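(* Let $A\in\mathbb{R}^{m\times n}$ with $m\ge n$ have the singular value decomposition $A=U\Sigma V^T$, with singular values $\sigma_1\ge\sigma_2\ge\cdots\ge\sigma_n$ satisfying \[\sigma_1\ge\cdots\ge\sigma_k>\theta>\sigma_{k+1}\ge\cdots\ge\sigma_n\] for a given threshold $\theta>0$ and integer $k$. Let $b\le k$ be a positive integer (block size), $q\ge 0$ an integer (power parameter), and let $\Omega_1$ be an $n\times b$ standard Gaussian matrix. Let $\widehat Q_1\in\mathbb{R}^{m\times b}$ be a matrix with orthonormal columns spanning the range of $(AA^T)^qA\Omega_1$, let $\widehat U_1$ be a $b\times b$ orthogonal matrix whose columns are eigenvectors of $\widehat Q_1^TAA^T\widehat Q_1$ (ordered by decreasing eigenvalues), and set $Q_1=\widehat Q_1\widehat U_1$. Partition \[\widehat\Omega:=V^T\Omega_1=\begin{bmatrix}\widehat\Omega_1\\ \widehat\Omega_2\end{bmatrix},\qquad \widehat\Omega_1\in\mathbb{R}^{b\times b},\ \widehat\Omega_2\in\mathbb{R}^{(n-b)\times b},\] and assume $\widehat\Omega_1$ is nonsingular. For $1\le j\le b$ let $\hat\tau_j=\sigma_{b+1}/\sigma_j$. Let $\Sigma_{(b)\perp}$ denote the trailing $(m-b)\times(n-b)$ diagonal block of $\Sigma$ (containing $\sigma_{b+1},\dots,\sigma_n$). Then, for every integer $t$ with $b\le t\le k$, writing $U_{(t)}$ for the first $t$ columns of $U$: \[\|(I-Q_1Q_1^T)A\|_{\xi}\le\big(1+\hat\tau_b^{4q}\|\widehat\Omega_2\widehat\Omega_1^{-1}\|_2^2\big)^{1/2}\|\Sigma_{(b)\perp}\|_{\xi},\quad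 \xi\in\{2,F\},\] \[\sigma_j\ge\sigma_j(Q_1^TA)\ge\frac{\sigma_j}{\sqrt{1+\hat\tau_j^{4q+2}\|\widehat\Omega_2\widehat\Omega_1^{-1}\|_2^2}},\qquad 1\le j\le b,\] \[\mathbf{d}(\mathcal{R}(Q_1),\mathcal{R}(U_{(t)}))\le\Big(\frac{\sigma_{t+1}}{\sigma_b}\Big)^{2q+1}\|\widehat\Omega_2\widehat\Omega_1^{-1}\|_2 .\] Moreover, for $0<\delta<1$, with probability at least $1-\delta$, \[\|\widehat\Omega_2\|_2\|\widehat\Omega_1^{-1}\|_2\le\mathcal{C}_{\delta,b,b}=2e\sqrt{b}\,\frac{2}{\delta}\Big(\sqrt{n-b}+\sqrt{b}+\sqrt{2\log\tfrac{2}{\delta}}\Big).\]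
   Context: $\sigma_j(M)$ denotes the $j$-th largest singular value of $M$; $\|\cdot\|_2,\|\cdot\|_F$ are the spectral and Frobenius norms; $\mathcal{R}(\cdot)$ is the column space. For matrices $W_1\in\mathbb{R}^{m\times s}$, $Z_1\in\mathbb{R}^{m\times t}$ with orthonormal columns, $\mathcal{P}_{W}=WW^T$ and the deviation $\mathbf{d}(\mathcal{R}(W_1),\mathcal{R}(Z_1))=\|(I-\mathcal{P}_{Z_1})\mathcal{P}_{W_1}\|_2$. A standard Gaussian matrix has i.i.d. $N(0,1)$ entries. The general constant is $\mathcal{C}_{\delta,r,\ell}=\frac{2e\sqrt{\ell}}{\ell-r+1}(2/\delta)^{1/(\ell-r+1)}(\sqrt{n-r}+\sqrt r+\sqrt{2\log(2/\delta)})$, here with $r=\ell=b$. *)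

(* Defs.v *)
From HB Require Import structures.
From mathcomp Require Import all_boot all_order all_algebra.
From mathcomp Require Import all_classical all_reals all_analysis.
Set Implicit Arguments. Unset Strict Implicit. Unset Printing Implicit Defensive.
Import Order.TTheory GRing.Theory Num.Theory.
Local Open Scope classical_set_scope.
Local Open Scope ring_scope.

Section Defs.
Variable R : realType.

(* entry (i,j) of a matrix with natural-number (0-based) indices; 0 outside *)
Definition mxnat {p r : nat} (M : 'M[R]_(p, r)) (i j : nat) : R :=
  match @insub nat (fun x => x < p)%N 'I_p i, @insub nat (fun x => x < r)%N 'I_r j with
  | Some i', Some j' => M i' j'
  | _, _ => 0
  end.

Definition vnorm {p : nat} (x : 'cV[R]_p) : R :=
  Num.sqrt (\sum_(i < p) x i 0 ^+ 2).

Definition norm2 {p r : nat} (M : 'M[R]_(p, r)) : R :=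
  sup [set y : R | exists x : 'cV[R]_r, vnorm x = 1 /\ y = vnorm (M *m x)].

Definition normF {p r : nat} (M : 'M[R]_(p, r)) : R :=
  Num.sqrt (\sum_(i < p) \sum_(j < r) M i j ^+ 2).

Definition orthonormal_cols {p r : nat} (M : 'M[R]_(p, r)) : Prop :=
  M^T *m M = 1%:M.

(* rectangular "diagonal" matrix with diagonal s 1, s 2, ... (1-indexed) *)
Definition rdiag (p r : nat) (s : nat -> R) : 'M[R]_(p, r) :=
  \matrix_(i < p, j < r) (if (i : nat) == j then s j.+1 else 0).

Definition svd {p r : nat} (M : 'M[R]_(p, r)) (U : 'M[R]_p) (s : nat -> R)
    (V : 'M[R]_r) : Prop :=
  [/\ U^T *m U = 1%:M, V^T *m V = 1%:M,
      M = U *m rdiag p r s *m V^T,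
      (forall j, (1 <= j)%N -> (j < minn p r)%N -> s j.+1 <= s j) &
      (forall j, (1 <= j <= minn p r)%N -> 0 <= s j)].

(* deviation d(R(W),R(Z)) = ||(I - Z Z^T) W W^T||_2 for orthonormal W, Z *)
Definition deviation {p s t : nat} (W : 'M[R]_(p, s)) (Z : 'M[R]_(p, t)) : R :=
  norm2 ((1%:M - Z *m Z^T) *m (W *m W^T)).

Definition leadcols {p r : nat} (t : nat) (M : 'M[R]_(p, r)) : 'M[R]_(p, t) :=
  \matrix_(i < p, j < t) mxnat M i j.

Definition toprows {p r : nat} (c : nat) (M : 'M[R]_(p, r)) : 'M[R]_(c, r) :=
  \matrix_(i < c, j < r) mxnat M i j.
Definition botrows {p r : nat} (c : nat) (M : 'M[R]_(p, r)) : 'M[R]_(p - c, r) :=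
  \matrix_(i < p - c, j < r) mxnat M (c + i) j.

Definition trailblock {p r : nat} (c : nat) (M : 'M[R]_(p, r)) : 'M[R]_(p - c, r - c) :=
  \matrix_(i < p - c, j < r - c) mxnat M (c + i) (c + j).

(* a random p x r matrix with i.i.d. N(0,1) entries: every entry is
   measurable and the joint law agrees with the product of standard normal
   laws on all measurable rectangles. *)
Definition std_gaussian_mx (d : measure_display) (T : measurableType d)
    (P : probability T R) (p r : nat) (G : T -> 'M[R]_(p, r)) : Prop :=
  (forall i j, measurable_fun setT (fun w => G w i j)) /\
  (forall B : 'I_p -> 'I_r -> set R, (forall i j, measurable (B i j)) ->
     P [set w | forall i j, B i j (G w i j)] =
     (\prod_(i < p) \prod_(j < r) normal_prob (0 : R) 1 (B i j))%E).

Definition Cconst (n : nat) (delta : R) (r l : nat) : R :=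
  2 * expR 1 * Num.sqrt l%:R / (l - r + 1)%:R * powR (2 / delta) ((l - r + 1)%:R^-1)
  * (Num.sqrt (n - r)%:R + Num.sqrt r%:R + Num.sqrt (2 * ln (2 / delta))).

End Defs.

(* Main.v *)
Require Import Defs.
From HB Require Import structures.
From mathcomp Require Import all_boot all_order all_algebra.
From mathcomp Require Import all_classical all_reals all_analysis.
From mathcomp Require Import measurable_realfun ring lra.
Set Implicit Arguments. Unset Strict Implicit. Unset Printing Implicit Defensive.
Import Order.TTheory GRing.Theory Num.Theory.
Import numFieldNormedType.Exports.
Local Open Scope classical_set_scope.
Local Open Scope ring_scope.

(** In the left singular basis of [A], the range of [(A A^T)^q A Omega] is the
    column space of [[I; F]], where [F = S2^(2q+1) X S1^-(2q+1)] and
    [X = Omega_2 Omega_1^-1].  The residual vanishes on this space, so it is at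
    most the norm of [A] minus any matrix with columns in it; the singular values
    are compared by intersecting subspaces of complementary dimensions; the
    deviation is read off the lower rows of [F].

    For a Gaussian [Omega], Givens rotations (two affine changes of variables in
    the plane) show that linear combinations of the entries are Gaussian and that
    rotating columns preserves the law.  The determinant of [Omega_1] is a
    combination of the entries of any one column with independent coefficients,
    which gives [P(|v Omega_1^-1| > x) <= sqrt(2/pi) |v| / x] for a coordinate
    vector [v], hence for every [v] by rotation; averaging over all sign vectors
    [v] bounds the spectral norm of [Omega_1^-1].  For [Omega_2] a Chernoff bound
    is summed over a grid with Gaussian weights, to which unit vectors are rounded
    coordinate by coordinate.  The constants [2 e] and [2 / delta] leave enough
    room for a union bound. *)

(** * Euclidean, spectral and Frobenius norms *)

(** The tail bounds are stated for [V^T *m Om] with [V] having orthonormal columns. The two blocks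
    of [V^T Omega] are then two choices of [V], the law of [V^T Omega] is never computed, and only
    the columns of [Om] are ever rotated. For a fixed row [v] the bound on the tail of
    [|v Omega_1^-1|] decays only like [1 / x]. This is why [2 / delta] enters to the first power,
    and it shapes the passage to the spectral norm: a union bound over a net of directions would
    cost a factor exponential in [b], and one over the rows a higher power of [b]. Sign vectors have
    norm [sqrt b] and all enter one average, so the cost is [sqrt b] times a constant. The second
    moment must be truncated, because [2 x] times a tail [1 / x] has a divergent integral; the
    fourth moment bounds what truncation loses. For [Omega_2] the grid points are not kept near the
    sphere. A penalty quadratic in their norm turns the union bound into a sum of Gaussian weights,
    which factors over coordinates and is bounded independently of the extent and mesh of the grid
    once the weights decay fast enough. *)

Section vector_norm.
Variable R : realType.
Implicit Types (p r : nat).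

Lemma vnorm_ge0 p (x : 'cV[R]_p) : 0 <= vnorm x.
Proof. exact: sqrtr_ge0. Qed.

Lemma vnorm_sqr p (x : 'cV[R]_p) : vnorm x ^+ 2 = \sum_i x i 0 ^+ 2.
Proof. by rewrite sqr_sqrtr// sumr_ge0// => i _; rewrite sqr_ge0. Qed.

Lemma vnorm_dot p (x : 'cV[R]_p) : vnorm x ^+ 2 = (x^T *m x) 0 0.
Proof. by rewrite vnorm_sqr mxE; apply: eq_bigr => i _; rewrite mxE expr2. Qed.

Lemma vnorm0 p : vnorm (0 : 'cV[R]_p) = 0.
Proof. by rewrite /vnorm big1 ?sqrtr0// => i _; rewrite mxE expr0n. Qed.

Lemma vnorm_eq0 p (x : 'cV[R]_p) : (vnorm x == 0) = (x == 0).
Proof.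
apply/eqP/eqP => [x0|->]; last exact: vnorm0.
have : \sum_i x i 0 ^+ 2 == 0 by rewrite -vnorm_sqr x0 expr0n.
rewrite psumr_eq0 => [/allP H|i _]; last by rewrite sqr_ge0.
apply/colP => i; rewrite mxE; apply/eqP; rewrite -sqrf_eq0.
by apply: H; rewrite mem_index_enum.
Qed.

Lemma vnorm_gt0 p (x : 'cV[R]_p) : (0 < vnorm x) = (x != 0).
Proof. by rewrite lt_neqAle vnorm_ge0 andbT eq_sym vnorm_eq0. Qed.

Lemma vnormZ p (a : R) (x : 'cV[R]_p) : vnorm (a *: x) = `|a| * vnorm x.
Proof.
rewrite /vnorm (eq_bigr (fun i => a ^+ 2 * x i 0 ^+ 2)); last first.
  by move=> i _; rewrite mxE exprMn.
by rewrite -mulr_sumr sqrtrM ?sqr_ge0// sqrtr_sqr.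
Qed.

Lemma vnormN p (x : 'cV[R]_p) : vnorm (- x) = vnorm x.
Proof. by rewrite -scaleN1r vnormZ normrN1 mul1r. Qed.

Lemma vnorm_isometry p r (V : 'M[R]_(p, r)) (x : 'cV[R]_r) :
  V^T *m V = 1%:M -> vnorm (V *m x) = vnorm x.
Proof.
move=> VV; apply/eqP; rewrite -(eqrXn2 (n := 2))// ?vnorm_ge0//.
by rewrite !vnorm_dot trmx_mul -mulmxA (mulmxA V^T) VV mul1mx.
Qed.

Lemma vnormD_sqr p (x y : 'cV[R]_p) :
  vnorm (x + y) ^+ 2 = vnorm x ^+ 2 + (x^T *m y) 0 0 *+ 2 + vnorm y ^+ 2.
Proof.
rewrite !vnorm_sqr mxE -sumrMnl -!big_split/=; apply: eq_bigr => i _.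
by rewrite !mxE; ring.
Qed.

(** Cauchy-Schwarz: with [a = |y|^2] and [c = x . y], the squared norm of [a x - c y] is
    [a (a |x|^2 - c^2)], and [a > 0] can be cancelled. *)
Lemma dot_sqr_le p (x y : 'cV[R]_p) :
  ((x^T *m y) 0 0) ^+ 2 <= vnorm x ^+ 2 * vnorm y ^+ 2.
Proof.
have [->|y0] := eqVneq y 0.
  by rewrite mulmx0 mxE expr0n mulr_ge0// sqr_ge0.
have yp : 0 < vnorm y ^+ 2 by rewrite exprn_gt0// vnorm_gt0.
set a := vnorm y ^+ 2 in yp *; set c := (x^T *m y) 0 0.
have := sqr_ge0 (vnorm (a *: x - c *: y)).
have cE : ((a *: x)^T *m (- c *: y)) 0 0 = - (a * c) * c.
  have cS : c = \sum_i x i 0 * y i 0.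
    by rewrite /c mxE; apply: eq_bigr => i _; rewrite mxE.
  by rewrite mxE {3}cS mulr_sumr; apply: eq_bigr => i _; rewrite !mxE; ring.
rewrite -scaleNr vnormD_sqr !vnormZ cE !exprMn !real_normK ?num_real// -/a => h.
have : 0 <= a * (vnorm x ^+ 2 * a - c ^+ 2) by move: h; nra.
by rewrite pmulr_rge0// subr_ge0.
Qed.

Lemma dot_le p (x y : 'cV[R]_p) : (x^T *m y) 0 0 <= vnorm x * vnorm y.
Proof.
apply: le_trans (ler_norm _) _.
by rewrite -(ler_pXn2r (n := 2))// ?nnegrE ?mulr_ge0 ?vnorm_ge0// real_normK ?num_real// exprMn dot_sqr_le.
Qed.

Lemma vnormD p (x y : 'cV[R]_p) : vnorm (x + y) <= vnorm x + vnorm y.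
Proof.
rewrite -(ler_pXn2r (n := 2))// ?nnegrE ?addr_ge0 ?vnorm_ge0//.
by rewrite vnormD_sqr; have := dot_le x y; nra.
Qed.

End vector_norm.

Section operator_norm.
Variable R : realType.
Implicit Types (p r : nat).

Lemma normF_ge0 p r (M : 'M[R]_(p, r)) : 0 <= normF M.
Proof. exact: sqrtr_ge0. Qed.

Lemma normF_sqr p r (M : 'M[R]_(p, r)) : normF M ^+ 2 = \sum_i \sum_j M i j ^+ 2.
Proof. by rewrite sqr_sqrtr// sumr_ge0// => i _; rewrite sumr_ge0// => j _; rewrite sqr_ge0. Qed.

Lemma normF_cols p r (M : 'M[R]_(p, r)) : normF M ^+ 2 = \sum_j vnorm (col j M) ^+ 2.
Proof.
rewrite normF_sqr exchange_big; apply: eq_bigr => j _; rewrite vnorm_sqr.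
by apply: eq_bigr => i _; rewrite mxE.
Qed.

Lemma normF_tr p r (M : 'M[R]_(p, r)) : normF M^T = normF M.
Proof.
rewrite /normF exchange_big; congr Num.sqrt; apply: eq_bigr => i _.
by apply: eq_bigr => j _; rewrite mxE.
Qed.

Lemma vnorm_mul_normF p r (M : 'M[R]_(p, r)) (x : 'cV[R]_r) :
  vnorm (M *m x) <= normF M * vnorm x.
Proof.
rewrite -(ler_pXn2r (n := 2))// ?nnegrE ?mulr_ge0 ?vnorm_ge0 ?normF_ge0//.
rewrite exprMn -normF_tr normF_cols vnorm_sqr mulr_suml; apply: ler_sum => i _.
have -> : (M *m x) i 0 = ((col i M^T)^T *m x) 0 0.
  by rewrite !mxE; apply: eq_bigr => j _; rewrite !mxE.
exact: dot_sqr_le.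
Qed.

(** The supremum in [norm2] is over unit vectors, so [x] is normalized; the Frobenius norm shows
    that the set is bounded above, which makes its supremum an actual bound. *)
Lemma vnorm_mul_norm2 p r (M : 'M[R]_(p, r)) (x : 'cV[R]_r) :
  vnorm (M *m x) <= norm2 M * vnorm x.
Proof.
have [->|x0] := eqVneq x 0; first by rewrite mulmx0 !vnorm0 mulr0.
have xp : 0 < vnorm x by rewrite vnorm_gt0.
rewrite -ler_pdivrMr//.
have -> : vnorm (M *m x) / vnorm x = vnorm (M *m ((vnorm x)^-1 *: x)).
  by rewrite -scalemxAr vnormZ ger0_norm ?invr_ge0 ?vnorm_ge0// mulrC.
apply: (@ub_le_sup R [set y : R | exists x : 'cV[R]_r, vnorm x = 1 /\ y = vnorm (M *m x)]).
  exists (normF M) => _ [z [z1 ->]]; by rewrite -[normF M]mulr1 -z1 vnorm_mul_normF.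
exists ((vnorm x)^-1 *: x); split => //.
by rewrite vnormZ ger0_norm ?invr_ge0 ?vnorm_ge0// mulVf// gt_eqF.
Qed.

Lemma norm2_ge0 p r (M : 'M[R]_(p, r)) : 0 <= norm2 M.
Proof.
have [[x x1]|H] := pselect (exists x : 'cV[R]_r, vnorm x = 1).
  by apply: le_trans (vnorm_ge0 (M *m x)) _; rewrite -[norm2 M]mulr1 -x1 vnorm_mul_norm2.
(* There is no unit vector when [r = 0]; the supremum of the empty set is [0] by convention. *)
rewrite /norm2 (_ : [set y | _] = set0) ?sup0//.
by apply/seteqP; split => // y /= [x [x1 _]]; apply: H; exists x.
Qed.

Lemma norm2_le p r (M : 'M[R]_(p, r)) (C : R) : 0 <= C ->
  (forall x, vnorm (M *m x) <= C * vnorm x) -> norm2 M <= C.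
Proof.
move=> C0 h; have [[x x1]|H] := pselect (exists x : 'cV[R]_r, vnorm x = 1).
  apply: ge_sup; first by exists (vnorm (M *m x)), x.
  by move=> _ [z [z1 ->]]; rewrite -[C]mulr1 -z1.
rewrite /norm2 (_ : [set y | _] = set0) ?sup0//.
by apply/seteqP; split => // y /= [x [x1 _]]; apply: H; exists x.
Qed.

(** [|M^T x|^2 = x . (M M^T x) <= |x| |M| |M^T x|], and one factor [|M^T x|] cancels. *)
Lemma norm2_tr_le p r (M : 'M[R]_(p, r)) : norm2 M^T <= norm2 M.
Proof.
apply: norm2_le => [|x]; first exact: norm2_ge0.
have [->|y0] := eqVneq (M^T *m x) 0; first by rewrite vnorm0 mulr_ge0 ?norm2_ge0 ?vnorm_ge0.
have yp : 0 < vnorm (M^T *m x) by rewrite vnorm_gt0.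
rewrite -(ler_pM2r yp) -expr2 vnorm_dot trmx_mul trmxK -mulmxA.
apply: le_trans (dot_le _ _) _; rewrite mulrAC [leRHS]mulrC ler_wpM2l ?vnorm_ge0//.
exact: vnorm_mul_norm2.
Qed.

Lemma norm2_tr p r (M : 'M[R]_(p, r)) : norm2 M^T = norm2 M.
Proof. by apply/eqP; rewrite eq_le norm2_tr_le -{1}(trmxK M) norm2_tr_le. Qed.

Lemma normF_mull p r s (M : 'M[R]_(p, r)) (N : 'M[R]_(r, s)) :
  normF (M *m N) <= norm2 M * normF N.
Proof.
rewrite -(ler_pXn2r (n := 2))// ?nnegrE ?mulr_ge0 ?norm2_ge0 ?normF_ge0//.
rewrite exprMn !normF_cols mulr_sumr; apply: ler_sum => j _.
rewrite -exprMn ler_pXn2r// ?nnegrE ?mulr_ge0 ?vnorm_ge0 ?norm2_ge0//.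
by rewrite !colE -mulmxA vnorm_mul_norm2.
Qed.

Lemma normF_mulr p r s (M : 'M[R]_(p, r)) (N : 'M[R]_(r, s)) :
  normF (M *m N) <= normF M * norm2 N.
Proof. by rewrite -normF_tr trmx_mul mulrC -(norm2_tr N) -(normF_tr M) normF_mull. Qed.

End operator_norm.

(** * Blocks of rows as submatrices *)

Section row_selection.
Variable R : realType.

Lemma mxnat_ord p r (M : 'M[R]_(p, r)) (i : 'I_p) (j : 'I_r) : mxnat M i j = M i j.
Proof. by rewrite /mxnat !valK. Qed.

Lemma bot_ord_proof (p c : nat) (i : 'I_(p - c)) : (c + i < p)%N.
Proof. by rewrite -ltn_subRL. Qed.

Definition bot_ord (p c : nat) (i : 'I_(p - c)) : 'I_p := Ordinal (bot_ord_proof i).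

Lemma bot_ord_inj (p c : nat) : injective (@bot_ord p c).
Proof. by move=> i j /(congr1 val)/= /addnI/val_inj. Qed.

Lemma toprowsE p r c (le_cp : (c <= p)%N) (M : 'M[R]_(p, r)) :
  toprows c M = rowsub (widen_ord le_cp) M.
Proof. by apply/matrixP => i j; rewrite !mxE (mxnat_ord M (widen_ord le_cp i)). Qed.

Lemma botrowsE p r c (M : 'M[R]_(p, r)) : botrows c M = rowsub (@bot_ord p c) M.
Proof. by apply/matrixP => i j; rewrite !mxE (mxnat_ord M (bot_ord i)). Qed.

Lemma rowsub_trmul p r c (f : 'I_c -> 'I_p) (V : 'M[R]_p) (M : 'M[R]_(p, r)) :
  rowsub f (V^T *m M) = (colsub f V)^T *m M.
Proof. by apply/matrixP => i j; rewrite !mxE; apply: eq_bigr => k _; rewrite !mxE. Qed.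

Lemma colsub_isometry p c (f : 'I_c -> 'I_p) (V : 'M[R]_p) : injective f ->
  V^T *m V = 1%:M -> (colsub f V)^T *m colsub f V = 1%:M.
Proof.
move=> finj VV; apply/matrixP => i j; move/matrixP: VV => /(_ (f i) (f j)).
rewrite !mxE (inj_eq finj) => <-; apply: eq_bigr => k _; by rewrite !mxE.
Qed.

End row_selection.

(** * Coordinates indexed by natural numbers, extended by zero *)

Section nat_coordinates.
Variable R : realType.
Implicit Types (p r c : nat).

Lemma mxnat_row_ge p r (M : 'M[R]_(p, r)) i j : (p <= i)%N -> mxnat M i j = 0.
Proof. by move=> pi; rewrite /mxnat; case: insubP => // u; rewrite ltnNge pi. Qed.

Lemma mxnat_mul p r c (M : 'M[R]_(p, r)) (N : 'M[R]_(r, c)) (i : nat) (j : 'I_c) :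
  mxnat (M *m N) i j = \sum_(l < r) mxnat M i l * N l j.
Proof.
have [ip|ip] := ltnP i p.
  rewrite (mxnat_ord (M *m N) (Ordinal ip)) mxE; apply: eq_bigr => l _.
  by rewrite (mxnat_ord M (Ordinal ip)).
by rewrite mxnat_row_ge// big1// => l _; rewrite mxnat_row_ge// mul0r.
Qed.

Lemma mxnat_toprows p r c (M : 'M[R]_(p, r)) i (j : 'I_r) :
  (i < c)%N -> mxnat (toprows c M) i j = mxnat M i j.
Proof. by move=> ic; rewrite (mxnat_ord (toprows c M) (Ordinal ic)) mxE. Qed.

Lemma mxnat_botrows p r c (M : 'M[R]_(p, r)) i (j : 'I_r) :
  mxnat (botrows c M) i j = mxnat M (c + i) j.
Proof.
have [ip|ip] := ltnP i (p - c).
  by rewrite (mxnat_ord (botrows c M) (Ordinal ip)) mxE.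
by rewrite !mxnat_row_ge// -leq_subLR.
Qed.

Lemma mxnat_rdiag_mul p r c (s : nat -> R) (M : 'M[R]_(r, c)) (i : 'I_p) (j : 'I_c) :
  (rdiag p r s *m M) i j = s i.+1 * mxnat M i j.
Proof.
rewrite mxE; have [ir|ir] := ltnP i r.
  rewrite (bigD1 (Ordinal ir))//= mxE eqxx big1 ?addr0 => [|l].
    by rewrite (mxnat_ord M (Ordinal ir)).
  by rewrite -val_eqE/= => li; rewrite mxE eq_sym (negbTE li) mul0r.
rewrite mxnat_row_ge// mulr0 big1// => l _; rewrite mxE ifN ?mul0r//.
by rewrite gtn_eqF// (leq_trans (ltn_ord l)).
Qed.

Lemma toprows_mul p r c t (M : 'M[R]_(p, r)) (N : 'M[R]_(r, c)) :
  toprows t (M *m N) = toprows t M *m N.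
Proof.
apply/matrixP => i j; rewrite mxE mxnat_mul mxE; apply: eq_bigr => l _.
by rewrite mxE.
Qed.

Lemma botrows_mul p r c t (M : 'M[R]_(p, r)) (N : 'M[R]_(r, c)) :
  botrows t (M *m N) = botrows t M *m N.
Proof.
apply/matrixP => i j; rewrite mxE mxnat_mul mxE; apply: eq_bigr => l _.
by rewrite mxE.
Qed.

Lemma rdiagM p r c (s s' : nat -> R) : (c <= r)%N ->
  rdiag p r s *m rdiag r c s' = rdiag p c (fun j => s j * s' j).
Proof.
move=> cr; apply/matrixP => i j; rewrite mxnat_rdiag_mul.
rewrite [RHS]mxE; have [ij|ij] := eqVneq (i : nat) j.
  by rewrite ij (mxnat_ord _ (widen_ord cr j) j) mxE eqxx.
have [ir|ir] := ltnP i r; last by rewrite mxnat_row_ge// mulr0.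
by rewrite (mxnat_ord _ (Ordinal ir)) mxE /= (negbTE ij) mulr0.
Qed.

Lemma trmx_rdiag p r (s : nat -> R) : (rdiag p r s)^T = rdiag r p s.
Proof. by apply/matrixP => i j; rewrite !mxE eq_sym; case: eqVneq => // ->. Qed.

Lemma eq_rdiag p r (s s' : nat -> R) : (forall j, (1 <= j <= r)%N -> s j = s' j) ->
  rdiag p r s = rdiag p r s'.
Proof.
move=> ss'; apply/matrixP => i j; rewrite !mxE; case: ifP => // _.
by rewrite ss'//=; exact: ltn_ord.
Qed.

Lemma rdiag1 p : rdiag p p (fun=> 1 : R) = 1%:M.
Proof. by apply/matrixP => i j; rewrite !mxE -val_eqE; case: ifP. Qed.

Lemma vnorm_nat p (x : 'cV[R]_p) : vnorm x ^+ 2 = \sum_(0 <= i < p) mxnat x i 0%N ^+ 2.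
Proof.
rewrite vnorm_sqr big_mkord; apply: eq_bigr => i _.
by rewrite -(mxnat_ord x i 0).
Qed.

Lemma mxnat_rdiag_vec p r (s : nat -> R) (x : 'cV[R]_r) i : (i < p)%N ->
  mxnat (rdiag p r s *m x) i 0%N = s i.+1 * mxnat x i 0%N.
Proof.
move=> ip; have := mxnat_rdiag_mul s x (Ordinal ip) 0.
by rewrite -mxnat_ord.
Qed.

Lemma vnorm_botrows p c (x : 'cV[R]_p) :
  vnorm (botrows c x) ^+ 2 = \sum_(c <= i < p) mxnat x i 0%N ^+ 2.
Proof.
rewrite vnorm_nat -[c in RHS]add0n big_addn; apply: eq_bigr => i _.
by have := mxnat_botrows c x i 0; rewrite /= addnC => ->.
Qed.

Lemma vnorm_toprows p c (x : 'cV[R]_p) : 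
  vnorm (toprows c x) ^+ 2 = \sum_(0 <= i < c) mxnat x i 0%N ^+ 2.
Proof.
rewrite vnorm_nat; apply: eq_big_nat => i /andP[_ ic].
by have := mxnat_toprows x 0 ic => /= ->.
Qed.

Lemma vnorm_split p c (x : 'cV[R]_p) : (c <= p)%N ->
  vnorm x ^+ 2 = vnorm (toprows c x) ^+ 2 + vnorm (botrows c x) ^+ 2.
Proof. by move=> cp; rewrite vnorm_toprows vnorm_botrows vnorm_nat -big_cat_nat. Qed.

Lemma mxnat_sum_ge p q t (x : 'cV[R]_p) (g : nat -> R) : (p <= q)%N ->
  \sum_(t <= i < q) g i * mxnat x i 0%N ^+ 2 = \sum_(t <= i < p) g i * mxnat x i 0%N ^+ 2.
Proof.
move=> pq; have [tp|pt] := leqP t p.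
  rewrite (big_cat_nat tp pq)/= [X in _ + X]big_nat_cond [X in _ + X]big1 ?addr0// => i /andP[/andP[pi _] _].
  by rewrite mxnat_row_ge// expr0n mulr0.
rewrite [RHS]big_geq ?(ltnW pt)// big_nat_cond big1// => i /andP[/andP[ti _] _].
by rewrite mxnat_row_ge ?expr0n ?mulr0// (leq_trans (ltnW pt)).
Qed.

End nat_coordinates.

(** * Deterministic error bounds *)

Section projector.
Variables (R : realType) (m b : nat) (Q : 'M[R]_(m, b)).
Hypothesis QQ : Q^T *m Q = 1%:M.

(** Pythagoras: [x] splits into the orthogonal parts [(I - Q Q^T) x] and [Q Q^T x], and [Q]
    preserves the norm of [Q^T x]. *)
Lemma vnorm_projC_sqr (x : 'cV[R]_m) :
  vnorm ((1%:M - Q *m Q^T) *m x) ^+ 2 = vnorm x ^+ 2 - vnorm (Q^T *m x) ^+ 2.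
Proof.
set y := Q *m Q^T *m x.
have xE : x = (1%:M - Q *m Q^T) *m x + y by rewrite -mulmxDl subrK mul1mx.
have yE : vnorm y = vnorm (Q^T *m x) by rewrite /y -mulmxA vnorm_isometry.
have o : (((1%:M - Q *m Q^T) *m x)^T *m y) 0 0 = 0.
  have -> : ((1%:M - Q *m Q^T) *m x)^T *m y = x^T *m ((1%:M - Q *m Q^T)^T *m (Q *m Q^T)) *m x.
    by rewrite trmx_mul /y !mulmxA.
  have -> : (1%:M - Q *m Q^T)^T *m (Q *m Q^T) = 0.
    rewrite linearB/= trmx1 trmx_mul trmxK mulmxBl mul1mx -!mulmxA (mulmxA Q^T Q) QQ mul1mx.
    by rewrite subrr.
  by rewrite mulmx0 mul0mx mxE.
by rewrite -yE {2}xE vnormD_sqr o mul0rn addr0 addrK.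
Qed.

Lemma vnorm_projC_le (x : 'cV[R]_m) : vnorm ((1%:M - Q *m Q^T) *m x) <= vnorm x.
Proof.
rewrite -(ler_pXn2r (n := 2))// ?nnegrE ?vnorm_ge0// vnorm_projC_sqr lerBlDr lerDl.
exact: sqr_ge0.
Qed.

Lemma vnorm_trmul_le (x : 'cV[R]_m) : vnorm (Q^T *m x) <= vnorm x.
Proof.
rewrite -(ler_pXn2r (n := 2))// ?nnegrE ?vnorm_ge0// -subr_ge0 -vnorm_projC_sqr.
exact: sqr_ge0.
Qed.

Lemma vnorm_projector_le (x : 'cV[R]_m) : vnorm (Q *m Q^T *m x) <= vnorm x.
Proof. by rewrite -mulmxA vnorm_isometry// vnorm_trmul_le. Qed.

End projector.

Section diagonal_norms.
Variable R : realType.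
Implicit Types (p r : nat).

(** A coordinate where [x] vanishes puts no constraint on the diagonal entry. In the comparison of
    singular values this discards the [j - 1] largest ones. *)
Lemma vnorm_rdiag_le p r (s : nat -> R) (x : 'cV[R]_r) (C : R) : 0 <= C ->
  (forall i, (i < p)%N -> (i < r)%N -> mxnat x i 0%N = 0 \/ `|s i.+1| <= C) ->
  vnorm (rdiag p r s *m x) <= C * vnorm x.
Proof.
move=> C0 h; rewrite -(ler_pXn2r (n := 2))// ?nnegrE ?mulr_ge0 ?vnorm_ge0//.
have le_term i : (i < p)%N -> mxnat (rdiag p r s *m x) i 0%N ^+ 2 <= C ^+ 2 * mxnat x i 0%N ^+ 2.
  move=> ip; rewrite mxnat_rdiag_vec// exprMn.
  have [ir|ir] := ltnP i r; last by rewrite mxnat_row_ge// expr0n !mulr0.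
  have [->|h'] := h i ip ir; first by rewrite expr0n !mulr0.
  rewrite ler_wpM2r ?sqr_ge0// -[s i.+1 ^+ 2]real_normK ?num_real//.
  by rewrite ler_pXn2r ?nnegrE.
rewrite exprMn vnorm_nat big_nat.
apply: (@le_trans _ _ (\sum_(0 <= i < p) C ^+ 2 * mxnat x i 0%N ^+ 2)).
  by rewrite [leRHS]big_nat; apply: ler_sum => i /andP[_ ip]; exact: le_term.
rewrite vnorm_nat mulr_sumr; have [pr|rp] := leqP p r.
  rewrite [leRHS](big_cat_nat (leq0n p) pr)/= lerDl; apply: sumr_ge0 => i _.
  by rewrite mulr_ge0 ?sqr_ge0.
by rewrite (mxnat_sum_ge 0 x (fun=> C ^+ 2) (ltnW rp)).
Qed.

Lemma vnorm_rdiag_ge p r (s : nat -> R) (x : 'cV[R]_r) (C : R) : (r <= p)%N -> 0 <= C ->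
  (forall i, (i < r)%N -> C <= s i.+1) -> C * vnorm x <= vnorm (rdiag p r s *m x).
Proof.
move=> rp C0 h; rewrite -(ler_pXn2r (n := 2))// ?nnegrE ?mulr_ge0 ?vnorm_ge0//.
rewrite exprMn !vnorm_nat (big_cat_nat (leq0n r) rp)/= mulr_sumr ler_wpDr//.
  by apply: sumr_ge0 => i _; exact: sqr_ge0.
rewrite !big_nat; apply: ler_sum => i /andP[_ ir].
rewrite mxnat_rdiag_vec ?(leq_trans ir)// exprMn ler_wpM2r ?sqr_ge0//.
by rewrite ler_pXn2r ?nnegrE ?h// (le_trans C0)// h.
Qed.

Lemma rdiag1_isometry p r : (r <= p)%N -> (rdiag p r (fun=> 1 : R))^T *m rdiag p r (fun=> 1) = 1%:M.
Proof.
move=> rp; rewrite trmx_rdiag rdiagM// -[RHS](rdiag1 R); congr rdiag.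
by apply/funext => j; rewrite mul1r.
Qed.

Lemma exists_ker p r (N : 'M[R]_(p, r)) : (p < r)%N ->
  exists x : 'cV[R]_r, x != 0 /\ N *m x = 0.
Proof.
move=> pr; exists (nz_row (kermx N^T))^T; split.
  apply/eqP => /(congr1 trmx); rewrite trmxK trmx0 => /eqP; rewrite nz_row_eq0.
  rewrite -mxrank_eq0 mxrank_ker mxrank_tr subn_eq0 leqNgt.
  by rewrite (leq_ltn_trans (rank_leq_row N)).
have /sub_kermxP h := nz_row_sub (kermx N^T).
by apply: trmx_inj; rewrite trmx_mul trmxK h trmx0.
Qed.

Lemma nonincr_from1 (s : nat -> R) (N : nat) :
  (forall j, (1 <= j)%N -> (j < N)%N -> s j.+1 <= s j) ->
  forall i j, (1 <= i)%N -> (i <= j)%N -> (j <= N)%N -> s j <= s i.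
Proof.
move=> h i j i1; elim: j => [|j IH]; first by rewrite leqn0 => /eqP i0; rewrite i0 in i1.
rewrite leq_eqVlt => /orP[/eqP -> //|ij jN].
by apply: le_trans (IH ij (ltnW jN)); apply: h => //; exact: leq_trans i1 ij.
Qed.

Lemma botrows_rdiag m n b c (s : nat -> R) (M : 'M[R]_(n, c)) :
  botrows b (rdiag m n s *m M) = rdiag (m - b) (n - b) (fun j => s (b + j)%N) *m botrows b M.
Proof.
apply/matrixP => i j; rewrite mxE mxnat_rdiag_mul mxnat_botrows.
have im : (b + i < m)%N by rewrite -ltn_subRL.
by rewrite (mxnat_ord _ (Ordinal im)) mxnat_rdiag_mul addnS.
Qed.

Lemma toprows_rdiag m n b c (s : nat -> R) (M : 'M[R]_(n, c)) : (b <= m)%N ->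
  toprows b (rdiag m n s *m M) = rdiag b b s *m toprows b M.
Proof.
move=> bm; apply/matrixP => i j; rewrite mxE mxnat_rdiag_mul mxnat_toprows//.
have im : (i < m)%N by exact: leq_trans bm.
by rewrite (mxnat_ord _ (Ordinal im)) mxnat_rdiag_mul.
Qed.

Lemma trailblock_rdiag m n b (s : nat -> R) :
  trailblock b (rdiag m n s) = rdiag (m - b) (n - b) (fun j => s (b + j)%N).
Proof.
apply/matrixP => i j; rewrite !mxE.
have im : (b + i < m)%N by rewrite -ltn_subRL.
have jn : (b + j < n)%N by rewrite -ltn_subRL.
by rewrite (mxnat_ord _ (Ordinal im) (Ordinal jn)) mxE/= eqn_add2l addnS.
Qed.

End diagonal_norms.

(** * The sketched range in the left singular basis *)

Section range_basis.
Variables (R : realType) (m n b q : nat) (sigma : nat -> R).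
Hypotheses (nm : (n <= m)%N) (bn : (b < n)%N).
Hypothesis sig_dec : forall i j, (1 <= i)%N -> (i <= j)%N -> (j <= n)%N -> sigma j <= sigma i.
Hypothesis sig_ge0 : forall j, (1 <= j <= n)%N -> 0 <= sigma j.
Hypothesis sigb : 0 < sigma b.
(** [Oi] stands for [V^T Omega Omega_1^-1]: multiplying by an invertible matrix on the right keeps
    the column space and makes the upper block the identity, so that the lower block is [X]. *)
Variable Oi : 'M[R]_(n, b).
Hypothesis topOi : toprows b Oi = 1%:M.
Local Notation X := (botrows b Oi).
Local Notation e := (2 * q + 1)%N.

(* In the left singular basis, the columns of (AA^T)^q A Omega span the same
   space as those of [I; F] with F = S2^(2q+1) X S1^-(2q+1). *)
Definition range_basis : 'M[R]_(m, b) :=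
  rdiag m n (fun j => sigma j ^+ e) *m Oi *m rdiag b b (fun j => sigma j ^- e).

Lemma sig_gt0 j : (1 <= j <= b)%N -> 0 < sigma j.
Proof.
by move=> /andP[j1 jb]; apply: lt_le_trans sigb _; apply: sig_dec => //; exact: ltnW.
Qed.

Let scale (c : 'cV[R]_b) := rdiag b b (fun j => sigma j ^- e) *m c.

Let basisE (c : 'cV[R]_b) : range_basis *m c = rdiag m n (fun j => sigma j ^+ e) *m (Oi *m scale c).
Proof. by rewrite /range_basis /scale !mulmxA. Qed.

Lemma range_basis_head (c : 'cV[R]_b) i : (i < b)%N -> mxnat (range_basis *m c) i 0%N = mxnat c i 0%N.
Proof.
move=> ib; have im : (i < m)%N by exact: leq_trans (ltn_trans ib bn) nm.
rewrite basisE mxnat_rdiag_vec//.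
have := mxnat_toprows (Oi *m scale c) 0 ib; rewrite /= toprows_mul topOi mul1mx => <-.
rewrite /scale mxnat_rdiag_vec// mulrA divff ?mul1r// expf_neq0// gt_eqF//.
exact: sig_gt0.
Qed.

Lemma vnorm_scale_le (c : 'cV[R]_b) j : (1 <= j <= b)%N ->
  (forall i, (j <= i)%N -> mxnat c i 0%N = 0) -> vnorm (scale c) <= sigma j ^- e * vnorm c.
Proof.
move=> j1b cj; have sj := sig_gt0 j1b; have /andP[j1 jb] := j1b.
rewrite -(ler_pXn2r (n := 2))// ?nnegrE ?mulr_ge0 ?vnorm_ge0 ?invr_ge0 ?exprn_ge0 ?(ltW sj)//.
rewrite exprMn !vnorm_nat mulr_sumr !big_nat; apply: ler_sum => i /andP[_ ib].
rewrite mxnat_rdiag_vec// exprMn; have [ji|ij] := leqP j i.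
  by rewrite cj// expr0n !mulr0.
rewrite ler_wpM2r ?sqr_ge0//.
have si : 0 < sigma i.+1 by apply: sig_gt0.
rewrite ler_pXn2r// ?nnegrE ?invr_ge0 ?exprn_ge0 ?(ltW sj) ?(ltW si)//.
rewrite lef_pV2 ?posrE ?exprn_gt0// lerXn2r ?nnegrE ?(ltW sj) ?(ltW si)//.
by apply: sig_dec => //; exact: ltnW (leq_ltn_trans jb bn).
Qed.

(** Two cases matter: [j = b] with general [c] and [t], for the deviation, and [t = b] with [c]
    supported on the first [j] coordinates, for the [j]-th singular value. The support of [c] is
    what allows [sigma j] in place of the smaller [sigma b]. *)
Lemma range_basis_tail (c : 'cV[R]_b) j t : (1 <= j <= b)%N -> (b <= t)%N -> (t < n)%N ->
  (forall i, (j <= i)%N -> mxnat c i 0%N = 0) ->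
  \sum_(t <= i < m) mxnat (range_basis *m c) i 0%N ^+ 2 <=
  ((sigma t.+1 / sigma j) ^+ e * norm2 X) ^+ 2 * vnorm c ^+ 2.
Proof.
move=> j1b bt tn cj.
have st : 0 <= sigma t.+1 by apply: sig_ge0.
have sj := sig_gt0 j1b.
apply: (@le_trans _ _ ((sigma t.+1 ^+ e) ^+ 2 * vnorm (botrows b (Oi *m scale c)) ^+ 2)).
  rewrite vnorm_botrows mulr_sumr.
  have -> : \sum_(t <= i < m) mxnat (range_basis *m c) i 0%N ^+ 2 =
     \sum_(t <= i < n) (sigma i.+1 ^+ e) ^+ 2 * mxnat (Oi *m scale c) i 0%N ^+ 2.
    rewrite -(mxnat_sum_ge _ _ (fun i => (sigma i.+1 ^+ e) ^+ 2) nm) !big_nat.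
    apply: eq_bigr => i /andP[_ im]; rewrite basisE mxnat_rdiag_vec// exprMn//.
  rewrite (big_cat_nat bt (ltnW tn))/= ler_wpDl//.
    by apply: sumr_ge0 => i _; rewrite mulr_ge0// sqr_ge0.
  rewrite !big_nat; apply: ler_sum => i /andP[ti im]; rewrite ler_wpM2r ?sqr_ge0//.
  rewrite ler_pXn2r// ?nnegrE ?exprn_ge0 ?sig_ge0// lerXn2r ?nnegrE ?sig_ge0//.
  exact: sig_dec.
rewrite -!exprMn ler_pXn2r// ?nnegrE ?mulr_ge0 ?exprn_ge0 ?vnorm_ge0 ?norm2_ge0 ?divr_ge0 ?(ltW sj)//.
rewrite botrows_mul; apply: (@le_trans _ _ (sigma t.+1 ^+ e * (norm2 X * (sigma j ^- e * vnorm c)))).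
  rewrite ler_wpM2l ?exprn_ge0//; apply: le_trans (vnorm_mul_norm2 _ _) _.
  by rewrite ler_wpM2l ?norm2_ge0// vnorm_scale_le.
by rewrite expr_div_n !mulrA [sigma t.+1 ^+ e * norm2 X * _]mulrAC.
Qed.

Lemma vnorm_range_basis (c : 'cV[R]_b) : vnorm (range_basis *m c) ^+ 2 =
  vnorm c ^+ 2 + \sum_(b <= i < m) mxnat (range_basis *m c) i 0%N ^+ 2.
Proof.
have bm : (b <= m)%N by exact: leq_trans (ltnW bn) nm.
rewrite vnorm_nat (big_cat_nat (leq0n b) bm)/= vnorm_nat; congr (_ + _).
by apply: eq_big_nat => i /andP[_ ib]; rewrite range_basis_head.
Qed.

Lemma vnorm_le_range_basis (c : 'cV[R]_b) : vnorm c <= vnorm (range_basis *m c).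
Proof.
rewrite -(ler_pXn2r (n := 2))// ?nnegrE ?vnorm_ge0// vnorm_range_basis lerDl.
by apply: sumr_ge0 => i _; rewrite sqr_ge0.
Qed.

Variables (U : 'M[R]_m) (V : 'M[R]_n) (Q : 'M[R]_(m, b)) (H H' : 'M[R]_b).
Hypotheses (UU : U^T *m U = 1%:M) (VV : V^T *m V = 1%:M) (QQ : Q^T *m Q = 1%:M).
(** [H] and [H'] witness the two inclusions between the column spaces of [U *m range_basis] and [Q].
    The residual and the singular values go through [UEQ], the deviation through [QUE]. *)
Hypotheses (UEQ : U *m range_basis = Q *m H) (QUE : Q = U *m range_basis *m H').
Local Notation A := (U *m rdiag m n sigma *m V^T).

(** [Q Q^T x] lies in the range, hence equals [U *m (range_basis *m c)] with
    [|c| <= |range_basis c| <= |x|]. Projecting off the first [t] columns of [U] keeps its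
    coordinates from [t] on, which [range_basis_tail] bounds. *)
Lemma deviation_range_le t : (b <= t)%N -> (t < n)%N -> (0 < b)%N ->
  deviation Q (leadcols t U) <= (sigma t.+1 / sigma b) ^+ e * norm2 X.
Proof.
move=> bt tn b0.
have st : 0 <= sigma t.+1 by apply: sig_ge0.
have C0 : 0 <= (sigma t.+1 / sigma b) ^+ e * norm2 X.
  by rewrite mulr_ge0 ?norm2_ge0// exprn_ge0// divr_ge0// ltW.
apply: norm2_le => // x.
set c := H' *m Q^T *m x.
have yE : Q *m Q^T *m x = U *m (range_basis *m c).
  by rewrite /c {1}QUE !mulmxA.
rewrite -!mulmxA (mulmxA Q) yE.
have tm : (t <= m)%N by exact: leq_trans (ltnW tn) nm.
apply: (@le_trans _ _ ((sigma t.+1 / sigma b) ^+ e * norm2 X * vnorm c)); last first.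
  rewrite ler_wpM2l//; apply: le_trans (vnorm_le_range_basis c) _.
  by rewrite -(vnorm_isometry _ UU) -yE vnorm_projector_le.
have /(_ (leadcols t U)) UtE : forall W : 'M[R]_(m, t), W = colsub (widen_ord tm) U ->
    vnorm ((1%:M - W *m W^T) *m (U *m (range_basis *m c))) ^+ 2 =
    \sum_(t <= i < m) mxnat (range_basis *m c) i 0%N ^+ 2.
  move=> W WE; move: (range_basis *m c) => z.
  (* In the basis [U] the complementary projector is diagonal. [rdiag] counts from 1, so [t < j]
     retains the 0-based coordinates [t, t + 1, ...]. *)
  have UW : U^T *m (1%:M - W *m W^T) *m U = rdiag m m (fun j => (t < j)%:R).
    rewrite mulmxBr mulmx1 mulmxBl UU.
    have -> : U^T *m (W *m W^T) *m U = rdiag m m (fun j => (j <= t)%N%:R).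
      have -> : W = U *m rdiag m t (fun=> 1).
        rewrite WE; apply/matrixP => i j; rewrite [LHS]mxE mxE (bigD1 (widen_ord tm j))//=.
        rewrite mxE/= eqxx mulr1 big1 ?addr0// => k; rewrite -val_eqE/= => kj.
        by rewrite mxE (negbTE kj) mulr0.
      rewrite trmx_mul trmx_rdiag -!mulmxA UU mulmx1 (mulmxA U^T) UU mul1mx.
      apply/matrixP => i j; rewrite mxnat_rdiag_mul mul1r [RHS]mxE.
      have [it|it] := ltnP i t.
        by rewrite (mxnat_ord _ (Ordinal it)) mxE/=; case: eqVneq => // <-; rewrite it.
      by rewrite mxnat_row_ge//; case: eqVneq => // <-; rewrite ltnNge it.
    apply/matrixP => i j; rewrite !mxE; have [->|ij] := eqVneq i j.
      have -> : (t < j.+1)%N = ~~ (j < t)%N by rewrite ltnS leqNgt.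
      by rewrite eqxx; case: (j < t)%N; rewrite /= ?subrr ?subr0.
    have /negbTE -> : (i : nat) != j by [].
    by rewrite subr0.
  rewrite -(vnorm_isometry _ (_ : U^T^T *m U^T = 1%:M)); last by rewrite trmxK; exact: mulmx1C.
  rewrite !mulmxA UW vnorm_nat.
  rewrite (big_cat_nat (leq0n t) tm)/= big_nat_cond big1 ?add0r => [|i /andP[/andP[_ it] _]]; last first.
    by rewrite mxnat_rdiag_vec ?(leq_trans it)// ltnS leqNgt it mul0r expr0n.
  apply: eq_big_nat => i /andP[ti im]; rewrite mxnat_rdiag_vec// ltnS ti mul1r//.
rewrite -(ler_pXn2r (n := 2))// ?nnegrE ?(mulr_ge0 C0) ?vnorm_ge0//.
rewrite UtE; last by apply/matrixP => i j; rewrite !mxE (mxnat_ord U i (widen_ord tm j)).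
rewrite [leRHS]exprMn; apply: range_basis_tail => //; first by rewrite b0 leqnn.
by move=> i bi; rewrite mxnat_row_ge.
Qed.

Let bm : (b <= m)%N. Proof. exact: leq_trans (ltnW bn) nm. Qed.

Lemma toprows_range_basis : toprows b range_basis = 1%:M.
Proof.
rewrite /range_basis toprows_mul toprows_rdiag// topOi mulmx1 rdiagM// -[RHS]rdiag1.
apply: eq_rdiag => j jb; rewrite divff// expf_neq0// gt_eqF//; exact: sig_gt0.
Qed.

(** The columns of [range_basis *m K] lie in the range, and its upper rows agree with those of
    [rdiag m n sigma]. The difference [N] has only lower rows, and these factor as the trailing
    block times [G]. The trailing block takes one power of [sigma] on the left and [K] cancels one
    on the right, so [G] carries the power [2 q] instead of [2 q + 1]: this is the origin of the
    exponent [4 q] in the residual bound. *)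
Let K := rdiag b b sigma *m toprows b (1%:M : 'M[R]_n).
Let G : 'M[R]_(n - b, n) := botrows b 1%:M -
  rdiag (n - b) (n - b) (fun j => sigma (b + j)%N ^+ (2 * q)) *m X *m
  rdiag b b (fun j => sigma j ^- (2 * q)) *m toprows b 1%:M.
Let N := rdiag m n sigma - range_basis *m K.

Let toprowsN : toprows b N = 0.
Proof.
have -> : toprows b N = toprows b (rdiag m n sigma *m 1%:M) - toprows b (range_basis *m K).
  rewrite mulmx1; apply/matrixP => i j; rewrite !mxE.
  have im : (i < m)%N by exact: leq_trans bm.
  by rewrite !(mxnat_ord _ (Ordinal im)) [LHS]mxE [X in _ + X]mxE.
by rewrite toprows_rdiag// toprows_mul toprows_range_basis mul1mx subrr.
Qed.

Let botrowsN : botrows b N = trailblock b (rdiag m n sigma) *m G.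
Proof.
have -> : botrows b N = botrows b (rdiag m n sigma *m 1%:M) - botrows b (range_basis *m K).
  rewrite mulmx1; apply/matrixP => i j; rewrite !mxE.
  by rewrite !(mxnat_ord _ (bot_ord i)) [LHS]mxE [X in _ + X]mxE.
rewrite botrows_rdiag -trailblock_rdiag /G mulmxBr; congr (_ - _).
rewrite /range_basis /K -!mulmxA botrows_rdiag botrows_mul.
have -> : rdiag (m - b) (n - b) (fun j => sigma (b + j)%N ^+ e) =
   trailblock b (rdiag m n sigma) *m rdiag (n - b) (n - b) (fun j => sigma (b + j)%N ^+ (2 * q)).
  rewrite trailblock_rdiag rdiagM//; apply: eq_rdiag => j _.
  by rewrite addn1 exprS.
rewrite -!mulmxA; do 3 congr (_ *m _); rewrite mulmxA rdiagM//; congr (_ *m _).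
apply: eq_rdiag => j jb; rewrite addn1 exprS invfM mulrC mulrA divff ?mul1r// gt_eqF//.
exact: sig_gt0.
Qed.

Let vnorm_resid z : vnorm (N *m z) = vnorm (trailblock b (rdiag m n sigma) *m G *m z).
Proof.
apply/eqP; rewrite -(eqrXn2 (n := 2))// ?vnorm_ge0//; apply/eqP.
rewrite (vnorm_split _ bm) toprows_mul toprowsN mul0mx vnorm0 expr0n add0r.
by rewrite botrows_mul botrowsN.
Qed.

Let residualE : (1%:M - Q *m Q^T) *m A = (1%:M - Q *m Q^T) *m U *m N *m V^T.
Proof.
have h : (1%:M - Q *m Q^T) *m U *m range_basis = 0.
  rewrite -(mulmxA (1%:M - _) U) UEQ (mulmxA (1%:M - _) Q) mulmxBl mul1mx.
  by rewrite -(mulmxA Q) QQ mulmx1 subrr mul0mx.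
rewrite /N (mulmxBr _ (rdiag m n sigma)) (mulmxA _ range_basis) h mul0mx subr0.
by rewrite !mulmxA.
Qed.

Let tau := sigma b.+1 / sigma b.

(** With [z1] and [z2] the norms of the upper and lower parts of [z], one has [|G z| <= z2 + g z1],
    and [(1 + g^2) (z1^2 + z2^2) - (z2 + g z1)^2 = (z1 - g z2)^2]. *)
Let norm2G : norm2 G <= Num.sqrt (1 + tau ^+ (4 * q) * norm2 X ^+ 2).
Proof.
have sb1 : 0 <= sigma b.+1 by apply: sig_ge0.
have tau0 : 0 <= tau by rewrite divr_ge0// ltW.
apply: norm2_le => [|z]; first exact: sqrtr_ge0.
set g := tau ^+ (2 * q) * norm2 X.
have -> : tau ^+ (4 * q) * norm2 X ^+ 2 = g ^+ 2.
  by rewrite /g [RHS]exprMn -exprM mulnAC.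
have g0 : 0 <= g by rewrite mulr_ge0 ?norm2_ge0// exprn_ge0.
have Gz : vnorm (G *m z) <= vnorm (botrows b z) + g * vnorm (toprows b z).
  rewrite /G mulmxBl -!mulmxA -!botrows_mul -!toprows_mul !mul1mx.
  apply: le_trans (vnormD _ _) _; rewrite vnormN lerD2l.
  set y := toprows b z.
  apply: (@le_trans _ _ (sigma b.+1 ^+ (2 * q) * (norm2 X * (sigma b ^- (2 * q) * vnorm y)))).
    apply: le_trans (vnorm_rdiag_le (C := sigma b.+1 ^+ (2 * q)) _ _) _; rewrite ?exprn_ge0//.
      move=> i inb _; right; have ibn : (b + i < n)%N by rewrite -ltn_subRL.
      have si : 0 <= sigma (b + i.+1) by apply: sig_ge0; rewrite addnS.
      rewrite ger0_norm ?exprn_ge0// lerXn2r ?nnegrE//.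
      by apply: sig_dec; rewrite ?addnS// ltnS leq_addr.
    rewrite ler_wpM2l ?exprn_ge0// botrows_mul; apply: le_trans (vnorm_mul_norm2 _ _) _.
    rewrite ler_wpM2l ?norm2_ge0//; apply: vnorm_rdiag_le.
      by rewrite invr_ge0 exprn_ge0// ltW.
    move=> i ib _; right; have si : 0 < sigma i.+1 by apply: sig_gt0.
    rewrite ger0_norm ?invr_ge0 ?exprn_ge0 ?(ltW si)// lef_pV2 ?posrE ?exprn_gt0//.
    rewrite lerXn2r ?nnegrE ?(ltW si) ?(ltW sigb)//; apply: sig_dec => //.
    exact: ltnW.
  by rewrite /g /tau expr_div_n !mulrA [sigma b.+1 ^+ _ * norm2 X * _]mulrAC.
apply: le_trans Gz _.
rewrite -(ler_pXn2r (n := 2))// ?nnegrE ?addr_ge0 ?(mulr_ge0 g0) ?mulr_ge0 ?vnorm_ge0 ?sqrtr_ge0//.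
rewrite exprMn sqr_sqrtr ?addr_ge0 ?sqr_ge0// (vnorm_split z (ltnW bn)).
set z1 := vnorm (toprows b z); set z2 := vnorm (botrows b z).
by have := sqr_ge0 (z1 - g * z2); nra.
Qed.

Let norm2_le1 p r (W : 'M[R]_(p, r)) : W^T *m W = 1%:M -> norm2 W <= 1.
Proof. by move=> WW; apply: norm2_le => // x; rewrite mul1r vnorm_isometry. Qed.

Let norm2_projC : norm2 (1%:M - Q *m Q^T) <= 1.
Proof. by apply: norm2_le => // x; rewrite mul1r vnorm_projC_le. Qed.

Lemma residual_norm2_le : norm2 ((1%:M - Q *m Q^T) *m A) <=
  Num.sqrt (1 + tau ^+ (4 * q) * norm2 X ^+ 2) * norm2 (trailblock b (rdiag m n sigma)).
Proof.
rewrite residualE; apply: norm2_le => [|x].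
  by rewrite mulr_ge0 ?sqrtr_ge0 ?norm2_ge0.
rewrite -!mulmxA; apply: le_trans (vnorm_projC_le QQ _) _; rewrite vnorm_isometry//.
rewrite vnorm_resid -mulmxA [in leRHS](mulrC (Num.sqrt _)) -[leRHS]mulrA.
apply: le_trans (vnorm_mul_norm2 _ _) _.
rewrite ler_wpM2l ?norm2_ge0//; apply: le_trans (vnorm_mul_norm2 _ _) _.
rewrite [X in _ * X <= _]vnorm_isometry; last by rewrite trmxK; exact: mulmx1C.
by rewrite ler_wpM2r ?vnorm_ge0// norm2G.
Qed.

Lemma residual_normF_le : normF ((1%:M - Q *m Q^T) *m A) <=
  Num.sqrt (1 + tau ^+ (4 * q) * norm2 X ^+ 2) * normF (trailblock b (rdiag m n sigma)).
Proof.
have NF : normF N = normF (trailblock b (rdiag m n sigma) *m G).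
  apply/eqP; rewrite -(eqrXn2 (n := 2))// ?normF_ge0//; apply/eqP.
  by rewrite !normF_cols; apply: eq_bigr => j _; rewrite !colE vnorm_resid.
rewrite residualE; apply: le_trans (normF_mulr _ _) _.
apply: (@le_trans _ _ (normF ((1%:M - Q *m Q^T) *m U *m N))).
  rewrite ler_piMr ?normF_ge0//; apply: norm2_le1; rewrite trmxK; exact: mulmx1C.
rewrite -mulmxA; apply: le_trans (normF_mull _ _) _.
apply: (@le_trans _ _ (normF (U *m N))); first by rewrite ler_piMl ?normF_ge0.
apply: le_trans (normF_mull _ _) _.
apply: (@le_trans _ _ (normF N)); first by rewrite ler_piMl ?normF_ge0// norm2_le1.
rewrite NF; apply: le_trans (normF_mulr _ _) _.
by rewrite mulrC ler_wpM2r ?normF_ge0// norm2G.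
Qed.

Variables (Us : 'M[R]_b) (s : nat -> R) (Vs : 'M[R]_n).
Hypothesis sB : svd (Q^T *m A) Us s Vs.

Let s_dec i j : (1 <= i)%N -> (i <= j)%N -> (j <= b)%N -> s j <= s i.
Proof.
move=> i1 ij jb; have [_ _ _ dec _] := sB; apply: (nonincr_from1 (N := b)) => // l l1 lb.
by apply: dec => //; rewrite (minn_idPl (ltnW bn)).
Qed.

Let s_ge0 j : (1 <= j <= b)%N -> 0 <= s j.
Proof. by move=> jb; have [_ _ _ _] := sB; apply; rewrite (minn_idPl (ltnW bn)). Qed.

(* A j-dimensional subspace always meets the kernel of j - 1 linear forms. *)
Lemma singular_value_le j : (1 <= j <= b)%N -> s j <= sigma j.
Proof.
move=> j1b; have /andP[j1 jb] := j1b; have [UsUs VsVs BE _ _] := sB.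
have jn : (j <= n)%N by exact: leq_trans jb (ltnW bn).
have pj : (j.-1 < j)%N by rewrite prednK.
(* [x] holds coefficients on the first [j] right singular vectors of [Q^T A]; the kernel condition
   makes the resulting vector orthogonal to the first [j - 1] columns of [V]. *)
have [x [x0 Nx]] := exists_ker (toprows j.-1 (V^T *m Vs *m rdiag n j (fun=> 1))) pj.
have xp : 0 < vnorm x by rewrite vnorm_gt0.
set y := rdiag n j (fun=> 1) *m x.
have yx : vnorm y = vnorm x by rewrite vnorm_isometry//; exact: rdiag1_isometry.
rewrite -(ler_pM2r xp).
apply: (@le_trans _ _ (vnorm (Q^T *m A *m (Vs *m y)))).
  rewrite BE -!mulmxA (mulmxA Vs^T) VsVs mul1mx vnorm_isometry// /y mulmxA rdiagM//.
  apply: vnorm_rdiag_ge => //; first exact: s_ge0.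
  by move=> i ij; rewrite mulr1; apply: s_dec.
rewrite -mulmxA; apply: le_trans (vnorm_trmul_le QQ _) _.
rewrite -!mulmxA vnorm_isometry//.
have zE : vnorm (V^T *m (Vs *m y)) = vnorm x.
  rewrite vnorm_isometry; first by rewrite vnorm_isometry.
  by rewrite trmxK; exact: mulmx1C.
rewrite -zE; apply: vnorm_rdiag_le => [|i im ir].
  by apply: sig_ge0; rewrite j1.
have [ij|ji] := ltnP i j.-1; [left|right].
  have := mxnat_toprows (V^T *m (Vs *m y)) 0 ij => /= <-.
  rewrite (_ : toprows _ _ = 0) ?(mxnat_ord _ (Ordinal ij) 0) ?mxE//.
  by rewrite -Nx -toprows_mul /y !mulmxA.
have si : 0 <= sigma i.+1 by apply: sig_ge0.
by rewrite ger0_norm//; apply: sig_dec => //; rewrite -(prednK j1) ltnS.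
Qed.

(** Let [B = Q^T A]. Choose [c] supported on the first [j] coordinates with [H c] orthogonal to the
    first [j - 1] left singular vectors of [B]. Then [|B^T H c| <= s j |H c|], where
    [|H c| = |range_basis c|] is at most the square root times [|c|]. On the other side, [B^T H c]
    is an isometric image of [Sigma^T (range_basis c)], whose first [j] coordinates alone have norm
    at least [sigma j |c|]. *)
Lemma singular_value_ge j : (1 <= j <= b)%N ->
  sigma j / Num.sqrt (1 + (sigma b.+1 / sigma j) ^+ (4 * q + 2) * norm2 X ^+ 2) <= s j.
Proof.
move=> j1b; have /andP[j1 jb] := j1b; have [UsUs VsVs BE _ _] := sB.
have sj := sig_gt0 j1b.
have pj : (j.-1 < j)%N by rewrite prednK.
have [c' [c0 Nc]] := exists_ker (toprows j.-1 (Us^T *m H *m rdiag b j (fun=> 1))) pj.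
set c := rdiag b j (fun=> 1) *m c'.
have cc' : vnorm c = vnorm c' by rewrite vnorm_isometry//; exact: rdiag1_isometry.
have cp : 0 < vnorm c by rewrite cc' vnorm_gt0.
have cj i : (j <= i)%N -> mxnat c i 0%N = 0.
  move=> ji; have [ib|ib] := ltnP i b; last by rewrite mxnat_row_ge.
  by rewrite mxnat_rdiag_vec// mxnat_row_ge// mulr0.
set g := (sigma b.+1 / sigma j) ^+ e * norm2 X.
have -> : (sigma b.+1 / sigma j) ^+ (4 * q + 2) * norm2 X ^+ 2 = g ^+ 2.
  by rewrite /g [RHS]exprMn -exprM mulnDl mul1n mulnAC.
have g1 : 0 < 1 + g ^+ 2 by rewrite ltr_pwDl// sqr_ge0.
rewrite ler_pdivrMr ?sqrtr_gt0// -(ler_pM2r cp).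
have yE : vnorm (H *m c) = vnorm (range_basis *m c).
  by rewrite -(vnorm_isometry _ QQ) mulmxA -UEQ -mulmxA vnorm_isometry.
have Ec : vnorm (range_basis *m c) <= Num.sqrt (1 + g ^+ 2) * vnorm c.
  rewrite -(ler_pXn2r (n := 2))// ?nnegrE ?mulr_ge0 ?sqrtr_ge0 ?vnorm_ge0//.
  rewrite vnorm_range_basis [leRHS]exprMn (sqr_sqrtr (ltW g1)) mulrDl mul1r lerD2l.
  exact: range_basis_tail.
apply: (@le_trans _ _ (s j * vnorm (H *m c))); last first.
  by rewrite yE -mulrA ler_wpM2l// s_ge0.
have BT : (Q^T *m A)^T *m (H *m c) = V *m (rdiag n m sigma *m (range_basis *m c)).
  rewrite trmx_mul trmxK -(mulmxA _ Q) (mulmxA Q) -UEQ -(mulmxA U range_basis).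
  move: (range_basis *m c) => z.
  by rewrite trmx_mul trmxK trmx_mul trmx_rdiag -!mulmxA (mulmxA U^T) UU mul1mx.
apply: (@le_trans _ _ (vnorm ((Q^T *m A)^T *m (H *m c)))).
  rewrite BT vnorm_isometry//.
  rewrite -(ler_pXn2r (n := 2))// ?nnegrE ?mulr_ge0 ?vnorm_ge0 ?(ltW sj)//.
  rewrite exprMn !vnorm_nat mulr_sumr (big_cat_nat (leq0n b) (ltnW bn))/= ler_wpDr//.
    by apply: sumr_ge0 => i _; exact: sqr_ge0.
  rewrite !big_nat; apply: ler_sum => i /andP[_ ib].
  rewrite mxnat_rdiag_vec ?(ltn_trans ib bn)// range_basis_head// exprMn.
  have [ij|ji] := ltnP i j; last by rewrite cj// expr0n !mulr0.
  have si : 0 < sigma i.+1 by apply: sig_gt0.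
  rewrite ler_wpM2r ?sqr_ge0// ler_pXn2r ?nnegrE ?(ltW sj) ?(ltW si)//.
  by apply: sig_dec => //; exact: leq_trans jb (ltnW bn).
rewrite BE trmx_mul trmxK trmx_mul trmx_rdiag -!mulmxA vnorm_isometry//.
have -> : vnorm (H *m c) = vnorm (Us^T *m (H *m c)).
  by rewrite [RHS]vnorm_isometry// trmxK; exact: mulmx1C.
apply: vnorm_rdiag_le => [|i ir ib]; first exact: s_ge0.
have [ij|ji] := ltnP i j.-1; [left|right].
  have := mxnat_toprows (Us^T *m (H *m c)) 0 ij => /= <-.
  rewrite (_ : toprows _ _ = 0) ?(mxnat_ord _ (Ordinal ij) 0) ?mxE//.
  by rewrite -Nc -toprows_mul /c !mulmxA.
by rewrite ger0_norm ?s_ge0//; apply: s_dec => //; rewrite -(prednK j1) ltnS.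
Qed.

End range_basis.

Lemma svd_power (R : realType) (m n q : nat) (U : 'M[R]_m) (V : 'M[R]_n) (sigma : nat -> R) :
  (n <= m)%N -> U^T *m U = 1%:M -> V^T *m V = 1%:M ->
  let A := U *m rdiag m n sigma *m V^T in
  (A *m A^T) ^+ q *m A = U *m rdiag m n (fun j => sigma j ^+ (2 * q + 1)) *m V^T.
Proof.
move=> nm UU VV A; elim: q => [|q IH].
  by rewrite expr0 mul1mx.
rewrite exprS -[_ * _]/(_ *m _) -mulmxA IH /A !trmx_mul trmxK trmx_rdiag.
have -> : U *m rdiag m n sigma *m V^T *m (V *m (rdiag n m sigma *m U^T)) *m
    (U *m rdiag m n (fun j => sigma j ^+ (2 * q + 1)) *m V^T) =
  U *m (rdiag m n sigma *m (V^T *m V) *m (rdiag n m sigma *m (U^T *m U) *m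
    rdiag m n (fun j => sigma j ^+ (2 * q + 1)))) *m V^T by rewrite !mulmxA.
rewrite UU VV !mulmx1 !rdiagM//; congr (_ *m _ *m _); apply: eq_rdiag => j _.
by rewrite -exprS -exprS; congr (_ ^+ _); rewrite mulnS.
Qed.

(** * Rotation invariance of Gaussian families *)

Section affine_change.
Variable R : realType.
Local Notation mu := (@lebesgue_measure R).
Implicit Types (a c : R).

Lemma measurable_affine a c :
  measurable_fun setT (fun x : measurableTypeR R => a * x + c : measurableTypeR R).
Proof. by apply: measurable_funD => //; apply: measurable_funM. Qed.

(** By uniqueness of Lebesgue measure it suffices to test half-open intervals. A negative [a]
    exchanges the open and the closed endpoint, which does not affect the length. *)
Lemma lebesgue_measure_affine a c (A : set R) : a != 0 -> measurable A ->
  (`|a|%:E * mu ((fun x => a * x + c)%R @^-1` A) = mu A)%E.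
Proof.
move=> a0 mA.
pose f : {mfun measurableTypeR R >-> measurableTypeR R} :=
  HB.pack (fun x : R => a * x + c)
   (isMeasurableFun.Build _ _ _ _ _ (@measurable_affine a c)).
have na0 : 0 < `|a| by rewrite normr_gt0.
apply/esym.
apply: (@lebesgue_measure_unique R
  (mscale (NngNum (ltW na0)) (pushforward mu f))) => //.
move=> X [[x y]] _ <-.
rewrite /= /pushforward/= /mscale/=.
have [ap|an] : 0 < a \/ a < 0.
  by move: a0; rewrite neq_lt => /orP[]; [right|left].
  rewrite [X in (_ * lebesgue_measure X)%E](_ : _ = `](x - c) / a, (y - c) / a]%classic); last first.
    apply/seteqP; split => z /=; rewrite !in_itv/= ltr_pdivrMr// ler_pdivlMr//;
    by rewrite ltrBlDr lerBrDr mulrC.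
  rewrite !lebesgue_measure_itv/= !lte_fin ltr_pM2r ?invr_gt0// ltrD2r.
  case: ifPn => _; last by rewrite mule0.
  rewrite -!EFinB -EFinM; congr EFin; rewrite gtr0_norm//; field; exact: a0.
rewrite [X in (_ * lebesgue_measure X)%E](_ : _ = `[(y - c) / a, (x - c) / a[%classic); last first.
  apply/seteqP; split => z /=; rewrite !in_itv/= ltr_ndivlMr// ler_ndivrMr//;
  by rewrite ltrBlDr lerBrDr mulrC andbC.
rewrite !lebesgue_measure_itv/= !lte_fin ltr_nM2r ?invr_lt0// ltrD2r.
case: ifPn => _; last by rewrite mule0.
rewrite -!EFinB -EFinM; congr EFin; rewrite ltr0_norm//; field; exact: a0.
Qed.

Lemma ge0_integral_affine a c (f : R -> \bar R) : a != 0 ->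
  measurable_fun setT f -> (forall x, (0 <= f x)%E) ->
  (\int[mu]_x f x = `|a|%:E * \int[mu]_x f (a * x + c)%R)%E.
Proof.
move=> a0 mf f0.
have mg := @measurable_affine a c.
have na0 : 0 < `|a| by rewrite normr_gt0.
pose pm : {measure set (measurableTypeR R) -> \bar R} :=
  measure_function_pushforward__canonical__measure_function_Measure mu mg.
transitivity (\int[mscale (NngNum (ltW na0)) pm]_x f x)%E.
  apply: eq_measure_integral => A mA _.
  exact/esym/lebesgue_measure_affine.
by rewrite ge0_integral_mscale// (ge0_integral_pushforward mg).
Qed.

End affine_change.

Section gaussian_rotation.
Variable R : realType.
Local Notation mu := (@lebesgue_measure R).
Local Notation phi := (@normal_pdf R 0 1).
Variables (c s : R).
Hypotheses (c0 : c != 0) (cs1 : c ^+ 2 + s ^+ 2 = 1).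

Definition rot2 (z : R * R) : R * R := (c * z.1 - s * z.2, s * z.1 + c * z.2).

Lemma measurable_rot2 : measurable_fun setT rot2.
Proof.
by apply/measurable_fun_pairP; split => /=; [apply: measurable_funB|apply: measurable_funD];
  apply: measurable_funM.
Qed.

(** The rotation is factored through one coordinate at a time: [x] is replaced by [u = c x - s y] at
    fixed [y], then [y] by [y / c + s u / c] at fixed [u], which is [s x + c y] because
    [c^2 + s^2 = 1]. The Jacobian factors [1 / |c|] and [|c|] cancel. *)
Lemma ge0_integral_rot2 (F : R * R -> \bar R) : measurable_fun setT F ->
  (forall z, (0 <= F z)%E) ->
  (\int[mu \x mu]_z F (rot2 z) = \int[mu \x mu]_z F z)%E.
Proof.
move=> mF F0.
pose H (z : R * R) := F (z.1, c^-1 * z.2 + (s * z.1 / c)).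
have mH : measurable_fun setT H.
  apply: measurableT_comp => //; apply: measurable_fun_pair => //.
  by apply: measurable_funD; do ?apply: measurable_funM.
have H0 z : (0 <= H z)%E by exact: F0.
have nc0 : `|c| != 0 by rewrite normr_eq0.
have mFr : measurable_fun setT (F \o rot2) by apply: measurableT_comp => //; exact: measurable_rot2.
rewrite [LHS](@fubini_tonelli2 _ _ _ _ R mu mu (F \o rot2) mFr (fun z => F0 _)).
transitivity (\int[mu]_y (`|c|^-1%:E * \int[mu]_x H (x, y)))%E.
  apply: eq_integral => y _; rewrite /fubini_G/=.
  have mHy : measurable_fun setT (fun x => H (x, y)) by exact: measurable_fun_pair1 mH.
  rewrite (ge0_integral_affine (- (s * y)) c0 mHy)//.
  rewrite muleA -EFinM mulVf// mul1e; apply: eq_integral => x _.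
  rewrite /H /rot2/=; congr (F (_, _)).
  rewrite (_ : c^-1 * y = c^-1 * ((c ^+ 2 + s ^+ 2) * y)); last by rewrite cs1 mul1r.
  by field.
rewrite ge0_integralZl//; last 2 first.
- by apply: (@measurable_fun_fubini_tonelli_G _ _ _ _ R mu H).
- by move=> y _; apply: integral_ge0.
rewrite -(@fubini_tonelli _ _ _ _ R mu mu H)// -ge0_integralZl//; last 2 first.
- by apply: (@measurable_fun_fubini_tonelli_F _ _ _ _ R mu H).
- by move=> y _; apply: integral_ge0.
rewrite (@fubini_tonelli1 _ _ _ _ R mu mu F)//; apply: eq_integral => x _; rewrite /fubini_F/=.
have ci0 : c^-1 != 0 by rewrite invr_eq0.
have mFx : measurable_fun setT (fun y => F (x, y)) by exact: measurable_fun_pair2 mF.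
rewrite [RHS](ge0_integral_affine (s * x / c) ci0 mFx)//.
by rewrite normfV.
Qed.

Definition gauss2 (C : set (R * R)) : \bar R :=
  (\int[mu \x mu]_(z in C) (phi z.1 * phi z.2)%:E)%E.

Lemma measurable_gauss2_pdf : measurable_fun setT (fun z : R * R => (phi z.1 * phi z.2)%:E).
Proof.
apply/measurable_EFinP; apply: measurable_funM;
 (apply: (measurableT_comp (measurable_normal_pdf 0 1)) => //).
Qed.

Let phi_ge0 (z : R * R) : (0 <= (phi z.1 * phi z.2)%:E)%E.
Proof. by rewrite lee_fin mulr_ge0// normal_pdf_ge0. Qed.

Lemma gauss2_rot2 C : measurable C -> gauss2 (rot2 @^-1` C) = gauss2 C.
Proof.
move=> mC; rewrite /gauss2 [LHS]integral_mkcond [RHS]integral_mkcond.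
rewrite -[RHS]ge0_integral_rot2.
- apply: eq_integral => z _; rewrite /patch.
  have -> : (z \in rot2 @^-1` C) = (rot2 z \in C) by apply/idP/idP; rewrite !inE.
  case: ifP => // _; congr EFin.
  rewrite !normal_pdfE ?oner_eq0// mulrACA [RHS]mulrACA; congr (_ * _).
  rewrite /normal_fun -!expRD; congr expR; rewrite /rot2/= !subr0.
  have -> : (c * z.1 - s * z.2) ^+ 2 = (c ^+ 2 + s ^+ 2) * (z.1 ^+ 2 + z.2 ^+ 2) - (s * z.1 + c * z.2) ^+ 2 by ring.
  by rewrite cs1; ring.
- by apply/(measurable_restrictT _ mC); apply: measurable_funTS; exact: measurable_gauss2_pdf.
- by move=> z; rewrite /patch; case: ifP.
Qed.

Lemma gauss2X A B : measurable A -> measurable B ->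
  gauss2 (A `*` B) = (normal_prob 0 1 A * normal_prob (0 : R) 1 B)%E.
Proof.
move=> mA mB; have mr (D : set R) : measurable D ->
    measurable_fun setT ((fun x : R => (phi x)%:E) \_ D).
  move=> mD; apply/(measurable_restrictT _ _).1 => //; apply: measurable_funTS.
  by apply/measurable_EFinP; exact: measurable_normal_pdf.
rewrite /gauss2 integral_mkcond fubini_tonelli1.
- rewrite /normal_prob [X in (X * _)%E]integral_mkcond.
  rewrite [X in (_ * X)%E]integral_mkcond -ge0_integralZr//.
  + apply: eq_integral => x _; rewrite /fubini_F /patch.
    case: ifPn => xA; last first.
      rewrite mul0e; apply: integral0_eq => y _.
      by rewrite ifN//; apply/negP; rewrite inE => -[/= /mem_set]; rewrite (negbTE xA).
    rewrite -ge0_integralZl//; last 3 first.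
    * exact: mr.
    * by move=> y _; case: ifP => // _; rewrite lee_fin normal_pdf_ge0.
    * by rewrite lee_fin normal_pdf_ge0.
    apply: eq_integral => y _; rewrite in_setX xA/=.
    by case: ifP; rewrite ?mule0// EFinM.
  + exact: mr.
  + by move=> y _; rewrite /patch; case: ifP => // _; rewrite lee_fin normal_pdf_ge0.
  + by apply: integral_ge0 => y _; rewrite /patch; case: ifP => // _; rewrite lee_fin normal_pdf_ge0.
- apply/(measurable_restrictT _ _).1; first exact: measurableX.
  by apply: measurable_funTS; exact: measurable_gauss2_pdf.
- by move=> z; rewrite /patch; case: ifP.
Qed.

End gaussian_rotation.

Section gauss2_measure.
Variable R : realType.

Let gauss2_0 : @gauss2 R set0 = 0%E.
Proof. exact: integral_set0. Qed.

Let gauss2_ge0 C : (0 <= @gauss2 R C)%E.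
Proof.
by apply: integral_ge0 => z _; rewrite lee_fin mulr_ge0// normal_pdf_ge0.
Qed.

Let gauss2_sigma_additive : semi_sigma_additive (@gauss2 R).
Proof.
move=> A mA tA mUA; rewrite /gauss2 ge0_integral_bigcup//.
- by apply: is_cvg_ereal_nneg_natsum_cond => n _ _; exact: gauss2_ge0.
- by apply: measurable_funTS; exact: measurable_gauss2_pdf.
- by move=> z _; rewrite lee_fin mulr_ge0// normal_pdf_ge0.
Qed.

HB.instance Definition _ := isMeasure.Build _ _ _
  (@gauss2 R) gauss2_0 gauss2_ge0 gauss2_sigma_additive.
End gauss2_measure.

Lemma measure_unique_prod (R : realType) (d1 d2 : measure_display)
  (T1 : measurableType d1) (T2 : measurableType d2)
  (m1 m2 : {measure set (T1 * T2) -> \bar R}) : (m1 setT < +oo)%E ->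
  (forall A B, measurable A -> measurable B -> m1 (A `*` B) = m2 (A `*` B)) ->
  forall C, measurable C -> m1 C = m2 C.
Proof.
move=> m1oo m12 C mC.
apply: (measure_unique [set A `*` B | A in measurable & B in measurable] (fun=> setT)) => //.
- by rewrite measurable_prod_measurableType.
- move=> _ _ [A1 mA1 [B1 mB1 <-]] [A2 mA2 [B2 mB2 <-]]; rewrite -setXI.
  by exists (A1 `&` A2); [exact: measurableI|exists (B1 `&` B2) => //; exact: measurableI].
- by move=> _; exists setT => //; exists setT => //; rewrite setXTT.
- by rewrite bigcup_const.
- by move=> _ [A mA [B mB <-]]; exact: m12.
Qed.

Lemma measurable_forall_fin (d : measure_display) (T : measurableType d)
  (I : finType) (F : I -> set T) :
  (forall i, measurable (F i)) -> measurable [set w | forall i, F i w].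
Proof.
move=> mF; rewrite (_ : [set w | _] = \bigcap_(i in [set: I]) F i).
  by apply: fin_bigcap_measurable => //; exact: finite_finset.
by apply/seteqP; split => w /= h i; [move=> _|]; exact: h.
Qed.

Section gaussian_family.
Variables (R : realType) (d : measure_display) (T : measurableType d).
Variable P : probability T R.
Local Notation gamma := (@normal_prob R 0 1).

Definition gauss_family (I : finType) (X : I -> T -> R) : Prop :=
  (forall i, measurable_fun setT (X i)) /\
  forall B : I -> set R, (forall i, measurable (B i)) ->
    P [set w | forall i, B i (X i w)] = (\prod_(i : I) gamma (B i))%E.

Lemma measurable_rect (I : finType) (X : I -> T -> R) (B : I -> set R) :
  (forall i, measurable_fun setT (X i)) -> (forall i, measurable (B i)) ->
  measurable [set w | forall i, B i (X i w)].
Proof.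
move=> mX mB; apply: measurable_forall_fin => i.
by rewrite -[Y in measurable Y]setTI; exact: (mX i).
Qed.

Definition givens_fam (I : finType) (X : I -> T -> R) (i j : I) (c s : R) (k : I) w :=
  if k == i then c * X i w - s * X j w else
  if k == j then s * X i w + c * X j w else X k w.

(** On the event [D] that the other coordinates lie in their sets, the law of [(X i, X j)] is a
    constant multiple of the planar Gaussian measure: the two agree on rectangles, hence on all
    measurable sets, in particular on rotated rectangles. The invariance of [gauss2] then
    concludes. *)
Lemma gauss_family_givens (I : finType) (X : I -> T -> R) (i j : I) (c s : R) :
  i != j -> c != 0 -> c ^+ 2 + s ^+ 2 = 1 ->
  gauss_family X -> gauss_family (givens_fam X i j c s).
Proof.
move=> ij c0 cs1 [mX lX]; split.
  move=> k; rewrite /givens_fam; case: (k == i).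
    by apply: measurable_funB; apply: measurable_funM.
  by case: (k == j) => //; apply: measurable_funD; apply: measurable_funM.
move=> B mB.
pose Z w := (X i w, X j w).
have mZ : measurable_fun setT Z by exact: measurable_fun_pair.
pose D := [set w | forall k, k != i -> k != j -> B k (X k w)].
have mD : measurable D.
  rewrite (_ : D = [set w | forall k, (if (k == i) || (k == j) then setT else B k) (X k w)]).
    apply: (measurable_rect (B := fun k => if (k == i) || (k == j) then setT else B k)) => // k.
    by case: ifP.
  apply/seteqP; split => w /= h k.
    by case: ifPn => //; rewrite negb_or => /andP[]; exact: h.
  by move=> ki kj; move: (h k); rewrite (negbTE ki) (negbTE kj).
pose kap := (\prod_(k | (k != i) && (k != j)) gamma (B k))%E.
have kapfin : kap \is a fin_num.
  by apply: prode_fin_num => k _; apply: fin_num_measure; exact: mB.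
have kap0 : (0 <= kap)%E by apply: prode_ge0 => k _.
have fk0 : 0 <= fine kap by exact: fine_ge0.
pose m1 : {measure set (R * R) -> \bar R} :=
  measure_function_pushforward__canonical__measure_function_Measure (mrestr P mD) mZ.
pose m2 : {measure set (R * R) -> \bar R} := mscale (NngNum fk0) (@gauss2 R).
have prodE (B' : I -> set R) : (\prod_(k : I) gamma (B' k) =
    gamma (B' i) * (gamma (B' j) * \prod_(k | (k != i) && (k != j)) gamma (B' k)))%E.
  rewrite (bigD1 i)//= (bigD1 j)/=; last by rewrite eq_sym.
  by [].
have m12 C : measurable C -> m1 C = m2 C.
  apply: measure_unique_prod => [|A A' mA mA'].
    rewrite /m1/= /pushforward /mrestr.
    by rewrite (le_lt_trans (probability_le1 P _))//= ?ltry// setTI.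
  rewrite /m1/= /pushforward /mrestr /m2 /mscale/= fineK//.
  rewrite [X in X = _](_ : _ = P [set w | forall k, (if k == i then A else if k == j then A' else B k) (X k w)]).
    rewrite (lX (fun k => if k == i then A else if k == j then A' else B k)); last first.
      by move=> k; case: ifP => // _; case: ifP.
    rewrite prodE eqxx eq_sym (negbTE ij) eqxx gauss2X//.
    rewrite [X in (_ * (_ * X))%E](_ : _ = kap); last first.
      by apply: eq_bigr => k /andP[/negbTE -> /negbTE ->].
    by rewrite muleA muleC.
  congr (P _); apply/seteqP; split => w /=.
    move=> [[XA XA'] Dw] k; case: eqVneq => [->//|ki].
    by case: eqVneq => [->//|kj]; exact: Dw.
  move=> h; split; first split.
  - by move: (h i); rewrite eqxx.
  - by move: (h j); rewrite eq_sym (negbTE ij) eqxx.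
  - by move=> k ki kj; move: (h k); rewrite (negbTE ki) (negbTE kj).
have mBij : measurable (B i `*` B j) by exact: measurableX.
have mrB : measurable (rot2 c s @^-1` (B i `*` B j)).
  by rewrite -[Y in measurable Y]setTI; exact: measurable_rot2.
transitivity (m1 (rot2 c s @^-1` (B i `*` B j))).
  rewrite /m1/= /pushforward /mrestr; congr (P _); apply/seteqP; split => w /=.
    move=> h; split; first split => /=.
    - by move: (h i); rewrite /givens_fam eqxx.
    - by move: (h j); rewrite /givens_fam eq_sym (negbTE ij) eqxx.
    - by move=> k ki kj; move: (h k); rewrite /givens_fam (negbTE ki) (negbTE kj).
  move=> [[hi hj] Dw] k; rewrite /givens_fam; case: eqVneq => [->//|ki].
  by case: eqVneq => [->//|kj]; exact: Dw.
rewrite m12//; transitivity ((fine kap)%:E * gauss2 (B i `*` B j))%E.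
  by rewrite -(gauss2_rot2 c0 cs1 mBij).
rewrite gauss2X// fineK// prodE.
by rewrite muleC -muleA.
Qed.
End gaussian_family.

Section standard_normal.
Variable R : realType.
Local Notation gamma := (@normal_prob R 0 1).
Local Notation mu := (@lebesgue_measure R).

Lemma normal_prob_oppr (A : set R) : measurable A ->
  gamma [set x | A (- x)] = gamma A.
Proof.
move=> mA; rewrite /normal_prob [LHS]integral_mkcond [RHS]integral_mkcond.
have N10 : (-1 : R) != 0 by rewrite oppr_eq0 oner_eq0.
rewrite [RHS](ge0_integral_affine 0 N10).
- rewrite normrN1 mul1e; apply: eq_integral => x _; rewrite /patch mulN1r addr0.
  have -> : (x \in [set x | A (- x)]) = (- x \in A) by apply/idP/idP; rewrite !inE.
  case: ifP => // _; rewrite !normal_pdfE ?oner_eq0//.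
  by rewrite /normal_fun !subr0 sqrrN.
- apply/(measurable_restrictT _ _).1 => //; apply: measurable_funTS.
  by apply/measurable_EFinP; exact: measurable_normal_pdf.
- by move=> x; rewrite /patch; case: ifP => // _; rewrite lee_fin normal_pdf_ge0.
Qed.

(** For [x >= t >= 0], [t x >= t^2] shows that the standard density at [x] is at most
    [exp (- t^2 / 2)] times the density of [N(t, 1)], which integrates to 1. *)
Lemma normal_prob_ge (t : R) : 0 <= t ->
  (gamma [set x | (t <= x)%R] <= (expR (- (t ^+ 2 / 2)))%:E)%E.
Proof.
move=> t0; rewrite -[leRHS]mule1 -(integral_normal_pdf t 1) -ge0_integralZl//; last 2 first.
- by apply/measurable_EFinP; exact: measurable_normal_pdf.
- by move=> x _; rewrite lee_fin normal_pdf_ge0.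
rewrite /normal_prob [leLHS]integral_mkcond; apply: ge0_le_integral => //.
- by move=> x _; rewrite /patch; case: ifP => // _; rewrite lee_fin normal_pdf_ge0.
- apply/(measurable_restrictT _ _).1 => //; last first.
    apply: measurable_funTS; apply/measurable_EFinP; exact: measurable_normal_pdf.
  rewrite (_ : [set x | t <= x] = `[t, +oo[%classic)//.
  by apply/seteqP; split => x /=; rewrite in_itv/= andbT.
- by apply/measurable_EFinP; apply: measurable_funM => //; exact: measurable_normal_pdf.
- move=> x _; rewrite /patch; case: ifPn => [|_].
    rewrite inE/= => tx; rewrite -EFinM lee_fin !normal_pdfE ?oner_eq0//.
    rewrite mulrCA ler_wpM2l ?normal_peak_ge0// /normal_fun -expRD ler_expR subr0.
    rewrite expr1n.
    have : t * t <= t * x by rewrite ler_wpM2l.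
    nra.
  by rewrite mule_ge0// lee_fin ?expR_ge0// normal_pdf_ge0.
Qed.

Lemma normal_prob_ball (e : R) : 0 <= e ->
  (gamma [set x | (`|x| <= e)%R] <= (2 * normal_peak 1 * e)%:E)%E.
Proof.
move=> e0.
have -> : [set x | `|x| <= e] = `[- e, e]%classic.
  by apply/seteqP; split => x /=; rewrite in_itv/= ler_norml.
rewrite /normal_prob.
apply: (@le_trans _ _ (\int[mu]_(x in `[(- e)%R, e]%classic) (normal_peak 1)%:E)%E).
  apply: ge0_le_integral => //.
  - by move=> x _; rewrite lee_fin normal_pdf_ge0.
  - by apply/measurable_EFinP; apply: measurable_funTS; exact: measurable_normal_pdf.
  - by move=> x _; rewrite lee_fin normal_pdf_ub ?oner_eq0.
rewrite integral_cst//= lebesgue_measure_itv/= lte_fin.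
case: ifPn => _; last by rewrite mule0 lee_fin !mulr_ge0// normal_peak_ge0.
by rewrite -EFinB -EFinM lee_fin; lra.
Qed.

End standard_normal.

Section linear_combination.
Variables (R : realType) (d : measure_display) (T : measurableType d).
Variable P : probability T R.
Local Notation gamma := (@normal_prob R 0 1).

Lemma gauss_family_marginal (I : finType) (X : I -> T -> R) i A :
  gauss_family P X -> measurable A -> P [set w | A (X i w)] = gamma A.
Proof.
move=> [mX lX] mA.
rewrite [Y in P Y](_ : _ = [set w | forall k, (if k == i then A else setT) (X k w)]).
  rewrite (lX (fun k => if k == i then A else setT)); last by move=> k; case: ifP.
  rewrite (bigD1 i)//= eqxx big1 ?mule1// => k /negbTE ->.
  by have := @probability_setT _ _ _ gamma.
apply/seteqP; split => w /=; first by move=> Aw k; case: eqVneq => // ->.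
by move=> /(_ i); rewrite eqxx.
Qed.

(** Induction on the number of non-zero coefficients: a Givens rotation merges two of them, [a i]
    and [a j], into the single [r = sqrt (a i ^+ 2 + a j ^+ 2)]. It changes neither the combination
    nor the sum of squares, and the rotated family is again Gaussian. *)
Lemma gauss_family_lin (I : finType) (a : I -> R) (X : I -> T -> R) (A : set R) :
  gauss_family P X -> measurable A ->
  P [set w | A (\sum_i a i * X i w)] =
  gamma [set x | A (Num.sqrt (\sum_i a i ^+ 2) * x)].
Proof.
move=> gX mA; move: {2}(#|[set i | a i != 0]%SET|) (leqnn #|[set i | a i != 0]%SET|) => N.
elim: N a X gX => [|N IH] a X gX.
  rewrite leqn0 cards_eq0 => /eqP a0.
  have {}a0 i : a i = 0.
    apply/eqP/negPn/negP => ai; have : i \in [set i | a i != 0]%SET by rewrite inE.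
    by rewrite a0 inE.
  rewrite big1 => [|i _]; last by rewrite a0 expr0n.
  rewrite sqrtr0 [Y in P Y](_ : _ = [set w | A 0]); last first.
    by apply/funext => w /=; rewrite big1// => i _; rewrite a0 mul0r.
  rewrite [Y in gamma Y](_ : _ = [set w | A 0]); last first.
    by apply/funext => w /=; rewrite mul0r.
  have [A0|A0] := pselect (A 0).
    have -> : [set _ : T | A 0] = setT by apply/seteqP; split.
    have -> : [set _ : R | A 0] = setT by apply/seteqP; split.
    by rewrite probability_setT; apply/esym; have := @probability_setT _ _ _ gamma.
  have -> : [set _ : T | A 0] = set0 by apply/seteqP; split.
  have -> : [set _ : R | A 0] = set0 by apply/seteqP; split.
  by rewrite !measure0.
move=> aN; have [[i [j [ij ai aj]]]|H] :=
  pselect (exists i, exists j, [/\ i != j, a i != 0 & a j != 0]).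
  pose r := Num.sqrt (a i ^+ 2 + a j ^+ 2).
  have r2 : r ^+ 2 = a i ^+ 2 + a j ^+ 2 by rewrite sqr_sqrtr// addr_ge0// sqr_ge0.
  have r0 : r != 0.
    by rewrite sqrtr_eq0 -ltNge ltr_wpDr ?sqr_ge0// exprn_even_gt0.
  have c0 : a i / r != 0 by rewrite mulf_neq0// invr_eq0.
  have cs1 : (a i / r) ^+ 2 + (- (a j / r)) ^+ 2 = 1.
    by rewrite sqrrN !expr_div_n -mulrDl -r2 divff// expf_neq0.
  pose a' k := if k == i then r else if k == j then 0 else a k.
  have ji : (j == i) = false by rewrite eq_sym; exact: negbTE.
  have iE f g : (forall k, k != i -> k != j -> f k = g k) -> f i + f j = g i + g j ->
      \sum_k f k = \sum_k g k :> R.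
    move=> fg fgij; rewrite (bigD1 i)//= (bigD1 j) ?ji//= [RHS](bigD1 i)//= [X in _ = _ + X](bigD1 j) ?ji//=.
    by rewrite !addrA fgij; congr +%R; apply: eq_bigr => k /andP[ki kj]; exact: fg.
  have E1 w : \sum_k a' k * givens_fam X i j (a i / r) (- (a j / r)) k w = \sum_k a k * X k w.
    apply: iE => [k ki kj|]; rewrite /a' /givens_fam.
      by rewrite (negbTE ki) (negbTE kj).
    by rewrite eqxx ji eqxx mul0r addr0; field.
  have E2 : \sum_k a' k ^+ 2 = \sum_k a k ^+ 2.
    apply: iE => [k ki kj|]; rewrite /a'; first by rewrite (negbTE ki) (negbTE kj).
    by rewrite eqxx ji eqxx expr0n addr0.
  have := IH a' _ (gauss_family_givens ij c0 cs1 gX).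
  rewrite E2 => <-.
    by congr (P _); apply/funext => w /=; rewrite E1.
  rewrite -ltnS; apply: leq_trans aN; apply: proper_card; apply/properP; split.
    apply/fintype.subsetP => k; rewrite !inE /a'; case: (eqVneq k i) => [->//|_].
    by case: (eqVneq k j) => // ->; rewrite eqxx.
  by exists j; rewrite !inE// /a' ji !eqxx.
have [[i ai]|H0] := pselect (exists i, a i != 0); last first.
  apply: IH => //; have -> : [set i | a i != 0]%SET = finset.set0; last by rewrite cards0.
  by apply/setP => i; rewrite !inE; apply/negbTE/negP => ai; case: H0; exists i.
have ak k : k != i -> a k = 0.
  by move=> ki; apply/eqP/negPn/negP => ak; apply: H; exists k, i.
have -> : \sum_i a i ^+ 2 = a i ^+ 2.
  by rewrite (bigD1 i)//= big1 ?addr0// => k /ak ->; rewrite expr0n.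
have mAi : measurable [set x | A (a i * x)].
  rewrite -[Y in measurable Y]setTI.
  have -> : (fun x => A (a i * x)) = (fun x => a i * x) @^-1` A by [].
  by apply: (_ : measurable_fun setT (fun x => a i * x)) => //; apply: measurable_funM.
rewrite sqrtr_sqr (_ : [set w | _] = [set w | [set x | A (a i * x)] (X i w)]); last first.
  apply/funext => w /=; congr (A _).
  by rewrite (bigD1 i)//= big1 ?addr0// => k /ak ->; rewrite mul0r.
rewrite (gauss_family_marginal i gX mAi).
(* The scale is [|a i|], not [a i]; a negative coefficient is absorbed by the symmetry of the normal
   law. *)
have [ai0|ai0] := ger0P (a i); first by [].
rewrite -normal_prob_oppr//; congr normal_prob; apply/funext => x /=.
by rewrite mulNr mulrN.
Qed.
End linear_combination.

(** * Independence *)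

Section independence.
Variables (R : realType) (d : measure_display) (T : measurableType d).
Variable P : probability T R.

Definition indep_systems (G1 G2 : set (set T)) : Prop :=
  forall A B, G1 A -> G2 B -> P (A `&` B) = (P A * P B)%E.

Definition pi_system (G : set (set T)) : Prop :=
  [/\ G `<=` measurable, setI_closed G & G setT].

Lemma pi_system_sigma_measurable G : pi_system G -> <<s G >> `<=` @measurable _ T.
Proof.
move=> [mG _ _]; apply: smallest_sub => //; split.
- exact: measurable0.
- by move=> A mA; rewrite setTD; exact: measurableC.
- by move=> F mF; exact: bigcupT_measurable.
Qed.

(** For fixed [B], the finite measures [P (A & B)] and [P B * P A] in [A] agree on a generating
    pi-system. *)
Lemma indep_systems_sigmal G1 G2 : pi_system G1 -> G2 `<=` measurable ->
  indep_systems G1 G2 -> indep_systems <<s G1 >> G2.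
Proof.
move=> pG1 mG2 iG A B sA GB.
have [mG1 IG1 TG1] := pG1.
have mB : measurable B by exact: mG2.
have fB0 : 0 <= fine (P B) by exact: fine_ge0.
have E : mrestr P mB A = mscale (NngNum fB0) P A.
  apply: (g_sigma_algebra_measure_unique G1 mG1 (fun=> setT)) => //.
  - by rewrite bigcup_const.
  - by move=> C GC; rewrite /= /mrestr /mscale/= iG// fineK ?fin_num_measure// muleC.
  - move=> _; rewrite /= /mrestr setTI.
    by apply: le_lt_trans (probability_le1 P _) _ => //; exact: ltry.
by move: E; rewrite /mrestr /mscale/= => ->; rewrite fineK ?fin_num_measure// muleC.
Qed.

Lemma indep_systems_sym G1 G2 : indep_systems G1 G2 -> indep_systems G2 G1.
Proof. by move=> h A B GA GB; rewrite setIC h// muleC. Qed.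

Lemma indep_systems_sigma G1 G2 : pi_system G1 -> pi_system G2 ->
  indep_systems G1 G2 -> indep_systems <<s G1 >> <<s G2 >>.
Proof.
move=> p1 p2 i12; apply: indep_systems_sym; apply: indep_systems_sigmal => //.
  exact: pi_system_sigma_measurable.
by apply: indep_systems_sym; apply: indep_systems_sigmal => //; case: p2.
Qed.

(* Fubini for the law of [w |-> (w, w)], which is a product by independence. *)
Lemma indep_section_le G1 G2 (C : set (g_sigma_algebraType G1 * g_sigma_algebraType G2)) (e : R) :
  pi_system G1 -> pi_system G2 -> indep_systems G1 G2 -> measurable C ->
  (forall w1 : T, (P [set w2 : T | C (w1, w2)] <= e%:E)%E) ->
  (P [set w : T | C (w, w)] <= e%:E)%E.
Proof.
move=> p1 p2 i12 mC h.
have s1 := pi_system_sigma_measurable p1; have s2 := pi_system_sigma_measurable p2.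
(* The target is [T] itself with the coarser generated sigma-algebra, so the identity is measurable
   into it. *)
have m1 : measurable_fun setT (fun w : T => w : g_sigma_algebraType G1).
  by move=> _ Y mY; rewrite setTI; exact: s1.
have m2 : measurable_fun setT (fun w : T => w : g_sigma_algebraType G2).
  by move=> _ Y mY; rewrite setTI; exact: s2.
pose f1 : {mfun T >-> g_sigma_algebraType G1} := HB.pack (fun w : T => w : g_sigma_algebraType G1)
   (isMeasurableFun.Build _ _ _ _ _ m1).
pose f2 : {mfun T >-> g_sigma_algebraType G2} := HB.pack (fun w : T => w : g_sigma_algebraType G2)
   (isMeasurableFun.Build _ _ _ _ _ m2).
have mD : measurable_fun setT (fun w : T => (w : g_sigma_algebraType G1, w : g_sigma_algebraType G2)).
  exact: measurable_fun_pair.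
pose pm := measure_function_pushforward__canonical__measure_function_Measure P mD.
have := @product_measure_unique _ _ _ _ R (distribution P f1) (distribution P f2) pm _ C mC.
move=> H; have {}H : (distribution P f1 \x distribution P f2)%E C = pm C.
  apply: H => A B mA mB; rewrite /pm/= /pushforward /distribution/= /pushforward.
  exact: (indep_systems_sigma p1 p2 i12).
rewrite (_ : P _ = pm C)// -H /product_measure1/=.
apply: (@le_trans _ _ (\int[distribution P f1]_x (cst e%:E x))%E); last first.
  by rewrite integral_cst//= probability_setT mule1.
apply: ge0_le_integral => //.
- exact: measurable_fun_xsection.
- by move=> x _ /=; rewrite /distribution /pushforward/= -[Y in P Y]/(xsection C x) ;
   rewrite (_ : xsection C x = [set w2 | C (x, w2)])//; apply/funext => y; rewrite /xsection/= inE.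
Qed.

End independence.

Lemma measurable_set_ge0 (R : realType) (d : measure_display) (T : measurableType d)
  (h : T -> R) : measurable_fun setT h -> measurable [set w | 0 <= h w].
Proof.
move=> mh; rewrite (_ : [set w | _] = setT `&` h @^-1` `[0, +oo[); first exact: mh.
by rewrite setTI; apply/funext => w /=; rewrite in_itv/= andbT.
Qed.

Lemma measurable_set_gt0 (R : realType) (d : measure_display) (T : measurableType d)
  (h : T -> R) : measurable_fun setT h -> measurable [set w | 0 < h w].
Proof.
move=> mh; rewrite (_ : [set w | _] = setT `&` h @^-1` `]0, +oo[); first exact: mh.
by rewrite setTI; apply/funext => w /=; rewrite in_itv/= andbT.
Qed.

Section cylinders.
Variables (R : realType) (d : measure_display) (T : measurableType d).
Variables (P : probability T R) (I : finType) (X : I -> T -> R).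
Hypothesis gX : gauss_family P X.
Local Notation gamma := (@normal_prob R 0 1).

(** A pi-system generating the sigma-algebra of the coordinates in [S]. Disjoint sets of coordinates
    give independent sigma-algebras. *)
Definition cylinders (S : pred I) : set (set T) :=
  [set A | exists2 B : I -> set R, (forall i, measurable (B i)) &
    A = [set w | forall i, S i -> B i (X i w)]].

Lemma cylindersE (S : pred I) (B : I -> set R) :
  [set w | forall i, S i -> B i (X i w)] =
  [set w | forall i, (if S i then B i else setT) (X i w)].
Proof.
by apply/seteqP; split => w /= h i; have := h i; case: (S i) => // h'; exact: h'.
Qed.

Lemma cylinders_prob (S : pred I) (B : I -> set R) : (forall i, measurable (B i)) ->
  P [set w | forall i, S i -> B i (X i w)] = (\prod_(i | S i) gamma (B i))%E.
Proof.
move=> mB; rewrite cylindersE (gX.2 (fun i => if S i then B i else setT)); last first.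
  by move=> i; case: ifP.
rewrite [RHS]big_mkcond; apply: eq_bigr => i _; case: ifP => // _.
by have := @probability_setT _ _ _ gamma.
Qed.

Lemma cylinders_pi_system (S : pred I) : pi_system (cylinders S).
Proof.
split.
- move=> _ [B mB ->]; rewrite cylindersE.
  apply: (measurable_rect (B := fun i => if S i then B i else setT)); first by case: gX.
  by move=> i; case: ifP.
- move=> _ _ [B mB ->] [B' mB' ->]; exists (fun i => B i `&` B' i).
    by move=> i; exact: measurableI.
  apply/seteqP; split => w /=; first by move=> [h h'] i Si; split; [exact: h|exact: h'].
  by move=> h; split => i Si; have [] := h i Si.
- by exists (fun=> setT) => //; apply/seteqP; split.
Qed.

Lemma cylinders_indep (S S' : pred I) : (forall i, S i -> ~~ S' i) ->
  indep_systems P (cylinders S) (cylinders S').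
Proof.
move=> SS' _ _ [B mB ->] [B' mB' ->].
rewrite (_ : _ `&` _ = [set w | forall i, S i || S' i -> (if S i then B i else B' i) (X i w)]); last first.
  apply/seteqP; split => w /=.
    by move=> [h h'] i; case: ifP => Si /=; [move=> _; exact: h|move=> S'i; exact: h'].
  move=> h; split => i Si; have := h i; rewrite Si ?orbT/= => /(_ isT)//.
  by case: ifP => // /SS'; rewrite Si.
rewrite (@cylinders_prob (fun i => S i || S' i) (fun i => if S i then B i else B' i)); last first.
  by move=> i; case: ifP.
rewrite !cylinders_prob//.
rewrite (bigID S)/=; congr (_ * _)%E.
  rewrite (eq_bigl S); last by move=> i; case: (S i); rewrite ?andbF ?andbT.
  by apply: eq_bigr => i ->.
rewrite (eq_bigl S'); last first.
  by move=> i; have := SS' i; case: (S i) => /=; rewrite ?andbT// => /(_ isT) /negbTE ->.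
by apply: eq_bigr => i S'i; case: ifP => // /SS'; rewrite S'i.
Qed.

Lemma cylinders_measurable (S : pred I) i : S i ->
  measurable_fun setT (X i : g_sigma_algebraType (cylinders S) -> R).
Proof.
move=> Si _ Y mY; rewrite setTI; apply: sub_sigma_algebra.
exists (fun k => if k == i then Y else setT); first by move=> k; case: ifP.
apply/seteqP; split => w /=; first by move=> Yw k Sk; case: eqVneq => // ->.
by move=> /(_ i Si); rewrite eqxx.
Qed.

Lemma gauss_family_inj (J : finType) (iota : J -> I) : injective iota ->
  gauss_family P (fun j => X (iota j)).
Proof.
move=> iinj; split; first by move=> j; case: gX.
move=> B mB.
(* The constraints are transported along [iota]; a coordinate outside its image gets the full set,
   of probability 1. *)
pose B' i := if [pick j | iota j == i] is Some j then B j else setT.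
have B'E j : B' (iota j) = B j.
  by rewrite /B'; case: pickP => [k /eqP/iinj ->//|/(_ j)]; rewrite eqxx.
have mB' i : measurable (B' i) by rewrite /B'; case: pickP.
transitivity (P [set w | forall i, B' i (X i w)]).
  congr (P _); apply/seteqP; split => w /= h => [i|j]; last by rewrite -B'E.
  by rewrite /B'; case: pickP => // j /eqP <-.
rewrite gX.2// (bigID (fun i => i \in iota @: [set: J]%SET))/= [X in (_ * X)%E]big1 ?mule1.
  rewrite big_imset/=; last by move=> j k _ _; exact: iinj.
  by apply: eq_big => [j|j _]; rewrite ?inE// B'E.
move=> i iS; rewrite /B'; case: pickP => [j /eqP ji|_].
  by move: iS; rewrite -ji imset_f// inE.
by have := @probability_setT _ _ _ gamma.
Qed.

(** With the coordinates in [S] frozen, the weights are constants and the sum is centred Gaussian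
    with standard deviation [sqrt (\sum_j W j ^+ 2)]. The event is then that a standard normal is at
    most [e] in absolute value. Positivity of the weight sum excludes the zero direction, for which
    the inequality would hold surely. *)
Lemma random_direction (J : finType) (iota : J -> I) (S : pred I) (W : J -> T -> R) (e : R) :
  injective iota -> (forall j, ~~ S (iota j)) -> 0 <= e ->
  (forall j, measurable_fun setT (W j : g_sigma_algebraType (cylinders S) -> R)) ->
  (P [set w | `|\sum_j W j w * X (iota j) w| <= e * Num.sqrt (\sum_j W j w ^+ 2) /\
              0 < \sum_j W j w ^+ 2]%R <= (2 * normal_peak 1 * e)%:E)%E.
Proof.
move=> iinj nS e0 mW.
pose S' := fun i => ~~ S i.
pose T1 := g_sigma_algebraType (cylinders S).
pose T2 := g_sigma_algebraType (cylinders S').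
pose C := [set z : T1 * T2 | `|\sum_j W j z.1 * X (iota j) z.2| <= e * Num.sqrt (\sum_j W j z.1 ^+ 2) /\
              0 < \sum_j W j z.1 ^+ 2].
have mWW : measurable_fun setT (fun z : T1 * T2 => \sum_j W j z.1 ^+ 2).
  apply: measurable_sum => j; apply: measurable_funX.
  exact: (measurableT_comp (mW j)).
have mX j : measurable_fun setT (X (iota j) : T2 -> R).
  exact: (cylinders_measurable (S := S') (nS j)).
have mC : measurable C.
  rewrite (_ : C = [set z : T1 * T2 | 0 <= e * Num.sqrt (\sum_j W j z.1 ^+ 2) - `|\sum_j W j z.1 * X (iota j) z.2|] `&`
     [set z : T1 * T2 | 0 < \sum_j W j z.1 ^+ 2]); last first.
    by apply/funext => z /=; rewrite subr_ge0.
  apply: measurableI; last exact: measurable_set_gt0.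
  apply: measurable_set_ge0; apply: measurable_funB.
    by apply: measurable_funM => //; apply: measurableT_comp mWW; apply: continuous_measurable_fun; exact: sqrt_continuous.
  apply: measurableT_comp => //; apply: measurable_sum => j; apply: measurable_funM.
    exact: (measurableT_comp (mW j)).
  exact: (measurableT_comp (mX j)).
apply: (indep_section_le (cylinders_pi_system S) (cylinders_pi_system S') _ mC).
  by apply: cylinders_indep => i Si; rewrite negbK.
move=> w1; have [W0|W0] := leP (\sum_j W j w1 ^+ 2) 0.
  rewrite (_ : [set w2 | _] = set0) ?measure0 ?lee_fin ?mulr_ge0 ?normal_peak_ge0//.
  by apply/seteqP; split => w //= -[_]; rewrite ltNge W0.
set s := Num.sqrt (\sum_j W j w1 ^+ 2).
have s0 : 0 < s by rewrite sqrtr_gt0.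
rewrite (_ : [set w2 | _] = [set w2 | [set x | `|x| <= e * s] (\sum_j W j w1 * X (iota j) w2)]); last first.
  by apply/seteqP; split => w /=; [move=> []|split].
rewrite gauss_family_lin -/s; last 2 first.
- exact: gauss_family_inj.
- rewrite (_ : [set x | _] = `[- (e * s), e * s]%classic)//.
  by apply/seteqP; split => x /=; rewrite in_itv/= ler_norml.
rewrite [Y in normal_prob _ _ Y](_ : _ = [set x | `|x| <= e]).
  exact: normal_prob_ball.
apply/seteqP; split => x /=; rewrite normrM gtr0_norm// mulrC ler_pM2r//.
Qed.

End cylinders.

(** * The inverse of a square Gaussian block *)

Section matrix_measurability.
Variables (R : realType) (d : measure_display) (T : measurableType d).

Definition measurable_mx (p r : nat) (f : T -> 'M[R]_(p, r)) : Prop :=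
  forall i j, measurable_fun setT (fun w => f w i j).

Lemma measurable_det p (f : T -> 'M[R]_p) : measurable_mx f ->
  measurable_fun setT (fun w => \det (f w)).
Proof.
move=> mf; rewrite /determinant; apply: measurable_sum => s.
apply: measurable_funM => //; apply: measurable_prod => i _; exact: mf.
Qed.

Lemma measurable_adj p (f : T -> 'M[R]_p) : measurable_mx f ->
  measurable_mx (fun w => \adj (f w)).
Proof.
move=> mf i j; under eq_fun do rewrite mxE; rewrite /cofactor.
apply: measurable_funM => //; apply: measurable_det => k l.
by under eq_fun do rewrite !mxE; exact: mf.
Qed.

Lemma measurable_mulmxl p r s (A : 'M[R]_(s, p)) (f : T -> 'M[R]_(p, r)) :
  measurable_mx f -> measurable_mx (fun w => A *m f w).
Proof.
move=> mf i j; under eq_fun do rewrite mxE; apply: measurable_sum => k.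
by apply: measurable_funM => //; exact: mf.
Qed.

End matrix_measurability.

Section givens_columns.
Variables (R : realType).

Definition givens_cols (p b : nat) (i j : 'I_b) (c s : R) (A : 'M[R]_(p, b)) : 'M[R]_(p, b) :=
  \matrix_(k, l) if l == i then c * A k i - s * A k j else
                 if l == j then s * A k i + c * A k j else A k l.

Lemma givens_colsE p b (i j : 'I_b) c s (A : 'M[R]_(p, b)) :
  givens_cols i j c s A = A *m givens_cols i j c s 1%:M.
Proof.
have dl (k : 'I_p) (m : 'I_b) : \sum_j A k j * (1%:M : 'M[R]_b) j m = A k m.
  by rewrite -[in RHS](mulmx1 A) mxE.
apply/matrixP => k l; rewrite !mxE.
under eq_bigr do rewrite !mxE.
have [li|li] := boolP (l == i).
  rewrite -!dl !mulr_sumr -sumrB; apply: eq_bigr => m _; rewrite !mxE; ring.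
have [lj|lj] := boolP (l == j).
  rewrite -!dl !mulr_sumr -big_split; apply: eq_bigr => m _; rewrite !mxE /=; ring.
by rewrite -dl; apply: eq_bigr => m _; rewrite !mxE.
Qed.

Lemma givens_colsK p b (i j : 'I_b) c s (A : 'M[R]_(p, b)) : i != j -> c ^+ 2 + s ^+ 2 = 1 ->
  givens_cols i j c (- s) (givens_cols i j c s A) = A.
Proof.
move=> ij cs1; have ji : (j == i) = false by rewrite eq_sym; exact: negbTE.
apply/matrixP => k l; rewrite !mxE !eqxx ji.
case: eqVneq => [->|li].
  by rewrite -[RHS]mul1r -cs1; ring.
case: eqVneq => [->|lj] //.
by rewrite -[RHS]mul1r -cs1; ring.
Qed.

Lemma givens_cols_unit b (i j : 'I_b) (c s : R) : i != j -> c ^+ 2 + s ^+ 2 = 1 ->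
  givens_cols i j c s 1%:M \in unitmx.
Proof.
move=> ij cs1.
by have /mulmx1_unit[] : givens_cols i j c s 1%:M *m givens_cols i j c (- s) 1%:M = 1%:M
  by rewrite -givens_colsE givens_colsK.
Qed.

End givens_columns.

Section gaussian_matrix.
Variables (R : realType) (d : measure_display) (T : measurableType d).
Variable P : probability T R.

Definition gauss_mx (n b : nat) (Om : T -> 'M[R]_(n, b)) : Prop :=
  gauss_family P (fun (kl : 'I_n * 'I_b) w => Om w kl.1 kl.2).

Lemma std_gaussian_mxP n b (Om : T -> 'M[R]_(n, b)) :
  std_gaussian_mx P Om -> gauss_mx Om.
Proof.
move=> [mOm lOm]; split; first by move=> [k l]; exact: mOm.
move=> B mB; transitivity (\prod_(k < n) \prod_(l < b) normal_prob (0 : R) 1 (B (k, l)))%E; last first.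
  by rewrite pair_bigA; apply: eq_bigr => -[k l].
rewrite -(lOm (fun k l => B (k, l)))//; congr (P _); apply/seteqP; split => w /= h.
  by move=> k l; exact: (h (k, l)).
by move=> [k l]; exact: h.
Qed.

(** Rotating two columns rotates one pair of entries in each row. [X ks] has the rows in [ks]
    already rotated, and each step of the induction is one Givens rotation of the whole family. *)
Lemma gauss_mx_givens_cols n b (Om : T -> 'M[R]_(n, b)) (i j : 'I_b) c s :
  i != j -> c != 0 -> c ^+ 2 + s ^+ 2 = 1 ->
  gauss_mx Om -> gauss_mx (fun w => givens_cols i j c s (Om w)).
Proof.
move=> ij c0 cs1 gO.
pose X (ks : seq 'I_n) (kl : 'I_n * 'I_b) (w : T) : R :=
  if kl.1 \in ks then givens_cols i j c s (Om w) kl.1 kl.2 else Om w kl.1 kl.2.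
suff H ks : uniq ks -> gauss_family P (X ks).
  have := H (enum 'I_n) (enum_uniq _); congr gauss_family.
  by apply/funext => kl; apply/funext => w; rewrite /X mem_enum.
elim: ks => [_|k0 ks IH /= /andP[k0ks uks]]; first exact: gO.
rewrite (_ : X (k0 :: ks) = givens_fam (X ks) (k0, i) (k0, j) c s).
  apply: gauss_family_givens => //; last exact: IH.
  by rewrite xpair_eqE eqxx.
apply/funext => -[k l]; apply/funext => w; rewrite /X /givens_fam /= inE !xpair_eqE.
rewrite (negbTE k0ks); have [->|kk0] := eqVneq k k0; last by [].
by rewrite mxE /= (negbTE k0ks).
Qed.

End gaussian_matrix.

Section gaussian_inverse.
Variables (R : realType) (d : measure_display) (T : measurableType d).
Variable P : probability T R.

Lemma gauss_mx_measurable n b (Om : T -> 'M[R]_(n, b)) : gauss_mx P Om -> measurable_mx Om.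
Proof. by move=> [mO _] i j; exact: (mO (i, j)). Qed.

(* The coefficients of [det (V^T Om)] as a linear form in column [j] of [Om]:
   they only involve the other columns. *)
Definition cofactor_dir n b (V Om : 'M[R]_(n, b)) (j : 'I_b) : 'cV[R]_n :=
  V *m \col_i cofactor (V^T *m Om) i j.

Lemma det_cofactor_dir n b (V Om : 'M[R]_(n, b)) j :
  \det (V^T *m Om) = \sum_k cofactor_dir V Om j k 0 * Om k j.
Proof.
rewrite (expand_det_col _ j).
under eq_bigr do rewrite mxE mulr_suml.
rewrite exchange_big; apply: eq_bigr => k _; rewrite mxE mulr_suml.
by apply: eq_bigr => i _; rewrite !mxE; ring.
Qed.

Lemma vnorm_cofactor_dir n b (V Om : 'M[R]_(n, b)) j : V^T *m V = 1%:M ->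
  vnorm (cofactor_dir V Om j) ^+ 2 = \sum_i cofactor (V^T *m Om) i j ^+ 2.
Proof.
move=> VV; rewrite vnorm_isometry// vnorm_sqr.
by apply: eq_bigr => i _; rewrite mxE.
Qed.

Lemma measurable_cofactor_dir n b (V : 'M[R]_(n, b)) (Om : T -> 'M[R]_(n, b)) (j : 'I_b) k :
  measurable_fun setT
   ((fun w => cofactor_dir V (Om w) j k 0) :
   g_sigma_algebraType (cylinders (fun kl w => Om w kl.1 kl.2) (fun kl : 'I_n * 'I_b => kl.2 != j)) -> R).
Proof.
pose T1 := g_sigma_algebraType (cylinders (fun kl w => Om w kl.1 kl.2) (fun kl : 'I_n * 'I_b => kl.2 != j)).
have mO (l : 'I_n) (m : 'I_b) : m != j -> measurable_fun setT ((fun w => Om w l m) : T1 -> R).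
  move=> mj; exact: (@cylinders_measurable _ _ _ _ (fun kl w => Om w kl.1 kl.2) (fun kl => kl.2 != j) (l, m)).
rewrite -/T1 /cofactor_dir.
rewrite (_ : (fun w => _) = fun w : T1 => \sum_i V k i * cofactor (V^T *m Om w) i j); last first.
  by apply/funext => w; rewrite mxE; apply: eq_bigr => i _; rewrite mxE.
apply: measurable_sum => i; apply: measurable_funM => //; rewrite /cofactor.
apply: measurable_funM => //; apply: measurable_det => l m.
rewrite (_ : (fun w => _) = fun w : T1 => \sum_a V a (lift i l) * Om w a (lift j m)); last first.
  by apply/funext => w; rewrite !mxE; apply: eq_bigr => a _; rewrite !mxE.
apply: measurable_sum => a; apply: measurable_funM => //; apply: mO.
by rewrite eq_sym neq_lift.
Qed.

(* The determinant is a Gaussian linear combination of the entries of column j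
   whose coefficients are independent of that column. *)
Lemma det_small_ball n b (V : 'M[R]_(n, b)) (Om : T -> 'M[R]_(n, b)) (j : 'I_b) (e : R) :
  gauss_mx P Om -> 0 <= e ->
  (P [set w | `|\det (V^T *m Om w)| <= e * vnorm (cofactor_dir V (Om w) j) /\
     0 < vnorm (cofactor_dir V (Om w) j) ^+ 2]%R <= (2 * normal_peak 1 * e)%:E)%E.
Proof.
move=> gO e0.
have jinj : injective (fun k : 'I_n => (k, j)) by move=> k k' [].
have nS (k : 'I_n) : ~~ ((k, j).2 != j) by rewrite /= eqxx.
apply: le_trans (random_direction gO jinj nS e0 (@measurable_cofactor_dir n b V Om j)).
rewrite le_eqVlt; apply/orP; left; apply/eqP; congr (P _).
by apply/funext => w /=; rewrite -det_cofactor_dir vnorm_sqr.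
Qed.

Lemma measurable_det_eq0 n b (V : 'M[R]_(n, b)) (Om : T -> 'M[R]_(n, b)) :
  gauss_mx P Om -> measurable [set w | \det (V^T *m Om w) = 0].
Proof.
move=> gO.
have mdet : measurable_fun setT (fun w => \det (V^T *m Om w)).
  by apply: measurable_det; apply: measurable_mulmxl; exact: gauss_mx_measurable gO.
rewrite (_ : [set w | _] = setT `&` (fun w => \det (V^T *m Om w)) @^-1` [set 0]).
  exact: mdet.
by rewrite setTI.
Qed.

Lemma measurable_det_ball n b (V : 'M[R]_(n, b)) (Om : T -> 'M[R]_(n, b)) (j : 'I_b) (e : R) :
  gauss_mx P Om ->
  measurable [set w | `|\det (V^T *m Om w)| <= e * vnorm (cofactor_dir V (Om w) j) /\
     0 < vnorm (cofactor_dir V (Om w) j) ^+ 2].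
Proof.
move=> gO.
have mM : measurable_mx (fun w => V^T *m Om w).
  by apply: measurable_mulmxl; exact: gauss_mx_measurable gO.
have mc : measurable_fun setT (fun w => vnorm (cofactor_dir V (Om w) j) ^+ 2).
  under eq_fun do rewrite vnorm_sqr.
  apply: measurable_sum => k; apply: measurable_funX; rewrite /cofactor_dir.
  apply: (@measurable_mulmxl _ _ _ _ _ _ V (fun w => \col_i cofactor (V^T *m Om w) i j)) => i z.
  by under eq_fun do rewrite mxE; have := measurable_adj mM j i; under eq_fun do rewrite mxE.
rewrite (_ : [set w | _] = [set w | 0 <= e * Num.sqrt (vnorm (cofactor_dir V (Om w) j) ^+ 2) - `|\det (V^T *m Om w)|]
  `&` [set w | 0 < vnorm (cofactor_dir V (Om w) j) ^+ 2]); last first.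
  by apply/funext => w /=; rewrite subr_ge0 sqrtr_sqr (ger0_norm (vnorm_ge0 _)).
apply: measurableI; last exact: measurable_set_gt0.
apply: measurable_set_ge0; apply: measurable_funB.
  by apply: measurable_funM => //; apply: measurableT_comp mc; apply: continuous_measurable_fun; exact: sqrt_continuous.
by apply: measurableT_comp => //; exact: measurable_det.
Qed.

(** Induction on the number of columns. Deleting the first column of both [V] and [Om] gives the
    minor at [(0, 0)], almost surely non-zero. It is one of the cofactors of column 0, so the
    direction of the linear form does not vanish, and the small ball estimate with radius [0]
    applies. *)
Lemma gauss_det_neq0 n b (V : 'M[R]_(n, b)) (Om : T -> 'M[R]_(n, b)) :
  gauss_mx P Om -> V^T *m V = 1%:M -> P [set w | \det (V^T *m Om w) = 0] = 0%E.
Proof.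
elim: b V Om => [|b IH] V Om gO VV.
  rewrite (_ : [set w | _] = set0) ?measure0//.
  by apply/seteqP; split => w //=; rewrite det_mx00 => /eqP; rewrite oner_eq0.
pose V' : 'M[R]_(n, b) := col' 0 V; pose Om' w : 'M[R]_(n, b) := col' 0 (Om w).
have gO' : gauss_mx P Om'.
  have := @gauss_family_inj _ _ _ _ _ _ gO _ (fun kl : 'I_n * 'I_b => (kl.1, lift ord0 kl.2)).
  move=> H; have {}H : gauss_family P (fun (kl : 'I_n * 'I_b) w => Om w kl.1 (lift ord0 kl.2)).
    by apply: H => -[k l] [k' l'] /= [-> /ord_inj/eqP]; rewrite ?(inj_eq lift_inj) => /eqP ->.
  rewrite /gauss_mx (_ : (fun _ => _) = (fun (kl : 'I_n * 'I_b) w => Om w kl.1 (lift ord0 kl.2)))//.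
  by apply/funext => kl; apply/funext => w; rewrite mxE.
have VV' : V'^T *m V' = 1%:M.
  apply/matrixP => i j; move/matrixP: (VV) => /(_ (lift 0 i) (lift 0 j)).
  rewrite !mxE (inj_eq lift_inj) => <-.
  by apply: eq_bigr => k _; rewrite !mxE.
have minorE w : row' 0 (col' 0 (V^T *m Om w)) = V'^T *m Om' w.
  by apply/matrixP => i j; rewrite !mxE; apply: eq_bigr => k _; rewrite !mxE.
apply/eqP; rewrite eq_le measure_ge0 andbT.
apply: (@le_trans _ _ (P ([set w | \det (V'^T *m Om' w) = 0] `|`
   [set w | `|\det (V^T *m Om w)| <= 0 * vnorm (cofactor_dir V (Om w) 0) /\
     0 < vnorm (cofactor_dir V (Om w) 0) ^+ 2]))).
  apply: le_measure; rewrite ?inE.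
  - exact: measurable_det_eq0.
  - by apply: measurableU; [exact: measurable_det_eq0|exact: measurable_det_ball].
  - move=> w /= dw; have [d'|d'] := eqVneq (\det (V'^T *m Om' w)) 0; [by left|right].
    rewrite dw normr0 mul0r; split=> //; rewrite vnorm_cofactor_dir// big_ord_recl.
    rewrite ltr_pwDl ?sumr_ge0// => [|i _]; last by rewrite sqr_ge0.
    by rewrite /cofactor addn0 expr0 mul1r minorE exprn_even_gt0.
apply: le_trans (measureU2 _ _ _) _; [exact: measurable_det_eq0|exact: measurable_det_ball|].
rewrite -[leRHS]add0e; apply: leeD.
  by move: (IH V' Om' gO' VV') => /eqP; rewrite eq_le => /andP[].
apply: le_trans (det_small_ball _ _ gO (lexx 0)) _.
by rewrite mulr0.
Qed.

End gaussian_inverse.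

Section inverse_rows.
Variables (R : realType) (d : measure_display) (T : measurableType d).
Variable P : probability T R.

(** On a singular matrix [invmx] returns the matrix itself; those outcomes are put into the event,
    so that its complement speaks of a true inverse. *)
Definition inv_large n b (V : 'M[R]_(n, b)) (Om : T -> 'M[R]_(n, b)) (v : 'rV[R]_b) (x : R) : set T :=
  [set w | V^T *m Om w \notin unitmx \/ x < vnorm (v *m invmx (V^T *m Om w))^T].

Lemma vnorm_mul_invmx b (v : 'rV[R]_b) (M : 'M[R]_b) : M \in unitmx ->
  vnorm (v *m invmx M)^T = vnorm (v *m \adj M)^T / `|\det M|.
Proof.
move=> uM; rewrite /invmx uM -scalemxAr linearZ/= vnormZ mulrC normfV//.
Qed.

(** Multiplying by the determinant replaces the inverse by the adjugate: the event becomes a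
    polynomial condition on the entries, hence measurable. *)
Lemma inv_largeE n b (V : 'M[R]_(n, b)) Om v x : 0 <= x ->
  inv_large V Om v x = [set w | \det (V^T *m Om w) = 0] `|`
    [set w | 0 < vnorm (v *m \adj (V^T *m Om w))^T ^+ 2 - x ^+ 2 * \det (V^T *m Om w) ^+ 2].
Proof.
move=> x0; apply/funext => w /=; rewrite /inv_large/=.
have [uM|uM] := boolP (V^T *m Om w \in unitmx); last first.
  apply/propext; split => _; left => //.
  by move: uM; rewrite unitmxE unitfE negbK => /eqP.
have d0 : \det (V^T *m Om w) != 0 by rewrite -unitfE -unitmxE.
rewrite vnorm_mul_invmx// ltr_pdivlMr ?normr_gt0// subr_gt0 -exprMn.
rewrite -[X in (X ^+ 2 < _)%R]/(x * \det (V^T *m Om w)).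
have -> : (x * \det (V^T *m Om w)) ^+ 2 = (x * `|\det (V^T *m Om w)|) ^+ 2.
  by rewrite !exprMn real_normK ?num_real.
rewrite ltr_pXn2r// ?nnegrE ?mulr_ge0 ?vnorm_ge0//.
by apply/propext; split => [[//|h]|[h|h]]; [right|rewrite h eqxx in d0|right].
Qed.

Lemma measurable_inv_large n b (V : 'M[R]_(n, b)) Om v x : gauss_mx P Om -> 0 <= x ->
  measurable (inv_large V Om v x).
Proof.
move=> gO x0; rewrite inv_largeE//; apply: measurableU; first exact: measurable_det_eq0 gO.
have mM : measurable_mx (fun w => V^T *m Om w).
  by apply: measurable_mulmxl; exact: gauss_mx_measurable gO.
apply: measurable_set_gt0; apply: measurable_funB; last first.
  by apply: measurable_funM => //; apply: measurable_funX; exact: measurable_det.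
under eq_fun do rewrite vnorm_sqr; apply: measurable_sum => k; apply: measurable_funX.
under eq_fun do rewrite mxE; exact: (measurable_mulmxl v (measurable_adj mM)).
Qed.

(** Row [j] of the inverse consists of the cofactors of column [j] divided by the determinant, so
    its norm is [|cofactor_dir| / |det|]. A long row therefore means a determinant small relative to
    its own direction. *)
Lemma inv_large_delta n b (V : 'M[R]_(n, b)) Om (c x : R) (j : 'I_b) :
  gauss_mx P Om -> V^T *m V = 1%:M -> 0 < x ->
  (P (inv_large V Om (c *: delta_mx 0 j)%R x) <= (2 * normal_peak 1 * (`|c| / x))%:E)%E.
Proof.
move=> gO VV x0.
have cx0 : 0 <= `|c| / x by rewrite divr_ge0// ltW.
apply: (@le_trans _ _ (P ([set w | \det (V^T *m Om w) = 0] `|`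
   [set w | `|\det (V^T *m Om w)| <= (`|c| / x) * vnorm (cofactor_dir V (Om w) j) /\
     0 < vnorm (cofactor_dir V (Om w) j) ^+ 2]))).
  apply: le_measure; rewrite ?inE.
  - by apply: measurable_inv_large => //; exact: ltW.
  - by apply: measurableU; [exact: measurable_det_eq0 gO|exact: measurable_det_ball gO].
  - rewrite inv_largeE ?ltW// => w [/= ->|/= h]; [by left|].
    have [d0|d0] := eqVneq (\det (V^T *m Om w)) 0; [by left|right].
    have cofE : vnorm (c *: delta_mx 0 j *m \adj (V^T *m Om w))^T ^+ 2 = c ^+ 2 * vnorm (cofactor_dir V (Om w) j) ^+ 2.
      rewrite -scalemxAl linearZ/= vnormZ exprMn real_normK ?num_real//; congr (_ * _).
      rewrite -rowE vnorm_cofactor_dir// vnorm_sqr; apply: eq_bigr => i _.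
      by rewrite !mxE.
    have d2 : 0 < \det (V^T *m Om w) ^+ 2 by rewrite exprn_even_gt0.
    have x2 : 0 < x ^+ 2 by rewrite exprn_gt0.
    move: h; rewrite cofE subr_gt0 => h.
    have h0 := lt_trans (mulr_gt0 x2 d2) h.
    split; last first.
      rewrite lt_neqAle sqr_ge0 andbT eq_sym; apply/eqP => z.
      by move: h0; rewrite z mulr0 ltxx.
    rewrite mulrAC ler_pdivlMr//.
    rewrite -(ler_pXn2r (n := 2))// ?nnegrE ?mulr_ge0 ?vnorm_ge0 ?(ltW x0)//.
    by rewrite !exprMn !real_normK ?num_real// mulrC ltW.
apply: le_trans (measureU2 _ _ _) _; [exact: measurable_det_eq0 gO|exact: measurable_det_ball gO|].
rewrite -[leRHS]add0e; apply: leeD.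
  by move: (gauss_det_neq0 gO VV) => /eqP; rewrite eq_le => /andP[].
exact: det_small_ball.
Qed.

(** If [B] is the rotation, [(v B) (M B)^-1 = v M^-1]. *)
Lemma inv_large_givens n b (V : 'M[R]_(n, b)) Om v x i j c s : i != j -> c ^+ 2 + s ^+ 2 = 1 ->
  inv_large V (fun w => givens_cols i j c s (Om w)) (givens_cols i j c s v) x = inv_large V Om v x.
Proof.
move=> ij cs1; apply/funext => w; rewrite /inv_large/=.
have uG := givens_cols_unit ij cs1.
rewrite givens_colsE (givens_colsE i j c s v) mulmxA unitmx_mul uG andbT.
have [uM|uM] := boolP (V^T *m Om w \in unitmx); last by apply/propext; split => _; left.
congr (_ \/ (_ < vnorm _^T)).
rewrite (_ : invmx (V^T *m Om w *m _) = invmx (givens_cols i j c s 1%:M) *m invmx (V^T *m Om w)).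
  by rewrite -mulmxA (mulmxA _ (invmx _)) mulmxV// mul1mx.
set A := V^T *m Om w in uM *; set B := givens_cols i j c s 1%:M in uG *.
have uAB : A *m B \in unitmx by rewrite unitmx_mul uM uG.
apply: (can_inj (mulKmx uAB)); rewrite mulmxV//.
by rewrite -mulmxA (mulmxA B) mulmxV// mul1mx mulmxV.
Qed.

(** The merging argument of [gauss_family_lin], applied to [v]: each rotation lowers the number of
    its non-zero coordinates and keeps its norm. [Om] varies in the induction because it is rotated
    along with [v], which preserves its law. *)
Lemma inv_large_le n b (V : 'M[R]_(n, b)) Om (v : 'rV[R]_b) (x : R) :
  gauss_mx P Om -> V^T *m V = 1%:M -> 0 < x ->
  (P (inv_large V Om v x) <= (2 * normal_peak 1 * (vnorm v^T / x))%:E)%E.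
Proof.
move=> gO VV x0; move: {2}(#|[set i | v 0 i != 0]%SET|) (leqnn #|[set i | v 0 i != 0]%SET|) => N.
elim: N v Om gO => [|N IH] v Om gO vN.
  have v0 : v = 0.
    apply/rowP => i; rewrite mxE; apply/eqP/negPn/negP => vi.
    move: vN; rewrite leqn0 cards_eq0 => /eqP/setP/(_ i); rewrite !inE.
    by rewrite vi.
  apply: (@le_trans _ _ (P [set w | \det (V^T *m Om w) = 0])).
    apply: le_measure; rewrite ?inE.
    - by apply: measurable_inv_large => //; exact: ltW.
    - exact: measurable_det_eq0 gO.
    - move=> w [/=|]; first by rewrite unitmxE unitfE negbK => /eqP.
      by rewrite v0 mul0mx trmx0 vnorm0 ltNge ltW.
  by rewrite (gauss_det_neq0 gO VV) v0 trmx0 vnorm0 mul0r mulr0.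
have [[i [j [ij vi vj]]]|H] := pselect (exists i, exists j, [/\ i != j, v 0 i != 0 & v 0 j != 0]).
  pose r := Num.sqrt (v 0 i ^+ 2 + v 0 j ^+ 2).
  have r2 : r ^+ 2 = v 0 i ^+ 2 + v 0 j ^+ 2 by rewrite sqr_sqrtr// addr_ge0// sqr_ge0.
  have r0 : r != 0.
    by rewrite sqrtr_eq0 -ltNge ltr_wpDr ?sqr_ge0// exprn_even_gt0.
  set c := v 0 i / r; set s := - (v 0 j / r).
  have c0 : c != 0 by rewrite mulf_neq0// invr_eq0.
  have cs1 : c ^+ 2 + s ^+ 2 = 1.
    by rewrite sqrrN !expr_div_n -mulrDl -r2 divff// expf_neq0.
  have ji : (j == i) = false by rewrite eq_sym; exact: negbTE.
  rewrite -(inv_large_givens V Om v x ij cs1).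
  have vE k : givens_cols i j c s v 0 k = if k == i then r else if k == j then 0 else v 0 k.
    rewrite mxE; case: ifP => _.
      have -> : c * v 0 i - s * v 0 j = r ^+ 2 / r by rewrite r2 /c /s; field.
      by rewrite expr2 mulfK.
    by case: ifP => _ //; rewrite /c /s; field.
  have nE : vnorm (givens_cols i j c s v)^T = vnorm v^T.
    apply/eqP; rewrite -(eqrXn2 (n := 2))// ?vnorm_ge0// !vnorm_sqr; apply/eqP.
    rewrite (bigD1 i)//= (bigD1 j) ?ji//= [RHS](bigD1 i)//= [X in _ = _ + X](bigD1 j) ?ji//=.
    rewrite ![_^T _ _]mxE !vE eqxx ji eqxx r2 expr0n/= add0r addrA; congr +%R.
    by apply: eq_bigr => k /andP[/negbTE ki /negbTE kj]; rewrite !mxE ki kj.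
  rewrite -nE; apply: IH; first exact: gauss_mx_givens_cols.
  rewrite -ltnS; apply: leq_trans vN; apply: proper_card; apply/properP; split.
    apply/fintype.subsetP => k; rewrite !inE vE; case: (eqVneq k i) => [->//|_].
    by case: (eqVneq k j) => // ->; rewrite eqxx.
  by exists j; rewrite !inE// vE ji !eqxx.
have [[i vi]|H0] := pselect (exists i, v 0 i != 0); last first.
  apply: IH => //; have -> : [set i | v 0 i != 0]%SET = finset.set0; last by rewrite cards0.
  by apply/setP => i; rewrite !inE; apply/negbTE/negP => vi; case: H0; exists i.
have vE : v = v 0 i *: delta_mx 0 i.
  apply/rowP => k; rewrite !mxE eqxx; have [->|ki] := eqVneq k i; first by rewrite mulr1.
  by rewrite mulr0; apply/eqP/negPn/negP => vk; apply: H; exists k, i.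
rewrite {1}vE; apply: le_trans (inv_large_delta _ _ gO VV x0) _.
rewrite lee_fin ler_wpM2l ?mulr_ge0 ?normal_peak_ge0// ler_wpM2r ?invr_ge0 ?(ltW x0)//.
rewrite -sqrtr_sqr ler_wsqrtr// (bigD1 i)//= !mxE lerDl sumr_ge0// => k _.
exact: sqr_ge0.
Qed.

End inverse_rows.

(** * Second and fourth moments of sums of random signs *)

Section rademacher_sums.
Variables (R : realType) (b : nat).
Implicit Types (u : 'I_b -> R) (r : seq 'I_b).
Local Notation signs := {ffun 'I_b -> bool}.

Definition sgn_sum u r (e : signs) : R := \sum_(i <- r) (-1) ^+ e i * u i.

Definition flip_sign (i : 'I_b) (e : signs) : signs :=
  [ffun k => if k == i then ~~ e k else e k].

Lemma flip_signK i : involutive (flip_sign i).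
Proof. by move=> e; apply/ffunP => k; rewrite !ffunE; case: (k == i); rewrite ?negbK. Qed.

Lemma sgn_sum_flip u i r e : i \notin r -> sgn_sum u r (flip_sign i e) = sgn_sum u r e.
Proof.
move=> ir; apply: eq_big_seq => k kr; rewrite ffunE.
by case: eqVneq => // ki; rewrite -ki kr in ir.
Qed.

(** Flipping the sign at [i] permutes the sign vectors and negates every term. *)
Lemma sum_sgn_odd u i r k : i \notin r ->
  \sum_(e : signs) (-1) ^+ e i * sgn_sum u r e ^+ k = 0.
Proof.
move=> ir; set S := LHS; suff : S = - S by move=> h; lra.
rewrite {1}/S (reindex_inj (inv_inj (flip_signK i))) -sumrN.
apply: eq_bigr => e _; rewrite sgn_sum_flip// ffunE eqxx.
by case: (e i); rewrite /= ?expr0 ?expr1; ring.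
Qed.

Lemma sgn_sum_cons u i r e : sgn_sum u (i :: r) e = (-1) ^+ e i * u i + sgn_sum u r e.
Proof. by rewrite /sgn_sum big_cons. Qed.

Lemma sum_sgn_sqr u r : uniq r ->
  \sum_(e : signs) sgn_sum u r e ^+ 2 = #|signs|%:R * \sum_(i <- r) u i ^+ 2.
Proof.
elim: r => [_|i r IH /= /andP[ir ur]].
  by rewrite big_nil mulr0 big1// => e _; rewrite /sgn_sum big_nil expr0n.
have H e : sgn_sum u (i :: r) e ^+ 2 = u i ^+ 2 + sgn_sum u r e ^+ 2 +
   2 * u i * ((-1) ^+ e i * sgn_sum u r e ^+ 1).
  by rewrite sgn_sum_cons; case: (e i); rewrite /= ?expr0 ?expr1; ring.
under eq_bigr => e _ do rewrite H.
have odd0 (a : R) k : \sum_(e : signs) a * ((-1) ^+ e i * sgn_sum u r e ^+ k) = 0.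
  by rewrite -mulr_sumr sum_sgn_odd// mulr0.
rewrite !big_split odd0 /= addr0 IH// sumr_const big_cons.
by rewrite mulrDr -[u i ^+ 2 *+ _]mulr_natl.
Qed.

(** Odd powers of the new sign cancel. Per sign vector this adds [6 u^2 Q + u^4], and [6 u^2 Q] is
    exactly the cross term of [3 (u^2 + Q)^2], which explains the factor 3. *)
Lemma sum_sgn_quartic u r : uniq r ->
  \sum_(e : signs) sgn_sum u r e ^+ 4 <= 3 * #|signs|%:R * (\sum_(i <- r) u i ^+ 2) ^+ 2.
Proof.
elim: r => [_|i r IH /= /andP[ir ur]].
  rewrite big_nil expr0n mulr0 big1// => e _; by rewrite /sgn_sum big_nil expr0n.
have H e : sgn_sum u (i :: r) e ^+ 4 = sgn_sum u r e ^+ 4 + 6 * u i ^+ 2 * sgn_sum u r e ^+ 2 + u i ^+ 4 +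
   (4 * u i * ((-1) ^+ e i * sgn_sum u r e ^+ 3) + 4 * u i ^+ 3 * ((-1) ^+ e i * sgn_sum u r e ^+ 1)).
  rewrite sgn_sum_cons; case: (e i); rewrite /= ?expr0 ?expr1; ring.
under eq_bigr => e _ do rewrite H.
have odd0 (a : R) k : \sum_(e : signs) a * ((-1) ^+ e i * sgn_sum u r e ^+ k) = 0.
  by rewrite -mulr_sumr sum_sgn_odd// mulr0.
rewrite !big_split !odd0 /= !addr0 sumr_const big_cons -mulr_sumr sum_sgn_sqr//.
set N : R := #|signs|%:R; set Q := \sum_(j <- r) _.
rewrite -[u i ^+ 4 *+ _]mulr_natl -/N.
have := IH ur; rewrite -/N -/Q => h.
have N0 : 0 <= N by rewrite ler0n.
have x4 : 0 <= N * u i ^+ 4 by rewrite mulr_ge0// exprn_even_ge0.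
have -> : 3 * N * (u i ^+ 2 + Q) ^+ 2 = 3 * N * Q ^+ 2 + 6 * u i ^+ 2 * (N * Q) + 3 * (N * u i ^+ 4) by ring.
lra.
Qed.

End rademacher_sums.

Section staircase.
Variable R : realType.

(** A Riemann sum of [2 x] over the levels [x = eta, ..., L eta] lying below [|z|]. Indicators are
    used so that its mean involves only tail probabilities. *)
Definition staircase (L : nat) (eta z : R) : R :=
  \sum_(l < L) (2 * l.+1%:R * eta ^+ 2) * ((l.+1%:R * eta < `|z|)%R : nat)%:R.

Lemma staircase_aux (L : nat) (eta z : R) : 0 <= eta ->
  (L%:R * eta < `|z| -> staircase L eta z = L%:R * L.+1%:R * eta ^+ 2) /\
  (`|z| <= L%:R * eta -> z ^+ 2 - L%:R * eta ^+ 2 <= staircase L eta z).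
Proof.
move=> e0; elim: L => [|L [IH1 IH2]].
  rewrite /staircase big_ord0 !mul0r; split => // h; rewrite subr0.
  have -> : z = 0 by apply/eqP; rewrite -normr_eq0 eq_le h normr_ge0.
  by rewrite expr0n.
have z2 : `|z| ^+ 2 = z ^+ 2 by rewrite real_normK ?num_real.
have rE : staircase L.+1 eta z = staircase L eta z + 2 * L.+1%:R * eta ^+ 2 * ((L.+1%:R * eta < `|z|)%R : nat)%:R.
  by rewrite /staircase big_ord_recr.
have LL : L%:R * eta <= L.+1%:R * eta by rewrite ler_wpM2r// ler_nat.
rewrite rE; split => [h|h].
  rewrite h IH1; last exact: le_lt_trans h.
  by rewrite /= mulr1 -[L.+2%:R]natr1 -[L.+1%:R]natr1; ring.
rewrite ltNge h/= mulr0 addr0.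
have [h'|h'] := leP `|z| (L%:R * eta).
  apply: le_trans (IH2 h'); rewrite lerD2l lerN2 ler_wpM2r ?sqr_ge0// ler_nat//.
(* Between the last two levels the value is [L (L + 1) eta^2], that is
   [((L + 1) eta)^2 - (L + 1) eta^2]. *)
rewrite IH1// -z2.
have : `|z| ^+ 2 <= (L.+1%:R * eta) ^+ 2 by rewrite ler_pXn2r ?nnegrE ?mulr_ge0.
rewrite -[L.+1%:R]natr1; nra.
Qed.

(* [staircase] discretizes [min(z^2, a^2)] with [a = L eta], and
   [z^2 - z^4 / (4 a^2) <= min(z^2, a^2)]. *)
Lemma staircase_ge (L : nat) (eta z : R) : 0 < eta -> (0 < L)%N ->
  z ^+ 2 - z ^+ 4 / (4 * (L%:R * eta) ^+ 2) - L%:R * eta ^+ 2 <= staircase L eta z.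
Proof.
move=> e0 L0; have [H1 H2] := staircase_aux L z (ltW e0).
set a := L%:R * eta; have a0 : 0 < a by rewrite mulr_gt0// ltr0n.
have a20 : 0 < 4 * a ^+ 2 by rewrite mulr_gt0// exprn_gt0.
have z4 : 0 <= z ^+ 4 / (4 * a ^+ 2) by rewrite divr_ge0 ?exprn_even_ge0// ltW.
have [h|h] := leP `|z| a; first by have := H2 h; lra.
rewrite (H1 h).
have -> : L%:R * L.+1%:R * eta ^+ 2 = a ^+ 2 + L%:R * eta ^+ 2 by rewrite /a -natr1; ring.
have e2 : 0 <= L%:R * eta ^+ 2 by rewrite mulr_ge0// sqr_ge0.
suff : z ^+ 2 - a ^+ 2 <= z ^+ 4 / (4 * a ^+ 2) by lra.
rewrite ler_pdivlMr//; have := sqr_ge0 (z ^+ 2 - 2 * a ^+ 2); nra.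
Qed.

End staircase.

(** With unit weights and [tau = 1] this is the union bound over the grid; with the weights of
    [staircase] it averages tail bounds over signs and levels. *)
Lemma markov_indic (R : realType) (d : measure_display) (T : measurableType d)
  (P : probability T R) (J : finType) (c p : J -> R) (A : J -> set T) (tau : R) :
  0 < tau -> (forall j, 0 <= c j) -> (forall j, measurable (A j)) ->
  (forall j, (P (A j) <= (p j)%:E)%E) ->
  (P [set w | tau <= \sum_j c j * \1_(A j) w]%R <= ((\sum_j c j * p j) / tau)%:E)%E.
Proof.
move=> t0 c0 mA pA; set B := [set w | _].
have mf : measurable_fun setT (fun w => \sum_j c j * \1_(A j) w : R).
  by apply: measurable_sum => j; apply: measurable_funM => //; exact: measurable_indic.
have mB : measurable B.
  rewrite (_ : B = [set w | 0 <= (\sum_j c j * \1_(A j) w) - tau]).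
    by apply: measurable_set_ge0; apply: measurable_funB.
  by apply/funext => w; rewrite /B/= subr_ge0.
rewrite EFinM lee_pdivlMr// muleC -(setIT B) -integral_indic// -ge0_integralZl//; last first.
- by rewrite lee_fin ltW.
- by apply/measurable_EFinP; exact: measurable_indic.
apply: (@le_trans _ _ (\int[P]_w (\sum_j (c j)%:E * (\1_(A j) w)%:E))%E).
  apply: ge0_le_integral => //.
  - by move=> w _; rewrite mule_ge0// lee_fin ltW.
  - by apply/measurable_EFinP; apply: measurable_funM => //; exact: measurable_indic.
  - apply: emeasurable_sum => j; apply/measurable_EFinP.
    by apply: measurable_funM => //; exact: measurable_indic.
  - move=> w _; under eq_bigr do rewrite -EFinM; rewrite sumEFin -EFinM lee_fin indicE.
    case: (boolP (w \in B)) => [|_]; first by rewrite inE mulr1.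
    by rewrite mulr0 sumr_ge0// => j _; rewrite mulr_ge0.
rewrite ge0_integral_sum//; last 2 first.
- move=> j; apply/measurable_EFinP.
    by apply: measurable_funM => //; exact: measurable_indic.
- by move=> j w _; rewrite mule_ge0// lee_fin.
rewrite -sumEFin; apply: lee_sum => j _.
rewrite ge0_integralZl ?lee_fin//; last by apply/measurable_EFinP; exact: measurable_indic.
rewrite integral_indic// setIT EFinM; apply: lee_wpmul2l; [by rewrite lee_fin|exact: pA].
Qed.

Section inverse_norm.
Variables (R : realType) (d : measure_display) (T : measurableType d).
Variable P : probability T R.

Definition sgn_row b (e : {ffun 'I_b -> bool}) : 'rV[R]_b := \row_i (-1) ^+ e i.

Lemma vnorm_sgn_row b (e : {ffun 'I_b -> bool}) : vnorm (sgn_row e)^T = Num.sqrt b%:R.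
Proof.
congr Num.sqrt; rewrite (eq_bigr (fun=> 1)) ?sumr_const ?card_ord// => i _.
by rewrite !mxE; case: (e i); rewrite /= ?expr1 ?expr0 ?sqrrN expr1n.
Qed.

Lemma sgn_row_mul b (e : {ffun 'I_b -> bool}) (u : 'cV[R]_b) :
  (sgn_row e *m u) 0 0 = sgn_sum (fun i => u i 0) (index_enum 'I_b) e.
Proof. by rewrite mxE; apply: eq_bigr => i _; rewrite mxE. Qed.

Lemma staircase_signs_ge b (u : 'cV[R]_b) (L : nat) (eta : R) :
  0 < eta -> (0 < L)%N -> vnorm u = 1 ->
  1 - 3 / (4 * (L%:R * eta) ^+ 2) - L%:R * eta ^+ 2 <=
  (\sum_(e : {ffun 'I_b -> bool}) staircase L eta ((sgn_row e *m u) 0 0)) / #|{ffun 'I_b -> bool}|%:R.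
Proof.
move=> e0 L0 u1; set N : R := #|_|%:R.
have N0 : 0 < N by rewrite ltr0n card_ffun card_bool expn_gt0.
have u2 : \sum_(i <- index_enum 'I_b) u i 0 ^+ 2 = 1 by rewrite -vnorm_sqr u1 expr1n.
have uq := index_enum_uniq 'I_b.
set a := L%:R * eta.
have a0 : 0 < a by rewrite mulr_gt0// ltr0n.
have k0 : 0 < 4 * a ^+ 2 by rewrite mulr_gt0// exprn_gt0.
rewrite ler_pdivlMr//.
apply: (@le_trans _ _ (\sum_(e : {ffun 'I_b -> bool})
   (((sgn_row e *m u) 0 0) ^+ 2 - ((sgn_row e *m u) 0 0) ^+ 4 / (4 * a ^+ 2) - L%:R * eta ^+ 2))); last first.
  by apply: ler_sum => e _; exact: staircase_ge.
rewrite !sumrB sumr_const -mulr_suml -[X in _ <= _ - X]mulr_natl -/N.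
under eq_bigr do rewrite sgn_row_mul.
rewrite sum_sgn_sqr// u2 mulr1 -/N.
have : \sum_(e : {ffun 'I_b -> bool}) (sgn_row e *m u) 0 0 ^+ 4 <= 3 * N.
  under eq_bigr do rewrite sgn_row_mul.
  by apply: le_trans (sum_sgn_quartic _ uq) _; rewrite u2 expr1n mulr1.
rewrite -(ler_pM2r (x := (4 * a ^+ 2)^-1)) ?invr_gt0// => h.
by move: h; rewrite -/N; lra.
Qed.

(* If [|M^-1| > t], pick a unit [x] with [u = M^-1 x] longer than [t]: for each
   sign vector [v], [|v M^-1| >= |v u|], and [v u / |u|] has second moment [1] and
   fourth moment at most [3] over [v].  The levels [l eta t] are weighted so that
   the bounds [1 / x] on the tails add up to [2 L eta]. *)
Lemma inv_norm_tail n b (V : 'M[R]_(n, b)) (Om : T -> 'M[R]_(n, b)) (t eta tau : R) (L : nat) :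
  gauss_mx P Om -> V^T *m V = 1%:M -> 0 < t -> 0 < eta -> (0 < L)%N -> 0 < tau ->
  tau <= 1 - 3 / (4 * (L%:R * eta) ^+ 2) - L%:R * eta ^+ 2 ->
  exists B : set T, [/\ measurable B,
    forall w, ~ B w -> V^T *m Om w \in unitmx /\ norm2 (invmx (V^T *m Om w)) <= t &
    (P B <= ((2 * (L%:R * eta)) * (2 * normal_peak 1) * Num.sqrt b%:R / t / tau)%:E)%E].
Proof.
move=> gO VV t0 e0 L0 tau0 htau.
pose J : finType := ({ffun 'I_b -> bool} * 'I_L)%type.
pose N : R := #|{ffun 'I_b -> bool}|%:R.
have N0 : 0 < N by rewrite ltr0n card_ffun card_bool expn_gt0.
pose lev (l : 'I_L) := l.+1%:R * eta * t.
have lev0 l : 0 < lev l by rewrite !mulr_gt0// ltr0n.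
pose A (j : J) := inv_large V Om (sgn_row j.1) (lev j.2).
pose c (j : J) := 2 * j.2.+1%:R * eta ^+ 2 / N.
pose p (j : J) := 2 * normal_peak 1 * (Num.sqrt b%:R / lev j.2).
have c0 j : 0 <= c j by rewrite /c !mulr_ge0 ?invr_ge0 ?sqr_ge0// ltW.
have mA j : measurable (A j) by apply: measurable_inv_large gO _; exact: ltW.
have pA j : (P (A j) <= (p j)%:E)%E.
  by rewrite /p -(vnorm_sgn_row j.1); exact: inv_large_le.
have mk := markov_indic tau0 c0 mA pA.
set B0 := [set w | _] in mk.
have mB0 : measurable B0.
  rewrite (_ : B0 = [set w | 0 <= (\sum_j c j * \1_(A j) w) - tau]).
    apply: measurable_set_ge0; apply: measurable_funB => //.
    by apply: measurable_sum => j; apply: measurable_funM => //; exact: measurable_indic.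
  by apply/funext => w; rewrite /B0/= subr_ge0.
have md := measurable_det_eq0 V gO.
(* The null event of singular blocks joins the exceptional set, so that [invmx] is an inverse
   outside it. *)
exists (B0 `|` [set w | \det (V^T *m Om w) = 0]); split.
- exact: measurableU.
- move=> w /not_orP[nB nd].
  have uM : V^T *m Om w \in unitmx by rewrite unitmxE unitfE; apply/eqP.
  split=> //; apply: norm2_le => [|x]; first exact: ltW.
  rewrite leNgt; apply/negP => hx; apply: nB; rewrite /B0/=.
  have x0 : 0 < vnorm x.
    rewrite lt_neqAle vnorm_ge0 andbT eq_sym vnorm_eq0; apply/eqP => x0.
    by move: hx; rewrite x0 mulmx0 !vnorm0 mulr0 ltxx.
  set u := invmx (V^T *m Om w) *m x in hx.
  have u0 : 0 < vnorm u by apply: le_lt_trans hx; rewrite mulr_ge0 ?vnorm_ge0// ltW.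
  apply: le_trans htau _.
  have u1 : vnorm ((vnorm u)^-1 *: u) = 1.
    by rewrite vnormZ ger0_norm ?invr_ge0 ?(ltW u0)// mulVf// gt_eqF.
  apply: le_trans (staircase_signs_ge e0 L0 u1) _.
  rewrite -/N mulr_suml.
  apply: (@le_trans _ _ (\sum_(e : {ffun 'I_b -> bool}) \sum_(l < L) c (e, l) * \1_(A (e, l)) w)); last first.
    by rewrite pair_bigA; apply: ler_sum => -[e l] _.
  apply: ler_sum => e _; rewrite /staircase mulr_suml; apply: ler_sum => l _.
  rewrite /c/= mulrAC ler_wpM2l ?divr_ge0 ?mulr_ge0 ?sqr_ge0 ?(ltW N0) ?(ltW e0)//.
  case: (boolP (l.+1%:R * eta < `|(sgn_row e *m ((vnorm u)^-1 *: u)) 0 0|)) => [h|_]; last by rewrite indicE.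
  rewrite indicE.
  suff : A (e, l) w by move/mem_set => ->.
  right; rewrite /lev/=.
  move: h; rewrite -scalemxAr mxE normrM normfV (ger0_norm (vnorm_ge0 u)) [X in _ < X]mulrC ltr_pdivlMr// => h.
  rewrite -(ltr_pM2r x0).
  apply: (@lt_le_trans _ _ `|(sgn_row e *m u) 0 0|).
    by apply: lt_trans h; rewrite -(mulrA (l.+1%:R * eta)) ltr_pM2l// mulr_gt0// ltr0n.
  rewrite /u mulmxA.
  rewrite -(ler_pXn2r (n := 2))// ?nnegrE ?mulr_ge0 ?vnorm_ge0//.
  rewrite real_normK ?num_real// exprMn; apply: le_trans (dot_sqr_le _ _).
  by rewrite trmxK.
- apply: le_trans (measureU2 _ _ _) _ => //.
  rewrite -[leRHS]adde0; apply: leeD; last first.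
    by move: (gauss_det_neq0 gO VV) => /eqP; rewrite eq_le => /andP[].
  apply: le_trans mk _; rewrite lee_fin ler_wpM2r ?invr_ge0 ?(ltW tau0)//.
  rewrite (eq_bigr (fun=> 2 * eta * (2 * normal_peak 1) * Num.sqrt b%:R / t / N)).
    rewrite sumr_const card_prod card_ord -[X in X <= _]mulr_natl natrM -/N.
    rewrite le_eqVlt; apply/orP; left; apply/eqP; field.
    by rewrite !gt_eqF.
  move=> [e l] _; rewrite /c /p /lev/=; field.
  by rewrite -/N !gt_eqF// ltr_pwDl.
Qed.

End inverse_norm.

(** * The spectral norm of a Gaussian block *)

Section grid_rounding.
Variable R : realType.

Lemma trmx_scale (p r : nat) (a : R) (M : 'M[R]_(p, r)) : (a *: M)^T = a *: M^T.
Proof. by apply/matrixP => i j; rewrite !mxE. Qed.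

Definition grid_coord (N : nat) (h : R) (k : nat) : R := h * (k%:R - N%:R).

(** Rounding [u] at random to its two grid neighbours with mean [u] keeps the linear term and adds
    to the square a variance [th (1 - th) h^2 <= h^2 / 4]; some neighbour does at least as well as
    the mean. The condition on [N] leaves room for the upper neighbour. *)
Lemma round_coord (N : nat) (h u l al : R) : 0 < h -> 0 <= al -> `|u| <= 1 -> h^-1 + 1 <= N%:R ->
  exists k : 'I_(N.*2.+1), l * u - al * u ^+ 2 - al * h ^+ 2 / 4 <=
     l * grid_coord N h k - al * grid_coord N h k ^+ 2.
Proof.
move=> h0 al0 u1 hN.
set m := Num.floor (u / h).
have m1 : m%:~R <= u / h by exact: floor_le_tmp.
have m2 : u / h < m%:~R + 1 by rewrite -[1]/(1%:~R) -intrD; exact: floorD1_gt.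
have uh : `|u / h| <= h^-1.
  by rewrite normrM normfV (gtr0_norm h0) ler_piMl// invr_ge0 ltW.
have := uh; rewrite ler_norml => /andP[uh1 uh2].
have mN1 : - (N%:R : R) <= m%:~R by lra.
have mN2 : m%:~R + 1 <= (N%:R : R) by lra.
set x := (h * m%:~R : R).
have xu : x <= u by rewrite /x mulrC -ler_pdivlMr.
have ux : u <= x + h by rewrite -[in X in _ + X](mulr1 h) -mulrDr mulrC -ler_pdivrMr// ltW.
have [k kE] : exists k : nat, (k%:R : R) = m%:~R + N%:R /\ (k.+1 < N.*2.+1)%N.
  have : (0 <= m + N%:Z)%R.
    by rewrite -(ler_int R) intrD -lerBlDr sub0r.
  case E : (m + N%:Z) => [k|//] _; exists k.
  have kE : (k%:R : R) = m%:~R + N%:R.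
    by rewrite -[k%:R]/((Posz k)%:~R) -E intrD.
  split=> //; rewrite ltnS -(ler_nat R) -natr1 kE -addnn natrD; lra.
case: kE => kE kN.
have g1 : grid_coord N h k = x by rewrite /grid_coord kE addrK.
have g2 : grid_coord N h k.+1 = x + h by rewrite /grid_coord -natr1 kE /x; ring.
have [H|H] := leP (l * u - al * u ^+ 2 - al * h ^+ 2 / 4) (l * x - al * x ^+ 2).
  by exists (Ordinal (ltnW kN)); rewrite /= g1.
exists (Ordinal kN); rewrite /= g2.
(* [u = (1 - th) x + th (x + h)], so the mean of the objective over the two
   neighbours exceeds the left-hand side. *)
set th := (u - x) / h.
have th0 : 0 <= th by rewrite divr_ge0 ?subr_ge0// ltW.
have th1 : th <= 1 by rewrite ler_pdivrMr// mul1r; lra.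
have uE : u = x + th * h by rewrite /th divfK ?gt_eqF//; ring.
set f1 := l * x - al * x ^+ 2 in H *.
set f2 := l * (x + h) - al * (x + h) ^+ 2.
set f := l * u - al * u ^+ 2 - al * h ^+ 2 / 4 in H *.
have cv : f <= (1 - th) * f1 + th * f2.
  have q0 : 0 <= al * h ^+ 2 * (1 - 2 * th) ^+ 2 / 4 
    by rewrite divr_ge0// mulr_ge0 ?sqr_ge0// mulr_ge0 ?sqr_ge0.
  rewrite -subr_ge0; apply: le_trans q0 _; rewrite le_eqVlt; apply/orP; left; apply/eqP.
  by rewrite /f /f1 /f2 uE; field.
have [th_0|th_0] := eqVneq th 0; first by move: cv H; rewrite th_0; lra.
have thp : 0 < th by rewrite lt_neqAle eq_sym th_0.
rewrite leNgt; apply/negP => H2.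
have : th * f2 < th * f by rewrite ltr_pM2l.
have : (1 - th) * f1 <= (1 - th) * f by rewrite ler_wpM2l ?subr_ge0// ltW.
by lra.
Qed.

Definition grid_pt (p N : nat) (h : R) (k : {ffun 'I_p -> 'I_(N.*2.+1)}) : 'cV[R]_p :=
  \col_i grid_coord N h (k i).

Lemma round_vec (p N : nat) (h al : R) (l u : 'cV[R]_p) :
  0 < h -> 0 <= al -> vnorm u = 1 -> h^-1 + 1 <= N%:R ->
  exists k : {ffun 'I_p -> 'I_(N.*2.+1)},
    (u^T *m l) 0 0 - al * (1 + p%:R * h ^+ 2 / 4) <=
    ((grid_pt h k)^T *m l) 0 0 - al * vnorm (grid_pt h k) ^+ 2.
Proof.
move=> h0 al0 u1 hN.
have ui i : `|u i 0| <= 1.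
  rewrite -u1 -sqrtr_sqr ler_wsqrtr// (bigD1 i)//= lerDl sumr_ge0// => k _; exact: sqr_ge0.
have [k kP] := fin_all_exists (fun i => round_coord (l i 0) h0 al0 (ui i) hN).
exists [ffun i => k i].
have -> : al * (1 + p%:R * h ^+ 2 / 4) = \sum_i (al * u i 0 ^+ 2 + al * h ^+ 2 / 4).
  rewrite big_split/= -mulr_sumr -vnorm_sqr u1 expr1n sumr_const card_ord -[X in _ = _ + X]mulr_natl.
  by ring.
rewrite vnorm_sqr mulr_sumr !mxE -!sumrB; apply: ler_sum => i _.
by rewrite !mxE !ffunE; have := kP i; lra.
Qed.

(* The roundings are made one after the other: [x] first, with the quadratic
   penalty inflated to pay in advance for the rounding of [y]. *)
Lemma norm2_grid (p r N1 N2 : nat) (G : 'M[R]_(p, r)) (h1 h2 s la mu rho : R) :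
  0 < h1 -> 0 < h2 -> h1^-1 + 1 <= N1%:R -> h2^-1 + 1 <= N2%:R ->
  0 < s -> 0 <= la -> 0 <= mu -> 0 <= rho ->
  (forall (k : {ffun 'I_p -> 'I_(N1.*2.+1)}) (k' : {ffun 'I_r -> 'I_(N2.*2.+1)}),
    s * ((grid_pt h1 k)^T *m G *m grid_pt h2 k') 0 0 <=
    s ^+ 2 / 2 * (vnorm (grid_pt h1 k) ^+ 2 * vnorm (grid_pt h2 k') ^+ 2)
     + la * vnorm (grid_pt h1 k) ^+ 2 + mu * vnorm (grid_pt h2 k') ^+ 2 + rho) ->
  s * norm2 G <= s ^+ 2 / 2 * ((1 + p%:R * h1 ^+ 2 / 4) * (1 + r%:R * h2 ^+ 2 / 4))
    + la * (1 + p%:R * h1 ^+ 2 / 4) + mu * (1 + r%:R * h2 ^+ 2 / 4) + rho.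
Proof.
move=> h10 h20 hN1 hN2 s0 la0 mu0 rho0 H.
set A1 := 1 + p%:R * h1 ^+ 2 / 4; set A2 := 1 + r%:R * h2 ^+ 2 / 4.
have A10 : 0 <= A1 by rewrite addr_ge0// divr_ge0// mulr_ge0// sqr_ge0.
have A20 : 0 <= A2 by rewrite addr_ge0// divr_ge0// mulr_ge0// sqr_ge0.
set C := (X in _ <= X).
have s20 : 0 <= s ^+ 2 / 2 by rewrite divr_ge0 ?sqr_ge0.
have C0 : 0 <= C.
  rewrite /C; apply: addr_ge0 => //; apply: addr_ge0; last exact: mulr_ge0.
  by apply: addr_ge0; apply: mulr_ge0 => //; apply: mulr_ge0.
rewrite mulrC -ler_pdivlMr//; apply: norm2_le => [|z]; first by rewrite divr_ge0// ltW.
have [->|z0] := eqVneq z 0; first by rewrite mulmx0 !vnorm0 mulr0.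
have zp : 0 < vnorm z by rewrite vnorm_gt0.
set v := (vnorm z)^-1 *: z.
have v1 : vnorm v = 1 by rewrite vnormZ ger0_norm ?invr_ge0 ?(ltW zp)// mulVf// gt_eqF.
have zE : z = vnorm z *: v by rewrite scalerA divff ?gt_eqF// scale1r.
clearbody v.
rewrite {1}zE -scalemxAr vnormZ (gtr0_norm zp) mulrC ler_pM2r//.
have [->|g0] := eqVneq (G *m v) 0; first by rewrite vnorm0 divr_ge0// ltW.
have gp : 0 < vnorm (G *m v) by rewrite vnorm_gt0.
set u := (vnorm (G *m v))^-1 *: (G *m v).
have u1 : vnorm u = 1 by rewrite vnormZ ger0_norm ?invr_ge0 ?(ltW gp)// mulVf// gt_eqF.
have uG : (u^T *m (s *: (G *m v))) 0 0 = s * vnorm (G *m v).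
  rewrite /u; move: (G *m v) gp => g gp.
  rewrite trmx_scale -scalemxAl -scalemxAr [LHS]mxE [X in _ * X]mxE -vnorm_dot expr2.
  by rewrite mulrCA mulKf// gt_eqF.
have al10 : 0 <= s ^+ 2 / 2 * A2 + la by rewrite addr_ge0// mulr_ge0.
have [k] := round_vec (s *: (G *m v)) h10 al10 u1 hN1.
rewrite -/A1 uG; set x := grid_pt h1 k => kP.
have al20 : 0 <= s ^+ 2 / 2 * vnorm x ^+ 2 + mu by rewrite addr_ge0// mulr_ge0// sqr_ge0.
have [k'] := round_vec (s *: (G^T *m x)) h20 al20 v1 hN2.
rewrite -/A2; set y := grid_pt h2 k' => kP'.
have dotC (z1 z2 : 'cV[R]_r) : (z1^T *m z2) 0 0 = (z2^T *m z1) 0 0.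
  by rewrite !mxE; apply: eq_bigr => i _; rewrite !mxE mulrC.
have E1 : (v^T *m (s *: (G^T *m x))) 0 0 = (x^T *m (s *: (G *m v))) 0 0.
  by rewrite dotC trmx_scale trmx_mul trmxK -scalemxAl -scalemxAr mulmxA.
have E2 : (y^T *m (s *: (G^T *m x))) 0 0 = s * (x^T *m G *m y) 0 0.
  by rewrite dotC trmx_scale trmx_mul trmxK -scalemxAl mxE.
have := H k k'; rewrite -/x -/y -/A1 -/A2.
rewrite ler_pdivlMr// mulrC; move: kP kP'; rewrite E1 E2 /C.
set q1 := (x^T *m _) 0 0; set X2 := vnorm x ^+ 2; set Y2 := vnorm y ^+ 2.
by lra.
Qed.

End grid_rounding.

Section theta_sum.
Variable R : realType.

Lemma expR_ge_taylor4 (x : R) : 0 <= x ->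
  1 + x + x ^+ 2 / 2 + x ^+ 3 / 6 + x ^+ 4 / 24 <= expR x.
Proof.
move=> x0; have h : series (exp_coeff x) 5%N <= expR x.
  apply: nondecreasing_cvgn_le; last exact: is_cvg_series_exp_coeff.
  apply/nondecreasing_seqP => n; rewrite /series/= big_nat_recr//= lerDl.
  by rewrite /exp_coeff/= divr_ge0// exprn_ge0.
apply: le_trans h; rewrite /series/= !big_nat_recr//= big_geq// /exp_coeff/=.
by rewrite !factS fact0 !muln1 expr0 expr1 /=; lra.
Qed.

Lemma expRN_6_5 : expR (- (6 / 5)) <= 3^-1 :> R.
Proof.
rewrite expRN lef_pV2 ?posrE ?expR_gt0//.
by apply: le_trans (expR_ge_taylor4 _); lra.
Qed.

(** As [k^2 >= k], the sum is at most [1 + 2 (1/3 + ... + 3^-N)], which is [2 - 3^-N]. *)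
Lemma theta_sum_le (a : R) (N : nat) : 0 <= a -> expR (- a) <= 3^-1 ->
  \sum_(k < N.*2.+1) expR (- (a * (k%:R - N%:R) ^+ 2)) <= 2 - 3^-1 ^+ N.
Proof.
move=> a0 ha; elim: N => [|N IH].
  by rewrite big_ord_recl big_ord0 /= subrr expr0n mulr0 oppr0 expR0 expr0; lra.
have e3 : expR (- (a * N.+1%:R ^+ 2)) <= 3^-1 ^+ N.+1.
  apply: (@le_trans _ _ (expR (- a) ^+ N.+1)); last first.
    by rewrite lerXn2r ?nnegrE ?expR_ge0.
  rewrite -expRM_natl ler_expR mulrN lerN2 mulrC ler_wpM2l//.
  by rewrite expr2 ler_peMl// ler1n.
rewrite doubleS big_ord_recl big_ord_recr /=.
under eq_bigr => k _.
  rewrite /bump /= add1n -[N.+1%:R]natr1 -[k.+1%:R]natr1.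
  rewrite (_ : k%:R + 1 - (N%:R + 1) = k%:R - N%:R :> R); last by ring.
  over.
rewrite sub0r sqrrN.
have -> : ((bump 0 N.*2.+1)%:R - N.+1%:R) = N.+1%:R :> R.
  by rewrite /bump /= add1n -doubleS -addnn natrD addrK.
by move: IH e3; rewrite [3^-1 ^+ N.+1]exprS; lra.
Qed.

(** The weight is a product over coordinates, so the sum over grid points is a product of [p]
    one-dimensional sums, each at most 2. *)
Lemma grid_sum_le (p N : nat) (h la : R) : 0 <= la * h ^+ 2 -> expR (- (la * h ^+ 2)) <= 3^-1 ->
  \sum_(k : {ffun 'I_p -> 'I_(N.*2.+1)}) expR (- (la * vnorm (grid_pt h k) ^+ 2)) <= 2 ^+ p.
Proof.
move=> a0 ha.
rewrite (eq_bigr (fun k : {ffun 'I_p -> 'I_(N.*2.+1)} =>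
  \prod_i expR (- (la * h ^+ 2 * ((k i : nat)%:R - N%:R) ^+ 2)))); last first.
  move=> k _; rewrite vnorm_sqr mulr_sumr -sumrN expR_sum; apply: eq_bigr => i _.
  by rewrite mxE /grid_coord; congr expR; ring.
rewrite -(bigA_distr_bigA (fun (i : 'I_p) (k : 'I_(N.*2.+1)) => expR (- (la * h ^+ 2 * (k%:R - N%:R) ^+ 2)))).
rewrite prodr_const card_ord lerXn2r// ?nnegrE.
- by apply: sumr_ge0 => k _; exact: expR_ge0.
- by [].
by apply: le_trans (theta_sum_le _ a0 ha) _; rewrite gerBl exprn_ge0// invr_ge0.
Qed.

End theta_sum.

Section gaussian_norm.
Variables (R : realType) (d : measure_display) (T : measurableType d).
Variable P : probability T R.

Lemma bilinear_sum n b (V : 'cV[R]_n) (Om : 'M[R]_(n, b)) (y : 'cV[R]_b) :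
  (V^T *m Om *m y) 0 0 = \sum_(kl : 'I_n * 'I_b) (V kl.1 0 * y kl.2 0) * Om kl.1 kl.2.
Proof.
rewrite -(pair_bigA _ (fun k l => V k 0 * y l 0 * Om k l)) exchange_big mxE.
apply: eq_bigr => l _; rewrite mxE mulr_suml; apply: eq_bigr => k _; rewrite mxE; ring.
Qed.

(** The form is centred Gaussian with standard deviation [|V| |y|]. Keeping the threshold in the
    exponential form of Chernoff's bound lets one [s] serve grid points of all norms. *)
Lemma bilinear_tail n b (V : 'cV[R]_n) (Om : T -> 'M[R]_(n, b)) (y : 'cV[R]_b) (s r : R) :
  gauss_mx P Om -> 0 < s -> 0 <= r ->
  (P [set w | s ^+ 2 / 2 * (vnorm V ^+ 2 * vnorm y ^+ 2) + r < s * (V^T *m Om w *m y) 0 0]%R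
    <= (expR (- r))%:E)%E.
Proof.
move=> gO s0 r0.
pose nu := Num.sqrt (\sum_(kl : 'I_n * 'I_b) (V kl.1 0 * y kl.2 0) ^+ 2).
have nu0 : 0 <= nu by exact: sqrtr_ge0.
have nu2 : vnorm V ^+ 2 * vnorm y ^+ 2 = nu ^+ 2.
  rewrite [in RHS]/nu [RHS]sqr_sqrtr; last by apply: sumr_ge0 => kl _; exact: sqr_ge0.
  transitivity (\sum_k \sum_l (V k 0 * y l 0) ^+ 2); last by rewrite pair_bigA.
  rewrite !vnorm_sqr mulr_suml.
  by apply: eq_bigr => k _; rewrite mulr_sumr; apply: eq_bigr => l _; rewrite exprMn.
set A := [set x : R | s ^+ 2 / 2 * nu ^+ 2 + r < s * x].
have mA : measurable A.
  rewrite (_ : A = [set x | 0 < s * x - (s ^+ 2 / 2 * nu ^+ 2 + r)]); last first.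
    by apply/funext => x; rewrite /A/= subr_gt0.
  by apply: measurable_set_gt0; apply: measurable_funB => //; apply: measurable_funM.
rewrite (_ : [set w | _] = [set w | A (\sum_(kl : 'I_n * 'I_b) (V kl.1 0 * y kl.2 0) * Om w kl.1 kl.2)]); last first.
  by apply/funext => w; rewrite /A/= bilinear_sum nu2.
rewrite (gauss_family_lin (fun kl : 'I_n * 'I_b => V kl.1 0 * y kl.2 0) gO mA) -/nu.
have [n0|n0] := eqVneq nu 0.
  rewrite (_ : [set x | _] = set0) ?measure0 ?lee_fin ?expR_ge0//.
  apply/seteqP; split => x //=; rewrite /A/= n0 mul0r expr0n/= !mulr0 add0r.
  by rewrite ltNge r0.
have np : 0 < nu by rewrite lt_neqAle eq_sym n0.
have snp : 0 < s * nu by rewrite mulr_gt0.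
set t := s * nu / 2 + r / (s * nu).
have t0 : 0 <= t by rewrite addr_ge0// divr_ge0// ltW.
apply: (@le_trans _ _ (normal_prob 0 1 [set x : R | t <= x])).
  apply: le_measure; rewrite ?inE.
  - rewrite (_ : [set x | _] = (fun x => nu * x) @^-1` A)// -[Y in measurable Y]setTI.
    by apply: (_ : measurable_fun setT (fun x => nu * x)) => //; apply: measurable_funM.
  - rewrite (_ : [set x | _] = `[t, +oo[%classic)//.
    by apply/seteqP; split => x /=; rewrite in_itv/= andbT.
  - move=> x; rewrite /A/= => h; rewrite -(ler_pM2l snp) -[leRHS]mulrA ltW//.
    apply: le_lt_trans h; rewrite le_eqVlt; apply/orP; left; apply/eqP.
    by rewrite /t; field; rewrite !gt_eqF.
apply: le_trans (normal_prob_ge t0) _; rewrite lee_fin ler_expR lerN2.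
(* [t^2 / 2 >= r] by AM-GM. *)
have -> : t ^+ 2 / 2 = r + (s * nu / 2 - r / (s * nu)) ^+ 2 / 2.
  by rewrite /t; field; rewrite !gt_eqF.
by rewrite lerDl divr_ge0// sqr_ge0.
Qed.

(** The allowance at a grid point contains [la |x|^2 + mu |y|^2], so the failure probabilities carry
    Gaussian weights with sum at most [2 ^+ p * 2 ^+ b]. The constants are [49/50 = (7/5)^2 / 2] and
    [21/20 = (3/4) (7/5)]. *)
Lemma op_norm_tail n p b (V : 'M[R]_(n, p)) (Om : T -> 'M[R]_(n, b)) (s rho : R) :
  gauss_mx P Om -> V^T *m V = 1%:M -> (0 < p)%N -> (0 < b)%N -> 0 < s -> 0 <= rho ->
  exists B : set T, [/\ measurable B,
    forall w, ~ B w -> s * norm2 (V^T *m Om w) <= 49 / 50 * s ^+ 2 + 21 / 20 * (p%:R + b%:R) + rho &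
    (P B <= (2 ^+ (p + b) * expR (- rho))%:E)%E].
Proof.
move=> gO VV p0 b0 s0 rho0.
have pp : 0 < p%:R :> R by rewrite ltr0n.
have bp : 0 < b%:R :> R by rewrite ltr0n.
pose h (m : nat) : R := Num.sqrt (8 / 5 / m%:R).
have h2 m : (0 < m)%N -> h m ^+ 2 = 8 / 5 / m%:R.
  by move=> m0; rewrite sqr_sqrtr// !divr_ge0.
have h0 m : (0 < m)%N -> 0 < h m.
  by move=> m0; rewrite sqrtr_gt0 divr_gt0 ?ltr0n//; lra.
have exN (x : R) : exists N : nat, x <= N%:R.
  by exists (Num.bound `|x|); apply: le_trans (ler_norm _) (ltW (archi_boundP (normr_ge0 x))).
have [N1 hN1] := exN ((h p)^-1 + 1).
have [N2 hN2] := exN ((h b)^-1 + 1).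
(* The squared mesh [8 / (5 p)] inflates squared norms by [7/5] on average, and
   [la * h p ^+ 2 = mu * h b ^+ 2 = 6/5 >= ln 3]. *)
pose la : R := 3 / 4 * p%:R; pose mu : R := 3 / 4 * b%:R.
pose J : finType := ({ffun 'I_p -> 'I_(N1.*2.+1)} * {ffun 'I_b -> 'I_(N2.*2.+1)})%type.
pose x (j : J) := grid_pt (h p) j.1; pose y (j : J) := grid_pt (h b) j.2.
pose r (j : J) := la * vnorm (x j) ^+ 2 + mu * vnorm (y j) ^+ 2 + rho.
have r0 j : 0 <= r j.
  by rewrite /r !addr_ge0// mulr_ge0 ?sqr_ge0// mulr_ge0.
pose A (j : J) := [set w | s ^+ 2 / 2 * (vnorm (V *m x j) ^+ 2 * vnorm (y j) ^+ 2) + r j <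
   s * ((V *m x j)^T *m Om w *m y j) 0 0].
have mA j : measurable (A j).
  rewrite (_ : A j = [set w | 0 < s * (\sum_(kl : 'I_n * 'I_b) ((V *m x j) kl.1 0 * y j kl.2 0) * Om w kl.1 kl.2)
    - (s ^+ 2 / 2 * (vnorm (V *m x j) ^+ 2 * vnorm (y j) ^+ 2) + r j)]); last first.
    by apply/funext => w; rewrite /A/= bilinear_sum subr_gt0.
  apply: measurable_set_gt0; apply: measurable_funB => //; apply: measurable_funM => //.
  apply: measurable_sum => kl; apply: measurable_funM => //; exact: gauss_mx_measurable gO _ _.
have pA j : (P (A j) <= (expR (- r j))%:E)%E by exact: bilinear_tail.
have mk := markov_indic ltr01 (fun=> ler01) mA pA.
set B := [set w | _] in mk.
have mB : measurable B.
  rewrite (_ : B = [set w | 0 <= (\sum_(j : J) (1 : R) * \1_(A j) w) - 1]); last first.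
    by apply/funext => w; rewrite /B/= subr_ge0.
  apply: measurable_set_ge0; apply: measurable_funB => //.
  by apply: measurable_sum => j; apply: measurable_funM => //; exact: measurable_indic.
exists B; split => //.
- move=> w nB.
  have nA j : ~ A j w.
    move=> Aj; apply: nB; rewrite /B/= (bigD1 j)//= indicE mem_set// mulr1 lerDl.
    by apply: sumr_ge0 => k _; rewrite mul1r indicE.
  have := @norm2_grid R p b N1 N2 (V^T *m Om w) (h p) (h b) s la mu rho (h0 _ p0) (h0 _ b0) hN1 hN2 s0.
  have la0 : 0 <= la by rewrite mulr_ge0.
  have mu0 : 0 <= mu by rewrite mulr_ge0.
  move=> /(_ la0 mu0 rho0).
  have -> : 1 + p%:R * h p ^+ 2 / 4 = 7 / 5 by rewrite h2//; field; rewrite gt_eqF.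
  have -> : 1 + b%:R * h b ^+ 2 / 4 = 7 / 5 by rewrite h2//; field; rewrite gt_eqF.
  move=> H; apply: le_trans (H _) _; last by rewrite /la /mu; lra.
  move=> k k'; have := nA (k, k'); rewrite /A/= /x /y/= => /negP; rewrite -leNgt.
  by rewrite vnorm_isometry// /r /x /y/= trmx_mul -!mulmxA !addrA.
- apply: le_trans mk _; rewrite divr1 lee_fin.
  rewrite (eq_bigr (fun j => expR (- rho) * (expR (- (la * vnorm (x j) ^+ 2)) * expR (- (mu * vnorm (y j) ^+ 2))))); last first.
    by move=> j _; rewrite mul1r /r -!expRD; congr expR; ring.
  rewrite -mulr_sumr mulrC ler_wpM2r ?expR_ge0//.
  rewrite -(pair_bigA _ (fun k k' => expR (- (la * vnorm (grid_pt (h p) k) ^+ 2)) * expR (- (mu * vnorm (grid_pt (h b) k') ^+ 2)))).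
  under eq_bigr do rewrite -mulr_sumr.
  rewrite -mulr_suml exprD; apply: ler_pM.
  + by apply: sumr_ge0 => k _; exact: expR_ge0.
  + by apply: sumr_ge0 => k _; exact: expR_ge0.
  + have E : la * h p ^+ 2 = 6 / 5 by rewrite h2// /la; field; rewrite gt_eqF.
    by apply: grid_sum_le; rewrite E; [lra|exact: expRN_6_5].
  + have E : mu * h b ^+ 2 = 6 / 5 by rewrite h2// /mu; field; rewrite gt_eqF.
    by apply: grid_sum_le; rewrite E; [lra|exact: expRN_6_5].
Qed.

End gaussian_norm.

(** * The probabilistic bound *)

Section numerical_constants.
Variable R : realType.

Lemma expR1_ge : 27 / 10 <= expR 1 :> R.
Proof. by apply: le_trans (expR_ge_taylor4 ler01); lra. Qed.

Lemma two_le_expR : 2 <= expR (7 / 10) :> R.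
Proof. by apply: le_trans (expR_ge_taylor4 _); lra. Qed.

Lemma sin_le_id (x : R) : 0 <= x -> sin x <= x.
Proof.
move=> x0.
have [c _] := @MVT_segment R sin cos 0 x x0 (fun z _ => is_derive_sin z)
  (continuous_subspaceT (@continuous_sin R)).
by rewrite sin0 !subr0 => ->; rewrite ler_piMl// cos_le1.
Qed.

(** [sin (pi / 4) ^+ 2 = 1/2] and [sin x <= x] give [pi >= 2 sqrt 2], slightly above [141/50]. *)
Lemma pi_ge : 141 / 50 <= pi :> R.
Proof.
have p0 := @pi_gt0 R.
have h : sin (pi / 4) <= pi / 4 :> R by apply: sin_le_id; lra.
have s0 : 0 <= sin (pi / 4) :> R by apply: sin_ge0_pi; lra.
have c : sin (pi / 4) ^+ 2 = 2^-1 :> R.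
  have := @cos_pihalf R; rewrite (_ : pi / 2 = pi / 4 *+ 2); last by rewrite -mulr_natr; field.
  by rewrite cos_mulr2n cos2sin2; lra.
rewrite leNgt; apply/negP => hp.
have : sin (pi / 4) ^+ 2 <= (pi / 4) ^+ 2 :> R by rewrite ler_pXn2r// ?nnegrE//; lra.
rewrite c; nra.
Qed.

(** The left-hand side is [sqrt (2 / pi)], and [2 / pi <= 100/141 < (27/32)^2]. *)
Lemma normal_peak1_le : 2 * normal_peak 1 <= 27 / 32 :> R.
Proof.
rewrite /normal_peak expr1n mul1r -(ler_pXn2r (n := 2))// ?nnegrE; last 2 first.
- by rewrite mulr_ge0// invr_ge0 sqrtr_ge0.
- by lra.
have p0 := @pi_gt0 R; have hp := pi_ge.
rewrite exprMn exprVn sqr_sqrtr; last by rewrite mulrn_wge0// ltW.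
have p20 : 0 < pi *+ 2 :> R by rewrite mulrn_wgt0.
by rewrite ler_pdivrMr//; lra.
Qed.

End numerical_constants.

Section gaussian_blocks.
Variables (R : realType) (d : measure_display) (T : measurableType d).
Variable P : probability T R.

Lemma CconstE (n b : nat) (delta : R) : 0 < delta ->
  Cconst n delta b b = 2 * expR 1 * Num.sqrt b%:R * (2 / delta) *
    (Num.sqrt (n - b)%:R + Num.sqrt b%:R + Num.sqrt (2 * ln (2 / delta))).
Proof.
move=> d0; rewrite /Cconst subnn add0n invr1 powRr1 ?mulr1//.
by rewrite divr_ge0// ltW.
Qed.

(** The thresholds [131/50 * L] and [t] multiply exactly to [Cconst]. The norm of the lower block
    has an exponentially small tail and takes only [delta / 54] of the failure probability; the
    inverse, with its [1 / t] tail, takes [96/100 * delta]. *)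
Lemma gauss_blocks_tail (n b : nat) (V : 'M[R]_n) (Om : T -> 'M[R]_(n, b)) (delta : R) :
  V^T *m V = 1%:M -> gauss_mx P Om -> (0 < b)%N -> (b < n)%N -> 0 < delta < 1 ->
  exists E : set T,
    [/\ measurable E,
      E `<=` [set w | toprows b (V^T *m Om w) \in unitmx /\
         norm2 (botrows b (V^T *m Om w)) * norm2 (invmx (toprows b (V^T *m Om w)))
           <= Cconst n delta b b] &
      ((1 - delta)%:E <= P E)%E].
Proof.
move=> VV gO b0 bn /andP[d0 d1].
pose V1 : 'M[R]_(n, b) := colsub (widen_ord (ltnW bn)) V.
pose V2 : 'M[R]_(n, n - b) := colsub (@bot_ord n b) V.
have V1V1 : V1^T *m V1 = 1%:M.
  by apply: colsub_isometry => // i j /(congr1 val)/= /val_inj.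
have V2V2 : V2^T *m V2 = 1%:M by apply: colsub_isometry => //; exact: bot_ord_inj.
have topE w : toprows b (V^T *m Om w) = V1^T *m Om w.
  by rewrite (toprowsE (ltnW bn)) rowsub_trmul.
have botE w : botrows b (V^T *m Om w) = V2^T *m Om w.
  by rewrite botrowsE rowsub_trmul.
have nb0 : (0 < n - b)%N by rewrite subn_gt0.
pose l := ln (2 / delta).
have d2 : 1 < 2 / delta by rewrite ltr_pdivlMr// mul1r; lra.
have d2p : 0 < 2 / delta by exact: lt_trans ltr01 d2.
have l_ge : 2^-1 <= l.
  have h : ln 2 <= l by rewrite ler_ln ?posrE// ler_pdivlMr//; nra.
  apply: le_trans h; rewrite -[leLHS](expRK (R := R)) ler_ln ?posrE ?expR_gt0//.
  rewrite -[2^-1]opprK expRN -[leRHS]invrK lef_pV2 ?posrE ?expR_gt0 ?invr_gt0//.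
  by apply: le_trans (expR_ge1Dx _); lra.
have l0 : 0 <= 2 * l by lra.
set L := Num.sqrt (n - b)%:R + Num.sqrt b%:R + Num.sqrt (2 * l).
have sq1 m : (0 < m)%N -> 1 <= Num.sqrt (m%:R : R).
  by move=> m0; rewrite -[leLHS]sqrtr1 ler_wsqrtr// ler1n.
(* The squares sum to [n + 2 l]; the extra 2 is the cross term [2 sqrt (n - b) sqrt b], both roots
   being at least 1. *)
have L_sqr : n%:R + 2 * l + 2 <= L ^+ 2.
  have e1 : Num.sqrt ((n - b)%:R : R) ^+ 2 = (n - b)%:R by rewrite sqr_sqrtr.
  have e2 : Num.sqrt (b%:R : R) ^+ 2 = b%:R by rewrite sqr_sqrtr.
  have e3 : Num.sqrt (2 * l) ^+ 2 = 2 * l by rewrite sqr_sqrtr.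
  have nE : n%:R = (n - b)%:R + b%:R :> R by rewrite -natrD subnK// ltnW.
  have := sq1 _ nb0; have := sq1 _ b0; have := sqrtr_ge0 (2 * l).
  by move: e1 e2 e3 nE; rewrite /L; nra.
have L0 : 0 < L.
  by rewrite ltr_wpDr ?sqrtr_ge0// addr_gt0// sqrtr_gt0 ltr0n.
have s0 : 0 < 4 / 3 * L by rewrite mulr_gt0.
(* [4/3] nearly minimizes [49/50 s + 7/4 / s], which is at most [131/50] there;
   [rho] makes the exponent [- 7/4 (L^2 - n)] after [2^n <= exp (7/10 n)]. *)
pose rho : R := 7 / 10 * n%:R + 7 / 4 * (L ^+ 2 - n%:R).
have rho0 : 0 <= rho by rewrite /rho; have := ler0n R n; lra.
have [B1 [mB1 B1P pB1]] := op_norm_tail gO V2V2 nb0 b0 s0 rho0.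
pose t : R := 4 * expR 1 * Num.sqrt b%:R / (131 / 50 * delta).
have sb0 : 0 < Num.sqrt b%:R :> R by rewrite sqrtr_gt0 ltr0n.
have t0 : 0 < t by rewrite divr_gt0// !mulr_gt0// expR_gt0.
(* 100 steps of width [3/200], that is [a = 3/2] in [staircase_ge]. *)
have tau0 : 0 < 773 / 1200 :> R by lra.
have eta0 : 0 < 3 / 200 :> R by lra.
(* The value [a = 3/2] minimizes [a / (1 - 3 / (4 a^2))]; the right-hand side is then
   [1 - 1/3 - 9/400 = 773/1200]. *)
have tauP : 773 / 1200 <= 1 - 3 / (4 * (100%:R * (3 / 200)) ^+ 2) - 100%:R * (3 / 200) ^+ 2 :> R.
  by lra.
have [B2 [mB2 B2P pB2]] := inv_norm_tail gO V1V1 t0 eta0 (isT : (0 < 100)%N) tau0 tauP.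
have p1 : (P B1 <= (delta / 54)%:E)%E.
  apply: le_trans pB1 _; rewrite lee_fin subnK ?(ltnW bn)//.
  have e7 : 2 ^+ n <= expR (7 / 10 * n%:R) :> R.
    by rewrite expRM_natr lerXn2r ?nnegrE ?expR_ge0// two_le_expR.
  have := ler_wpM2r (expR_ge0 (- rho)) e7; rewrite -expRD => h; apply: le_trans h _.
  (* By [L_sqr] and [l >= 1/2]. The two exponentials on the right contribute [delta / 2] and
     [(1/3)^3], whence [delta / 54]. *)
  have : 7 / 10 * n%:R - rho <= - l - 3 * (6 / 5) by rewrite /rho; lra.
  rewrite -ler_expR => h; apply: le_trans h _.
  rewrite expRD [- (3 * _)](_ : _ = 3%:R * (- (6 / 5))); last by lra.
  rewrite expRM_natl expRN /l lnK ?posrE// invf_div.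
  have e3 := lerXn2r 3%N (expR_ge0 (- (6 / 5))) _ (expRN_6_5 R).
  have {}e3 : expR (- (6 / 5)) ^+ 3 <= (3^-1 : R) ^+ 3 by apply: e3; rewrite nnegrE.
  have := ler_wpM2l (ltW (divr_gt0 d0 (ltr0n R 2))) e3; lra.
have p2 : (P B2 <= (96 / 100 * delta)%:E)%E.
  apply: le_trans pB2 _; rewrite lee_fin ler_pdivrMr//.
  have -> : 2 * (100%:R * (3 / 200)) * (2 * normal_peak 1) * Num.sqrt b%:R / t =
     3 * (131 / 50) / (4 * expR 1) * (2 * normal_peak 1) * delta :> R.
    by rewrite /t; field; rewrite !gt_eqF ?expR_gt0.
  have e1 := expR1_ge R; have e2 := normal_peak1_le R.
  (* [e >= 27/10] gives [131/180]; times [27/32] and divided by [773/1200] this stays below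
     [96/100]. *)
  have h : 3 * (131 / 50) / (4 * expR 1) <= 131 / 180 :> R.
    by rewrite ler_pdivrMr ?mulr_gt0 ?expR_gt0//; lra.
  have pk0 := @normal_peak_ge0 R 1.
  have : 3 * (131 / 50) / (4 * expR 1) * (2 * normal_peak 1) <= 131 / 180 * (27 / 32) :> R.
    by apply: ler_pM => //; rewrite ?divr_ge0 ?mulr_ge0 ?expR_ge0.
  by nra.
exists (~` (B1 `|` B2)); split.
- by apply: measurableC; exact: measurableU.
- move=> w /not_orP[nB1 nB2] /=.
  have [uM iM] := B2P w nB2; rewrite topE botE; split => //.
  have := B1P w nB1 => h1.
  have h2 : norm2 (V2^T *m Om w) <= 131 / 50 * L.
    rewrite -(ler_pM2l s0); apply: le_trans h1 _; rewrite natrB ?(ltnW bn)// /rho.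
    by have := sqr_ge0 L; lra.
  apply: (@le_trans _ _ ((131 / 50 * L) * t)).
    by apply: ler_pM => //; exact: norm2_ge0.
  rewrite CconstE// -/l -/L /t le_eqVlt; apply/orP; left; apply/eqP.
  by field; rewrite gt_eqF.
- rewrite probability_setC; last exact: measurableU.
  have pU : (P (B1 `|` B2) <= delta%:E)%E.
    apply: le_trans (measureU2 _ mB1 mB2) _.
    apply: le_trans (leeD p1 p2) _; rewrite -EFinD lee_fin; lra.
  rewrite EFinB; apply: leeB => //.
Qed.

End gaussian_blocks.

Theorem theorem3p2 (R : realType) (m n k b q : nat) (theta : R)
    (A : 'M[R]_(m, n)) (U : 'M[R]_m) (sigma : nat -> R) (V : 'M[R]_n) :
  (n <= m)%N ->
  svd A U sigma V ->
  0 < theta ->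
  (k < n)%N ->
  sigma k > theta -> theta > sigma k.+1 ->
  (1 <= b)%N -> (b <= k)%N ->
  (* deterministic bounds, for every realization Omega_1 with nonsingular Omega_hat_1 *)
  (forall (Om1 : 'M[R]_(n, b)) (Qh : 'M[R]_(m, b)) (Uh : 'M[R]_b) (ev : nat -> R),
     orthonormal_cols Qh ->
     (Qh^T == ((A *m A^T) ^+ q *m A *m Om1)^T)%MS ->
     Uh^T *m Uh = 1%:M ->
     (Qh^T *m A *m A^T *m Qh) *m Uh = Uh *m rdiag b b ev ->
     (forall j, (1 <= j)%N -> (j < b)%N -> ev j.+1 <= ev j) ->
     toprows b (V^T *m Om1) \in unitmx ->
     let Q1 := Qh *m Uh in
     let X := botrows b (V^T *m Om1) *m invmx (toprows b (V^T *m Om1)) in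
     let tau := fun j : nat => sigma b.+1 / sigma j in
     [/\ norm2 ((1%:M - Q1 *m Q1^T) *m A)
           <= Num.sqrt (1 + tau b ^+ (4 * q) * norm2 X ^+ 2)
              * norm2 (trailblock b (rdiag m n sigma)),
         normF ((1%:M - Q1 *m Q1^T) *m A)
           <= Num.sqrt (1 + tau b ^+ (4 * q) * norm2 X ^+ 2)
              * normF (trailblock b (rdiag m n sigma)),
         (forall (Us : 'M[R]_b) (s : nat -> R) (Vs : 'M[R]_n),
            svd (Q1^T *m A) Us s Vs ->
            forall j, (1 <= j <= b)%N ->
              sigma j >= s j /\
              s j >= sigma j / Num.sqrt (1 + tau j ^+ (4 * q + 2) * norm2 X ^+ 2)) &
         (forall t, (b <= t <= k)%N ->
            deviation Q1 (leadcols t U)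
              <= (sigma t.+1 / sigma b) ^+ (2 * q + 1) * norm2 X)]) /\
  (* probabilistic bound for a standard Gaussian Omega_1 *)
  (forall (delta : R), 0 < delta < 1 ->
     forall (d : measure_display) (T : measurableType d) (P : probability T R)
            (Om : T -> 'M[R]_(n, b)),
     std_gaussian_mx P Om ->
     exists E : set T,
       [/\ measurable E,
           E `<=` [set w | toprows b (V^T *m Om w) \in unitmx /\
                           norm2 (botrows b (V^T *m Om w))
                             * norm2 (invmx (toprows b (V^T *m Om w)))
                           <= Cconst n delta b b] &
           ((1 - delta)%:E <= P E)%E]).
Proof.
move=> nm [UU VV AE dec ge0] theta0 kn sk _ b0 bk.
have bn : (b < n)%N by exact: leq_ltn_trans bk kn.
split; last first.
  move=> delta d01 d T P Om gO; apply: (gauss_blocks_tail VV) => //.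
  exact: std_gaussian_mxP.
have mn : minn m n = n by exact/minn_idPr.
have sig_dec i j : (1 <= i)%N -> (i <= j)%N -> (j <= n)%N -> sigma j <= sigma i.
  by apply: nonincr_from1 => l l1 ln; apply: dec => //; rewrite mn.
have sig_ge0 j : (1 <= j <= n)%N -> 0 <= sigma j by move=> jn; apply: ge0; rewrite mn.
have sigb : 0 < sigma b.
  by apply: lt_le_trans (lt_trans theta0 sk) _; apply: sig_dec => //; exact: ltnW.
move=> Om1 Qh Uh ev QhQh; rewrite AE (svd_power q sigma nm UU VV).
set D := rdiag m n (fun j => sigma j ^+ (2 * q + 1)).
set S := rdiag b b (fun j => sigma j ^+ (2 * q + 1)).
set Si := rdiag b b (fun j => sigma j ^- (2 * q + 1)).
set O := V^T *m Om1.
(* Equality of the row spaces of the transposes is equality of the ranges; its two inclusions give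
   the factors [D1] and [D2] from which [QUE] and [UEQ] are assembled. *)
move=> /andP[/submxP[D1 QhD1] /submxP[D2 YD2]] UhUh _ _ uO Q1 X tau.
have OE : U *m D *m V^T *m Om1 = U *m D *m O by rewrite -!mulmxA.
have {}QhD1 : Qh = U *m D *m O *m D1^T.
  by apply: trmx_inj; rewrite trmx_mul trmxK QhD1 OE.
have {}YD2 : U *m D *m O = Qh *m D2^T.
  by apply: trmx_inj; rewrite [RHS]trmx_mul trmxK -YD2 OE.
pose Oi := O *m invmx (toprows b O).
have topOi : toprows b Oi = 1%:M by rewrite toprows_mul mulmxV.
have XE : X = botrows b Oi by rewrite botrows_mul.
have SiS : Si *m S = 1%:M.
  rewrite rdiagM// -[RHS]rdiag1; apply: eq_rdiag => j /andP[j1 jb].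
  rewrite mulVf// expf_neq0// gt_eqF//; apply: lt_le_trans sigb _.
  by apply: sig_dec => //; exact: ltnW.
have QQ : Q1^T *m Q1 = 1%:M.
  by rewrite trmx_mul -mulmxA (mulmxA Qh^T) QhQh mul1mx.
have UhUh' : Uh *m Uh^T = 1%:M by exact: mulmx1C.
(* [Uh] is orthogonal, so [Q1] and [Qh] have the same range; the remaining factors undo the
   normalization of the upper block and of the scaling. *)
have UEQ : U *m range_basis m q sigma Oi = Q1 *m (Uh^T *m D2^T *m invmx (toprows b O) *m Si).
  rewrite /range_basis -/D -/Si /Oi /Q1 !mulmxA -(mulmxA Qh) UhUh' mulmx1 -YD2.
  by rewrite !mulmxA.
have QUE : Q1 = U *m range_basis m q sigma Oi *m (S *m toprows b O *m D1^T *m Uh).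
  rewrite /range_basis -/D -/Si /Oi /Q1 {1}QhD1 !mulmxA -(mulmxA _ Si) SiS mulmx1.
  by rewrite -(mulmxA _ (invmx _)) mulVmx// mulmx1.
rewrite XE; split.
- exact: (residual_norm2_le nm bn sig_dec sig_ge0 sigb topOi UU VV QQ UEQ).
- exact: (residual_normF_le nm bn sig_dec sig_ge0 sigb topOi UU VV QQ UEQ).
- move=> Us s Vs sB j jb; split.
    exact: (singular_value_le bn sig_dec sig_ge0 UU VV QQ sB jb).
  exact: (singular_value_ge nm bn sig_dec sig_ge0 sigb topOi UU VV QQ UEQ sB jb).
- move=> t /andP[bt tk].
  by apply: (deviation_range_le nm bn sig_dec sig_ge0 sigb topOi UU QQ QUE) => //; exact: leq_ltn_trans tk kn.
Qed.
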